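(* Cartan subalgebras of $\mathfrak{gl}_\infty$ (respectively of $\mathfrak{sl}_\infty$, $\mathfrak{so}_\infty$, or $\mathfrak{sp}_\infty$) are in one-to-one correspondence with maximal dual systems for $\mathfrak{gl}_\infty$ (respectively with maximal dual systems for $\mathfrak{sl}_\infty$, maximal self-dual systems for $\mathfrak{so}_\infty$, or maximal self-dual systems for $\mathfrak{sp}_\infty$).
   Context: Everything is over $\mathbb{C}$. $V,V_*$ are countably infinite-dimensional vector spaces with a nondegenerate pairing $\langle\cdot,\cdot\rangle:V\times V_*\to\mathbb{C}$. $\mathfrak{gl}(V,V_* )$ is the Lie algebra associated to the associative algebra $V\otimes V_*$ with multiplication $(v\otimes w)\cdot(v'\otimes w')=\langle v',w\rangle\,v\otimes w'$; $\mathfrak{sl}(V,V_* )$ is its derived subalgebra. If $V$ carries a nondegenerate symmetric (resp. antisymmetric) bilinear form, one takes $V_*=V$ and lets $\mathfrak{so}(V)=\bigwedge^2V$ (resp. $\mathfrak{sp}(V)=\mathrm{Sym}^2(V)$) inside $V\otimes V$ with the commutator bracket. Up to isomorphism these Lie algebras do not depend on $V,V_*$ and the pairing or form, and they are denoted $\mathfrak{gl}_\infty$, $\mathfrak{sl}_\infty$, $\mathfrak{so}_\infty$, $\mathfrak{sp}_\infty$. Each of these Lie algebras $\mathfrak{g}$ is a union of nested finite-dimensional reductive subalgebras $\mathfrak{g}_i$ with $\mathfrak{g}_i$ reductive in $\mathfrak{g}_{i+1}$; semisimple and nilpotent elements and the Jordan decomposition $x=x_{ss}+x_{nil}$ of an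 element are inherited from the $\mathfrak{g}_i$ (nilpotent elements lie in $[\mathfrak{g}_i,\mathfrak{g}_i]$). For a subalgebra $\mathfrak{h}\subseteq\mathfrak{g}$ put $\mathfrak{h}_{ss}:=\{h_{ss}:h\in\mathfrak{h}\}$. A subalgebra $\mathfrak{h}$ is a Cartan subalgebra if it is locally nilpotent (every finite subset lies in a nilpotent subalgebra) and $\mathfrak{h}$ equals the centralizer $\mathfrak{z}_{\mathfrak{g}}(\mathfrak{h}_{ss})$ of $\mathfrak{h}_{ss}$ in $\mathfrak{g}$. A dual system for $\mathfrak{gl}(V,V_* )$ or for $\mathfrak{sl}(V,V_* )$ is a set of one-dimensional subspaces $L_i\subseteq V$ and $L^i\subseteq V_*$, $i\in I$, such that $\langle L_i,L^j\rangle=\delta_{ij}\mathbb{C}$, where $I$ is a finite set or $\mathbb{Z}_{>0}$. A self-dual system for $\mathfrak{so}(V)$ or for $\mathfrak{sp}(V)$ is a set of one-dimensional subspaces $L_i\subseteq V$, $i\in I$, such that $\langle L_i,L_j\rangle=\delta_{i,-j}\mathbb{C}$, where $I$ is a finite subset of $\mathbb{Z}_{\neq0}$ with $-I=I$, or $I=\mathbb{Z}_{\neq0}$. A (self-)dual system is maximal if it is not properly contained in another one. *)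

(* Defs.v *)
From HB Require Import structures.
From mathcomp Require Import all_boot all_order all_algebra.
From mathcomp Require Import all_classical reals.
From mathcomp Require Import complex.

Set Implicit Arguments.
Unset Strict Implicit.
Unset Printing Implicit Defensive.
Import Order.TTheory GRing.Theory Num.Theory.
Local Open Scope classical_set_scope.
Local Open Scope ring_scope.

(* The ground field is R[i] for R : realType, i.e. the complex numbers.
   Subspaces of possibly infinite-dimensional spaces are predicates (set U). *)

Section LinearAlgebra.
Context {K : fieldType}.

Definition subspace (U : lmodType K) (S : set U) : Prop :=
  S 0 /\ forall (a : K) (x y : U), S x -> S y -> S (a *: x + y).

Definition lin_span (U : lmodType K) (A : set U) : set U :=
  smallest (@subspace U) A.

Definition finite_dim (U : lmodType K) (S : set U) : Prop :=
  exists A : set U, finite_set A /\ S = lin_span A.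

Definition countably_infinite_dim (U : lmodType K) : Prop :=
  exists e : nat -> U,
    lin_span (range e) = setT /\
    forall (n : nat) (c : 'I_n -> K),
      \sum_(i < n) c i *: e i = 0 -> forall i, c i = 0.

Definition line (U : lmodType K) (L : set U) : Prop :=
  exists2 v : U, v != 0 & L = [set a *: v | a in [set: K]].

Definition nondegenerate_pairing (V W : lmodType K) (b : V -> W -> K) : Prop :=
  (forall v, (forall w, b v w = 0) -> v = 0) /\
  (forall w, (forall v, b v w = 0) -> w = 0).

(* The universal property of t : V x W -> T. *)
Definition is_tensor_product (V W T : lmodType K)
    (t : {bilinear V -> W -> T}) : Prop :=
  forall (U : lmodType K) (f : {bilinear V -> W -> U}),
    exists! g : T -> U, linear g /\ forall v w, g (t v w) = f v w.

End LinearAlgebra.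

(* The pairing of V and V_* = W together with the associative algebra
   V (x) V_* that it defines. *)
Record tensor_algebra (R : realType) (V W : lmodType R[i]) := TensorAlgebra {
  pairing : {bilinear V -> W -> R[i] | *%R & *%R};
  carrier :> lmodType R[i];
  tens : {bilinear V -> W -> carrier};
  tmul : {bilinear carrier -> carrier -> carrier};
  dim_left : countably_infinite_dim V;
  dim_right : countably_infinite_dim W;
  pairing_nondeg : nondegenerate_pairing pairing;
  tensP : is_tensor_product tens;
  tmulE : forall v w v' w',
    tmul (tens v w) (tens v' w') = pairing v' w *: tens v w'
}.

Section Lie.
Context {R : realType} {V W : lmodType R[i]} (T : tensor_algebra V W).
Implicit Types (x y s n : T) (A g h k l : set T).

Definition bracket x y : T := tmul T x y - tmul T y x.

Definition lie_subalgebra k : Prop :=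
  subspace k /\ forall x y, k x -> k y -> k (bracket x y).

Definition bracket_span k l : set T :=
  lin_span [set z | exists x y, [/\ k x, l y & z = bracket x y]].

Definition derived k : set T := bracket_span k k.

Definition lower_central k (m : nat) : set T := iter m (bracket_span k) k.

Definition nilpotent_lie k : Prop := exists m, lower_central k m = [set 0].

Definition locally_nilpotent h : Prop :=
  forall A, finite_set A -> A `<=` h ->
    exists k, [/\ lie_subalgebra k, k `<=` h, A `<=` k & nilpotent_lie k].

Definition centralizer g A : set T :=
  [set x | g x /\ forall a, A a -> bracket x a = 0].

Definition submodule k l (M : set T) : Prop :=
  [/\ subspace M, M `<=` l & forall x y, k x -> M y -> M (bracket x y)].

(* l is semisimple (completely reducible) as a k-module; for k = l this says
   that the adjoint representation of k is semisimple, i.e. k is reductive. *)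
Definition reductive_in k l : Prop :=
  forall M, submodule k l M ->
    exists M', [/\ submodule k l M', M `&` M' = [set 0] &
                   l = [set z | exists x y, [/\ M x, M' y & z = x + y]]].

Definition reductive_exhaustion g (F : nat -> set T) : Prop :=
  [/\ forall i, [/\ lie_subalgebra (F i), finite_dim (F i) &
                    reductive_in (F i) (F i)],
      forall i, F i `<=` F i.+1 /\ reductive_in (F i) (F i.+1) &
      g = \bigcup_i F i].

(* Semisimple and nilpotent elements of a finite-dimensional reductive k. *)
Definition semisimple_elt k s : Prop :=
  k s /\ k `<=` lin_span [set y | k y /\ exists a, bracket s y = a *: y].

Definition nilpotent_elt k n : Prop :=
  derived k n /\ exists m, forall y, k y -> iter m (bracket n) y = 0.

Definition jordan_in k x s n : Prop :=
  [/\ semisimple_elt k s, nilpotent_elt k n, bracket s n = 0 & x = s + n].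

Definition ss_parts (F : nat -> set T) h : set T :=
  [set s | exists2 x, h x & exists i n, jordan_in (F i) x s n].

Definition cartan_subalgebra g (F : nat -> set T) h : Prop :=
  [/\ lie_subalgebra h, h `<=` g, locally_nilpotent h &
      h = centralizer g (ss_parts F h)].

Definition gl_alg : set T := setT.

Definition sl_alg : set T := derived gl_alg.

Definition pair_sets (L : set V) (M : set W) : set R[i] :=
  [set c | exists v w, [/\ L v, M w & c = pairing T v w]].

(* Systems are unlabelled: a dual system is the pair of sets
   ({L_i | i in I}, {L^i | i in I}), so that re-indexing does not change it. *)
Definition dual_system (D : set (set V) * set (set W)) : Prop :=
  exists (I : set nat) (L : nat -> set V) (M : nat -> set W),
    [/\ finite_set I \/ I = [set i | (0 < i)%N],
        forall i, I i -> line (L i) /\ line (M i),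
        forall i j, I i -> I j ->
          pair_sets (L i) (M j) = if i == j then setT else [set 0],
        D.1 = L @` I & D.2 = M @` I].

Definition maximal_dual_system (D : set (set V) * set (set W)) : Prop :=
  dual_system D /\
  forall D', dual_system D' -> D.1 `<=` D'.1 -> D.2 `<=` D'.2 -> D' = D.

(* Only the products L_i (x) L^i contribute (L_i (x) L_(-i) in the self-dual
   case), as the other pairs of lines are orthogonal; hence this is the
   intersection of g with the sum of these products. *)
Definition system_torus g (D : set (set V) * set (set W)) : set T :=
  g `&` lin_span [set z | exists v w,
    [/\ exists2 L, D.1 L & L v, exists2 M, D.2 M & M w,
        pairing T v w != 0 & z = tens T v w]].

Definition system_cartan g (D : set (set V) * set (set W)) : set T :=
  centralizer g (system_torus g D).

End Lie.

Section SelfDual.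
Context {R : realType} {V : lmodType R[i]} (T : tensor_algebra V V).

Definition symmetric_pairing : Prop :=
  forall u v, pairing T u v = pairing T v u.

Definition antisymmetric_pairing : Prop :=
  forall u v, pairing T u v = - pairing T v u.

Definition so_alg : set T :=
  lin_span [set z | exists u v, z = tens T u v - tens T v u].

Definition sp_alg : set T :=
  lin_span [set z | exists u v, z = tens T u v + tens T v u].

Definition self_dual_system (D : set (set V)) : Prop :=
  exists (I : set int) (L : int -> set V),
    [/\ (finite_set I /\ I `<=` [set i | i != 0] /\
           forall i, I i <-> I (- i)) \/
        I = [set i | i != 0],
        forall i, I i -> line (L i),
        forall i j, I i -> I j ->
          pair_sets T (L i) (L j) = if i == - j then setT else [set 0] &
        D = L @` I].

Definition maximal_self_dual_system (D : set (set V)) : Prop :=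
  self_dual_system D /\
  forall D', self_dual_system D' -> D `<=` D' -> D' = D.

End SelfDual.

Arguments gl_alg {R V W} T _.
Arguments sl_alg {R V W} T _.
Arguments so_alg {R V} T _.
Arguments sp_alg {R V} T _.

(* Main.v *)
(** Everything happens in the algebra [V (x) W] of finite-rank operators.  Each
    of the four Lie algebras g contains the additive Jordan components of its
    elements and has no operator commuting with it, and this forces the Jordan
    decompositions taken inside the [F i] to be those of operators.

    If h is Cartan and S is the set of its semisimple parts, then S is a
    commuting family contained in h.  Its spectral projections lie in the double
    centralizer of S; a minimal one, p, is such that the corner pTp commutes with
    S, so local nilpotence of h forces p to have rank one.  The ranges of these
    orthogonal rank-one idempotents form the system, g meets their span exactly
    in S, and maximality holds because an idempotent orthogonal to all of them
    would give one more semisimple element commuting with S.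

    Conversely, for a maximal system an element of the centralizer of the torus
    is s + y, with s in the torus and y annihilated by the idempotents, and
    products of three such y vanish: for gl, sl and sp because the annihilators of
    the system pair to zero, for so because a space without hyperbolic planes
    carries a symmetric form of rank at most one.  Hence the centralizer is
    nilpotent of class at most two and its semisimple parts are the torus.  The
    idempotents are recovered as the rank-one idempotents e commuting with h such
    that e x = e for some x in h. *)

Require Import Defs.
From HB Require Import structures.
From mathcomp Require Import all_boot all_order all_algebra.
From mathcomp Require Import all_classical reals.
From mathcomp Require Import complex.
From mathcomp Require Import ring.

Set Implicit Arguments.
Unset Strict Implicit.
Unset Printing Implicit Defensive.
Import Order.TTheory GRing.Theory Num.Theory.
Local Open Scope classical_set_scope.
Local Open Scope ring_scope.

(** * Linear operators *)

(** [T] has no unit, and no nonzero idempotent lies in sl, so or sp: its trace is its rank, and a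
    skew idempotent would equal its own negative. Hence functional calculus uses only polynomials
    without constant term, which give spectral projections at nonzero eigenvalues alone, and an
    idempotent e of the system is seen by g only through a difference e - f, where f is another
    idempotent of the system (gl, sl) or the adjoint of e (so, sp).

    Semisimplicity inside [F i] is a condition on the adjoint action, hence blind to central
    elements. Reductivity of each [F i] in the next one carries commutation up the chain, until the
    absence of operators commuting with g decides.

    A corner of rank at least two contains traceless x, y with [x, y] = 2y and y nonzero, which
    local nilpotence forbids. The traces are zero so that sl contains the pair; for so and sp it is
    replaced by x - x', y - y', with ' the adjoint, which satisfy the same relation because p and
    its adjoint are orthogonal. *)

Section Subspaces.
Context {K : fieldType} {U : lmodType K}.
Implicit Types (S A B : set U) (x y : U).

Lemma subspaceD S x y : subspace S -> S x -> S y -> S (x + y).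
Proof. by case=> _ hS Sx Sy; rewrite -[x]scale1r; exact: hS. Qed.

Lemma subspaceZ S a x : subspace S -> S x -> S (a *: x).
Proof. by case=> S0 hS Sx; rewrite -[_ *: _]addr0; exact: hS. Qed.

Lemma subspaceN S x : subspace S -> S x -> S (- x).
Proof. by move=> hS Sx; rewrite -scaleN1r; exact: subspaceZ. Qed.

Lemma subspaceB S x y : subspace S -> S x -> S y -> S (x - y).
Proof. by move=> hS Sx Sy; apply: subspaceD => //; exact: subspaceN. Qed.

Lemma subspace_sum (I : eqType) S (r : seq I) (f : I -> U) :
  subspace S -> (forall i, i \in r -> S (f i)) -> S (\sum_(i <- r) f i).
Proof.
move=> hS hf; rewrite big_seq; apply: (big_ind S) => //; first by case: hS.
by move=> x y; exact: subspaceD.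
Qed.

Lemma subspaceT : subspace [set: U].
Proof. by []. Qed.

Lemma subspaceI S A : subspace S -> subspace A -> subspace (S `&` A).
Proof.
move=> [S0 hS] [A0 hA]; split=> // a x y [Sx Ax] [Sy Ay].
by split; [exact: hS | exact: hA].
Qed.

Lemma subspace_lin_span A : subspace (lin_span A).
Proof.
split=> [B [[]]//|a x y Ax Ay B hB]; case: (hB) => [[_ h] _].
by apply: h; [exact: Ax|exact: Ay].
Qed.

Lemma sub_lin_span A : A `<=` lin_span A.
Proof. exact: sub_smallest. Qed.

Lemma lin_span_sub A S : subspace S -> A `<=` S -> lin_span A `<=` S.
Proof. by move=> hS hA; exact: smallest_sub. Qed.

Lemma lin_spanS A B : A `<=` B -> lin_span A `<=` lin_span B.
Proof.
move=> AB; apply: lin_span_sub; first exact: subspace_lin_span.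
exact: (subset_trans AB (@sub_lin_span B)).
Qed.

End Subspaces.

Section LinearMaps.
Context {K : fieldType} {U U' : lmodType K} (phi : U -> U').
Implicit Types (a : K) (u v : U).
Hypothesis phiP : forall a u v, phi (a *: u + v) = a *: phi u + phi v.

Lemma lin_op0 : phi 0 = 0.
Proof. by have /eqP := phiP 1 0 0; rewrite !scale1r addr0 -subr_eq0 opprD addNKr oppr_eq0 => /eqP. Qed.

Lemma lin_opZ a u : phi (a *: u) = a *: phi u.
Proof. by rewrite -[a *: u]addr0 phiP lin_op0 addr0. Qed.

Lemma lin_opD u v : phi (u + v) = phi u + phi v.
Proof. by rewrite -{1}[u]scale1r phiP scale1r. Qed.

Lemma lin_opN u : phi (- u) = - phi u.
Proof. by rewrite -scaleN1r lin_opZ scaleN1r. Qed.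

Lemma lin_opB u v : phi (u - v) = phi u - phi v.
Proof. by rewrite lin_opD lin_opN. Qed.

Lemma lin_op_sum I (r : seq I) (P : pred I) (f : I -> U) :
  phi (\sum_(i <- r | P i) f i) = \sum_(i <- r | P i) phi (f i).
Proof. exact: (big_morph phi lin_opD lin_op0). Qed.

Lemma subspace_ker : subspace [set u | phi u = 0].
Proof.
split=> [|b u v /= hu hv]; first by rewrite /= lin_op0.
by rewrite phiP hu hv scaler0 addr0.
Qed.

End LinearMaps.

(** * Polynomials in a linear operator *)

Section PolynomialAction.
Context {K : fieldType} {U : lmodType K}.
Implicit Types (p q : {poly K}) (a b c : K) (u v : U) (N : set U).

Section Pev.
Variable phi : U -> U.
Hypothesis phiP : forall a u v, phi (a *: u + v) = a *: phi u + phi v.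

Lemma iter_lin n a u v : iter n phi (a *: u + v) = a *: iter n phi u + iter n phi v.
Proof. by elim: n => //= n ->. Qed.

Lemma subspace_eigen a : subspace [set u | phi u = a *: u].
Proof.
split=> [|b u v /= hu hv]; first by rewrite /= (lin_op0 phiP) scaler0.
by rewrite /= phiP hu hv scalerDr !scalerA mulrC.
Qed.

End Pev.

(** The vector p([phi])(u), defined for a bare function so that one theory serves [act x] on vectors
    and [bracket x], [tmul T x] and right multiplications on [T]. *)
Definition poly_act (phi : U -> U) p u := \sum_(i < size p) p`_i *: iter i phi u.

End PolynomialAction.

Lemma poly_act_morph (K : fieldType) (U U' : lmodType K)
    (phi : U -> U) (phi' : U' -> U') (psi : U -> U') p u :
  (forall a x y, psi (a *: x + y) = a *: psi x + psi y) ->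
  (forall x, psi (phi x) = phi' (psi x)) ->
  psi (poly_act phi p u) = poly_act phi' p (psi u).
Proof.
move=> psiP hc; rewrite /poly_act (lin_op_sum psiP); apply: eq_bigr => i _.
rewrite (lin_opZ psiP); congr (_ *: _).
by elim: (i : nat) => //= k IH; rewrite hc IH.
Qed.

Section PolynomialActionTheory.
Context {K : fieldType} {U : lmodType K}.
Implicit Types (p q : {poly K}) (a b c : K) (u v : U) (N : set U).

Section PevTheory.
Variable phi : U -> U.
Hypothesis phiP : forall a u v, phi (a *: u + v) = a *: phi u + phi v.
Local Notation pev := (poly_act phi).

Lemma poly_act_widen n p u : (size p <= n)%N ->
  pev p u = \sum_(i < n) p`_i *: iter i phi u.
Proof.
move=> le_pn; rewrite /poly_act (big_ord_widen n (fun i => p`_i *: iter i phi u)) //.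
rewrite big_mkcond; apply: eq_bigr => i _; case: ltnP => // le_pi.
by rewrite nth_default ?scale0r.
Qed.

Lemma poly_actP p a u v : pev p (a *: u + v) = a *: pev p u + pev p v.
Proof.
rewrite /poly_act scaler_sumr -big_split /=; apply: eq_bigr => i _.
by rewrite iter_lin // scalerDr !scalerA mulrC.
Qed.

Lemma poly_actD p q u : pev (p + q) u = pev p u + pev q u.
Proof.
rewrite (@poly_act_widen (maxn (size p) (size q)) (p + q)) ?size_polyD //.
rewrite (@poly_act_widen (maxn (size p) (size q)) p) ?leq_maxl //.
rewrite (@poly_act_widen (maxn (size p) (size q)) q) ?leq_maxr // -big_split /=.
by apply: eq_bigr => i _; rewrite coefD scalerDl.
Qed.

Lemma poly_actZ c p u : pev (c *: p) u = c *: pev p u.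
Proof.
rewrite (@poly_act_widen (size p) (c *: p)) ?size_scale_leq // /poly_act scaler_sumr.
by apply: eq_bigr => i _; rewrite coefZ scalerA.
Qed.

Lemma poly_actC c u : pev c%:P u = c *: u.
Proof.
rewrite (@poly_act_widen 1) ?size_polyC_leq1 // big_ord1 /=.
by rewrite coefC.
Qed.

Lemma poly_act0 u : pev 0 u = 0.
Proof. by rewrite -polyC0 poly_actC scale0r. Qed.

Lemma poly_act1 u : pev 1 u = u.
Proof. by rewrite -polyC1 poly_actC scale1r. Qed.

Lemma poly_actN p u : pev (- p) u = - pev p u.
Proof. by rewrite -(scaleN1r p) poly_actZ scaleN1r. Qed.

Lemma poly_actB p q u : pev (p - q) u = pev p u - pev q u.
Proof. by rewrite poly_actD poly_actN. Qed.

Lemma poly_actMX p u : pev (p * 'X) u = pev p (phi u).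
Proof.
rewrite (@poly_act_widen (size p).+1); last first.
  by have [->|p0] := eqVneq p 0; rewrite ?mul0r ?size_poly0 // size_mulX.
rewrite big_ord_recl coefMX /= scale0r add0r /poly_act.
by apply: eq_bigr => i _; rewrite coefMX /= -iterSr.
Qed.

Lemma poly_actX u : pev 'X u = phi u.
Proof. by rewrite -['X]mul1r poly_actMX poly_act1. Qed.

Lemma poly_actM p q u : pev (p * q) u = pev p (pev q u).
Proof.
elim/poly_ind: q u => [|q c IH] u; first by rewrite mulr0 !poly_act0 (lin_op0 (poly_actP p)).
rewrite mulrDr mulrA !poly_actD !poly_actMX IH poly_actC (lin_opD (poly_actP p)).
rewrite (mulrC p) mul_polyC. by rewrite poly_actZ (lin_opZ (poly_actP p)).
Qed.

Lemma poly_act_comm p q u : pev p (pev q u) = pev q (pev p u).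
Proof. by rewrite -!poly_actM mulrC. Qed.

Lemma poly_act_dvd p q u : p %| q -> pev p u = 0 -> pev q u = 0.
Proof. by move=> /dvdpP[r ->] h; rewrite poly_actM h (lin_op0 (poly_actP r)). Qed.

Lemma poly_act_coprime p q u : coprimep p q -> pev p u = 0 -> pev q u = 0 -> u = 0.
Proof.
move=> /Bezout_eq1_coprimepP[[r s] /= e] hp hq.
by rewrite -(poly_act1 u) -e poly_actD !poly_actM hp hq (lin_op0 (poly_actP r)) (lin_op0 (poly_actP s)) addr0.
Qed.

Lemma poly_act_stable N p u : subspace N -> (forall x, N x -> N (phi x)) ->
  N u -> N (pev p u).
Proof.
move=> hN hphi Nu; apply: subspace_sum => // i _; apply: subspaceZ => //.
by elim: (i : nat) => //= k; exact: hphi.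
Qed.

Lemma poly_act_eigen p a u : phi u = a *: u -> pev p u = p.[a] *: u.
Proof.
move=> h; rewrite /poly_act horner_coef scaler_suml; apply: eq_bigr => i _.
rewrite -scalerA; congr (_ *: _); elim: (i : nat) => [|k /= ->].
  by rewrite expr0 scale1r.
by rewrite lin_opZ // h scalerA exprSr.
Qed.

Lemma poly_act_XsubC a u : pev ('X - a%:P) u = phi u - a *: u.
Proof. by rewrite poly_actB poly_actX poly_actC. Qed.

Lemma poly_act_Xn n u : pev 'X^n u = iter n phi u.
Proof. by elim: n u => [|n IH] u; rewrite ?expr0 ?poly_act1 // exprSr poly_actMX IH -iterSr. Qed.

Lemma subspace_pev p : subspace [set u | pev p u = 0].
Proof. exact: subspace_ker (poly_actP p). Qed.

Lemma XsubC_coprime (s : seq K) a m n : a \notin s ->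
  coprimep (('X - a%:P) ^+ m) ((\prod_(b <- s) ('X - b%:P)) ^+ n).
Proof.
move=> ha; apply: coprimep_expl; apply: coprimep_expr.
by rewrite coprimep_sym coprimep_XsubC root_prod_XsubC.
Qed.

(** A Bezout relation between the power of 'X - a and that of the remaining factors splits u into
    two polynomials in [phi] applied to u. Both stay in [N]; one is handled by induction, the other
    is killed by the power of 'X - a. *)
Lemma primary_decomposition N (s : seq K) m u :
  subspace N -> (forall x, N x -> N (phi x)) -> uniq s ->
  N u -> pev ((\prod_(a <- s) ('X - a%:P)) ^+ m) u = 0 ->
  lin_span [set z | N z /\ exists2 a, a \in s & pev (('X - a%:P) ^+ m) z = 0] u.
Proof.
move=> hN hphi; elim: s u => [|a s IH] u.
  by move=> _ _; rewrite big_nil expr1n poly_act1 => ->; exact: (subspace_lin_span _).1.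
rewrite /= big_cons exprMn => /andP[ha us] Nu hu.
have /Bezout_eq1_coprimepP[[r t] /= e] := XsubC_coprime m m ha.
rewrite -(poly_act1 u) -e poly_actD; apply: (subspaceD (subspace_lin_span _)).
- have h : pev ((\prod_(b <- s) ('X - b%:P)) ^+ m) (pev (r * ('X - a%:P) ^+ m) u) = 0.
    by rewrite -poly_actM mulrCA poly_actM [X in pev X u]mulrC hu (lin_op0 (poly_actP _)).
  move: (IH _ us (poly_act_stable _ hN hphi Nu) h); apply: lin_spanS => z [Nz [b bs hb]].
  by split => //; exists b => //; rewrite inE bs orbT.
- apply: sub_lin_span; split; first exact: poly_act_stable.
  by exists a; rewrite ?mem_head // -poly_actM mulrCA poly_actM hu (lin_op0 (poly_actP _)).
Qed.

End PevTheory.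

Definition diagonal_op (phi : U -> U) :=
  forall u, lin_span [set y | exists a, phi y = a *: y] u.

(** The eigenvectors that add up to u may lie outside [N]. They show that u is killed by a product
    of distinct linear factors, and the primary decomposition with exponent 1 then takes place
    inside [N]. *)
Lemma diagonal_sub phi N u :
  (forall a u v, phi (a *: u + v) = a *: phi u + phi v) ->
  subspace N -> (forall x, N x -> N (phi x)) -> diagonal_op phi -> N u ->
  lin_span [set z | N z /\ exists a, phi z = a *: z] u.
Proof.
move=> phiP hN hphi hd Nu.
(* Quantifying over all lists that contain r makes [Q] additive, by concatenation, and allows
   repetitions to be removed afterwards. *)
pose Q x := exists r : seq K, forall s, {subset r <= s} ->
  poly_act phi (\prod_(a <- s) ('X - a%:P)) x = 0.
have hQ : subspace Q.
  split; first by exists [::] => s _; rewrite (lin_op0 (poly_actP phiP _)).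
  move=> a x y [r hr] [r' hr']; exists (r ++ r') => s hs.
  rewrite (poly_actP phiP) hr ?hr' ?scaler0 ?addr0 // => b hb; apply: hs;
    by rewrite mem_cat hb ?orbT.
have [r hr] : Q u.
  apply: (@lin_span_sub _ _ _ _ hQ _ _ (hd u)) => y [a ya].
  exists [:: a] => s hs; rewrite (poly_act_eigen phiP _ ya).
  have /eqP-> : root (\prod_(b <- s) ('X - b%:P)) a.
    by rewrite root_prod_XsubC hs ?mem_head.
  by rewrite scale0r.
have h : poly_act phi ((\prod_(a <- undup r) ('X - a%:P)) ^+ 1) u = 0.
  by rewrite expr1; apply: hr => b; rewrite mem_undup.
move: (primary_decomposition phiP hN hphi (undup_uniq r) Nu h).
apply: lin_spanS => z [Nz [a _]]; rewrite expr1 poly_act_XsubC // => /eqP.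
by rewrite subr_eq0 => /eqP za; split => //; exists a.
Qed.

Lemma diagonalD phi psi :
  (forall a u v, phi (a *: u + v) = a *: phi u + phi v) ->
  (forall a u v, psi (a *: u + v) = a *: psi u + psi v) ->
  (forall u, phi (psi u) = psi (phi u)) ->
  diagonal_op phi -> diagonal_op psi -> diagonal_op (fun u => phi u + psi u).
Proof.
move=> phiP psiP hc hphi hpsi u.
apply: (@lin_span_sub _ _ _ _ (subspace_lin_span _) _ _ (hphi u)) => y [a ya].
have st x : phi x = a *: x -> phi (psi x) = a *: psi x.
  by move=> xa; rewrite hc xa (lin_opZ psiP).
move: (diagonal_sub psiP (subspace_eigen phiP a) st hpsi ya); apply: lin_spanS.
by move=> z [/= za [b zb]]; exists (a + b); rewrite za zb scalerDl.
Qed.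


Section JordanParts.
Variables phi sigma nu : U -> U.
Hypothesis sigmaP : forall a u v, sigma (a *: u + v) = a *: sigma u + sigma v.
Hypothesis nuP : forall a u v, nu (a *: u + v) = a *: nu u + nu v.
Hypothesis phiE : forall u, phi u = sigma u + nu u.
Hypothesis comm : forall u, sigma (nu u) = nu (sigma u).
Hypothesis dsigma : diagonal_op sigma.
Hypothesis nnu : forall u, exists k, iter k nu u = 0.

Let phiP a u v : phi (a *: u + v) = a *: phi u + phi v.
Proof. by rewrite !phiE sigmaP nuP scalerDr addrACA. Qed.

(** On the b-eigenspace of [sigma], which [nu] preserves, [phi] - b is [nu]. *)
Lemma eigen_generalized b z : sigma z = b *: z ->
  exists k, poly_act phi (('X - b%:P) ^+ k) z = 0.
Proof.
move=> zb; have [k hk] := nnu z; exists k; rewrite -{}hk.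
elim: k => [|k IH]; first by rewrite expr0 poly_act1.
rewrite exprS poly_actM // IH poly_act_XsubC // phiE.
have -> : sigma (iter k nu z) = b *: iter k nu z.
  elim: k {IH} => //= k IH; by rewrite comm IH (lin_opZ nuP).
by rewrite addrAC subrr add0r.
Qed.

(** The kernel of ([phi] - a)^m is stable under [sigma], hence spanned by eigenvectors of [sigma] in
    it; one with eigenvalue b other than a would be killed by two coprime polynomials in [phi]. *)
Lemma generalized_eigen a m y : poly_act phi (('X - a%:P) ^+ m) y = 0 -> sigma y = a *: y.
Proof.
move=> ya; pose N := [set z | poly_act phi (('X - a%:P) ^+ m) z = 0].
have sN z : N z -> N (sigma z).
  rewrite /N /= => h; rewrite -(poly_act_morph (phi := phi)) ?h ?(lin_op0 sigmaP) //.
  by move=> x; rewrite !phiE (lin_opD sigmaP) comm.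
have := diagonal_sub sigmaP (subspace_pev phiP _) sN dsigma ya.
apply: (@lin_span_sub _ _ _ [set z | sigma z = a *: z]); first exact: subspace_eigen.
move=> z [/= Nz [b zb]]; have [<- //|nab] := eqVneq b a.
have [k hk] := eigen_generalized zb.
suff -> : z = 0 by rewrite (lin_op0 sigmaP) scaler0.
apply: (poly_act_coprime phiP _ Nz hk).
have := @XsubC_coprime [:: b] a m k; rewrite big_seq1; apply.
by rewrite inE eq_sym.
Qed.

End JordanParts.

(** Double induction in place of the binomial formula: one step of the sum gives [phi u], for which
    m drops, plus [psi u], for which n drops. *)
Lemma iter_addn_eq0 phi psi m n u :
  (forall a u v, phi (a *: u + v) = a *: phi u + phi v) ->
  (forall a u v, psi (a *: u + v) = a *: psi u + psi v) ->
  (forall u, phi (psi u) = psi (phi u)) ->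
  iter m phi u = 0 -> iter n psi u = 0 ->
  iter (m + n) (fun v => phi v + psi v) u = 0.
Proof.
move=> phiP psiP hc hm hn.
have sP a x y : phi (a *: x + y) + psi (a *: x + y) = a *: (phi x + psi x) + (phi y + psi y).
  by rewrite phiP psiP scalerDr addrACA.
have it0 k : iter k (fun v => phi v + psi v) 0 = 0.
  by elim: k => //= k ->; rewrite (lin_op0 phiP) (lin_op0 psiP) addr0.
have cphi k x : iter k psi (phi x) = phi (iter k psi x).
  by elim: k => //= k ->; rewrite hc.
have cpsi k x : iter k phi (psi x) = psi (iter k phi x).
  by elim: k => //= k ->; rewrite hc.
elim: m n u hm hn => [|m IHm] n u hm hn; first by rewrite (hm : u = 0) it0.
elim: n u hm hn => [|n IHn] u hm hn; first by rewrite (hn : u = 0) it0.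
have h1 := IHm n.+1 (phi u); have h2 := IHn (psi u).
rewrite addSn iterSr -[phi u]scale1r (iter_lin sP) h1 ?scaler0 ?add0r; last first.
- by rewrite cphi hn (lin_op0 phiP).
- by rewrite -iterSr.
rewrite -addSnnS h2 //; last by rewrite -iterSr.
by rewrite cpsi hm (lin_op0 psiP).
Qed.

End PolynomialActionTheory.

(** * Functional calculus over an algebraically closed field *)

Section ClosedField.
Context {K : closedFieldType} {U : lmodType K}.
Implicit Types (p q : {poly K}) (a b c : K) (u v : U) (N : set U).

Lemma dvdp_prod_XsubC_exp (r s : seq K) : {subset r <= s} ->
  \prod_(a <- r) ('X - a%:P) %| (\prod_(a <- s) ('X - a%:P)) ^+ (size r).
Proof.
elim: r => [|a r IH] hs; first by rewrite big_nil dvd1p.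
rewrite big_cons exprS; apply: dvdp_mul; last first.
  by apply: IH => b hb; apply: hs; rewrite inE hb orbT.
by rewrite dvdp_XsubCl root_prod_XsubC hs ?mem_head.
Qed.

(** The list r adds prescribed roots, in practice 0, to those of p; the exponent [m.+1] gives each
    of them positive multiplicity. *)
Lemma dvdp_primary (r : seq K) p : p != 0 ->
  exists s m, [/\ uniq s, {subset r <= s} &
    p %| (\prod_(a <- s) ('X - a%:P)) ^+ m.+1].
Proof.
move=> p0; have [t et] := closed_field_poly_normal p.
exists (undup (r ++ t)), (size t); split; first exact: undup_uniq.
  by move=> b hb; rewrite mem_undup mem_cat hb.
rewrite et dvdpZl ?lead_coef_eq0 // exprS; apply: dvdp_mull.
apply: dvdp_prod_XsubC_exp => b hb; by rewrite mem_undup mem_cat hb orbT.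
Qed.

Lemma crt_primary (s : seq K) m (c : K -> K) : uniq s ->
  exists P, forall a, a \in s -> ('X - a%:P) ^+ m %| P - (c a)%:P.
Proof.
elim: s => [|a s IH] /=; first by move=> _; exists 0.
case/andP=> ha us; have [P hP] := IH us.
have /Bezout_eq1_coprimepP[[r t] /= e] := XsubC_coprime m m ha.
set q := (\prod_(b <- s) _) ^+ m in e.
(* The correction is a multiple of q, so the congruences at the other roots survive; modulo the
   power of 'X - a the factor [t * q] is 1, which leaves [c a]. *)
exists (P + t * q * ((c a)%:P - P)) => b; rewrite inE => /orP[/eqP->|bs].
  have -> : P + t * q * ((c a)%:P - P) - (c a)%:P = (P - (c a)%:P) * (1 - t * q).
    by move: (c a)%:P => d; ring.
  by rewrite -e addrK !dvdp_mull.
rewrite addrAC dvdp_add ?hP // mulrAC dvdp_mull //.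
by apply: dvdp_exp2r; rewrite dvdp_XsubCl root_prod_XsubC.
Qed.

Section Operator.
Variable phi : U -> U.
Hypothesis phiP : forall a u v, phi (a *: u + v) = a *: phi u + phi v.

Lemma primary_span p u : p != 0 -> poly_act phi p u = 0 ->
  lin_span [set z | exists a m, poly_act phi (('X - a%:P) ^+ m) z = 0] u.
Proof.
move=> p0 hu; have [s [m [us _ hs]]] := dvdp_primary [::] p0.
have := primary_decomposition phiP (@subspaceT _ U) (fun _ _ => I) us I (poly_act_dvd phiP hs hu).
by apply: lin_spanS => z [_ [a _ ha]]; exists a, m.+1.
Qed.

(** The factor 'X is there because the result will be evaluated in an algebra without unit. It is
    obtained by putting 0 among the roots and interpolating with [c 0 = 0]. *)
Lemma functional_calculus p (c : K -> K) : p != 0 -> (forall u, poly_act phi p u = 0) ->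
  c 0 = 0 ->
  exists Q, forall a m u, poly_act phi (('X - a%:P) ^+ m) u = 0 ->
     poly_act phi (Q * 'X) u = c a *: u.
Proof.
move=> p0 hp c0; have [s [M [us s0 hs]]] := dvdp_primary [:: 0] p0.
have [P hP] := crt_primary M.+1 c us.
have /dvdpP[Q eQ] : 'X %| P.
  have := hP 0 (s0 0 (mem_head _ _)); rewrite c0 polyC0 !subr0; apply: dvdp_trans.
  by rewrite exprS dvdp_mulr.
exists Q => a m u hu; rewrite -eQ; apply/eqP; rewrite -subr_eq0 -[c a *: u](poly_actC phi) -poly_actB.
have [ha|ha] := boolP (a \in s); last first.
  have -> : u = 0.
    apply: (poly_act_coprime phiP (XsubC_coprime m M.+1 ha)) => //.
    exact: (poly_act_dvd phiP hs (hp u)).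
  by rewrite (lin_op0 (poly_actP phiP _)).
apply/eqP; apply: (poly_act_dvd phiP (hP a ha)).
(* The exponent m may exceed [M.+1]. Still ('X - a)^(M+1) kills u, since what it makes of u is
   killed by ('X - a)^m and by a power of the cofactor w, which are coprime. *)
have [w [ew hw]] : exists w, \prod_(b <- s) ('X - b%:P) = ('X - a%:P) * w /\ ~~ root w a.
  exists (\prod_(b <- rem a s) ('X - b%:P)).
  rewrite (perm_big _ (perm_to_rem ha)) big_cons; split => //.
  by rewrite root_prod_XsubC mem_rem_uniqF.
apply: (poly_act_coprime phiP (p := ('X - a%:P) ^+ m) (q := w ^+ M.+1)).
- by apply: coprimep_expl; apply: coprimep_expr; rewrite coprimep_sym coprimep_XsubC.
- by rewrite poly_act_comm // hu (lin_op0 (poly_actP phiP _)).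
- by rewrite -poly_actM // mulrC -exprMn -ew; apply: (poly_act_dvd phiP hs).
Qed.

End Operator.

(** Each vector is killed by some nonzero polynomial in [phi], which may depend on the vector. The
    primary components of u therefore lie in [N], and [sigma] is a scalar on each. *)
Lemma jordan_stable (phi sigma nu : U -> U) N u :
  (forall a u v, sigma (a *: u + v) = a *: sigma u + sigma v) ->
  (forall a u v, nu (a *: u + v) = a *: nu u + nu v) ->
  (forall u, phi u = sigma u + nu u) ->
  (forall u, sigma (nu u) = nu (sigma u)) ->
  diagonal_op sigma -> (forall u, exists k, iter k nu u = 0) ->
  subspace N -> (forall x, N x -> N (phi x)) -> N u -> N (sigma u).
Proof.
move=> sP nP pE hc ds nn hN sN Nu.
have phiP a x y : phi (a *: x + y) = a *: phi x + phi y.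
  by rewrite !pE sP nP scalerDr addrACA.
pose Q x := exists2 p, p != 0 & poly_act phi p x = 0.
have hQ : subspace Q.
  split; first by exists 1; rewrite ?oner_eq0 // (lin_op0 (poly_actP phiP _)).
  move=> a x y [p p0 hp] [q q0 hq]; exists (p * q); first by rewrite mulf_neq0.
  rewrite (poly_actP phiP) [X in X + _](_ : _ = 0) ?add0r.
    by apply: (poly_act_dvd phiP _ hq); rewrite dvdp_mull.
  by rewrite (poly_act_dvd phiP _ hp) ?scaler0 // dvdp_mulr.
have [p p0 hp] : Q u.
  apply: (@lin_span_sub _ _ _ _ hQ _ _ (ds u)) => y [a ya].
  have [k hk] := eigen_generalized sP nP pE hc nn ya.
  by exists (('X - a%:P) ^+ k) => //; rewrite expf_neq0 // polyXsubC_eq0.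
have [s [m [us _ hs]]] := dvdp_primary [::] p0.
have := primary_decomposition phiP hN sN us Nu (poly_act_dvd phiP hs hp).
apply: (@lin_span_sub _ _ _ [set z | N (sigma z)]).
  split; rewrite /= ?(lin_op0 sP); first by case: hN.
  by move=> a x y hx hy /=; rewrite sP; case: hN => _; apply.
move=> z [Nz [a _ ha]] /=; rewrite (generalized_eigen sP nP pE hc ds nn ha).
exact: subspaceZ.
Qed.

End ClosedField.

(** * The algebra of finite-rank operators *)

Section TensorSpan.
Context {K : fieldType} {V W T : lmodType K} (t : {bilinear V -> W -> T}).

Let tensors : set T := [set z | exists v w, z = t v w].

Definition tensor_span : {pred T} := fun x => `[< lin_span tensors x >].

Lemma tensor_span_submod : submod_closed tensor_span.
Proof.
have [h0 h] := subspace_lin_span tensors.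
split; first exact/asboolP.
by move=> a x y /asboolP hx /asboolP hy; apply/asboolP; exact: h.
Qed.

HB.instance Definition _ :=
  GRing.isSubmodClosed.Build K T tensor_span tensor_span_submod.

(** The span as a module in its own right, so that it can be the target in the universal
    property. *)
Record tensor_span_type := TensorSpanType {
  tensor_span_val : T; _ : tensor_span_val \in tensor_span }.

HB.instance Definition _ := [isSub for tensor_span_val].

HB.instance Definition _ := [Choice of tensor_span_type by <:].

HB.instance Definition _ := [SubChoice_isSubLmodule of tensor_span_type by <:].

(** The default 0 is never taken, pure tensors being in the span. *)
Definition corestrict_tensor v w : tensor_span_type :=
  insubd (0 : tensor_span_type) (t v w).

Lemma val_corestrict_tensor v w : val (corestrict_tensor v w) = t v w.
Proof.
rewrite /corestrict_tensor insubdK //; apply/asboolP.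
by apply: sub_lin_span; exists v, w.
Qed.

(* Both [id] and the corestriction of [t] to the span of the tensors followed by
   the inclusion satisfy the universal property. *)
Lemma tensor_spanP : is_tensor_product t -> forall x, lin_span tensors x.
Proof.
move=> tP x.
have bl : bilinear_for (GRing.Scale.Law.clone _ _ *:%R _)
                       (GRing.Scale.Law.clone _ _ *:%R _) corestrict_tensor.
  split=> [w|v] a u1 u2; apply: val_inj;
    rewrite linearP /= !val_corestrict_tensor ?linearPl ?linearPr //.
pose fM := bilinear_isBilinear.Build K V W tensor_span_type _ _ corestrict_tensor bl.
pose f : {bilinear V -> W -> tensor_span_type} := HB.pack corestrict_tensor fM.
have [g [[glin gE] _]] := tP _ f.
have [h [_ huniq]] := tP _ t.
have -> : x = val (g x).
  rewrite -[LHS](congr1 (fun k => k x) (huniq id _)); last by split.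
  rewrite (congr1 (fun k => k x) (huniq (fun y => val (g y)) _)) //.
  split; last by move=> v w; rewrite gE val_corestrict_tensor.
  by move=> a y z; rewrite glin linearP.
by have /asboolP := valP (g x).
Qed.

Lemma tensor_lift : is_tensor_product t ->
  forall (U : lmodType K) (f : V -> W -> U),
  (forall w a u v, f (a *: u + v) w = a *: f u w + f v w) ->
  (forall v a u w, f v (a *: u + w) = a *: f v u + f v w) ->
  exists g : T -> U, (forall a x y, g (a *: x + y) = a *: g x + g y) /\
     forall v w, g (t v w) = f v w.
Proof.
move=> tP U f fl fr.
have bl : bilinear_for (GRing.Scale.Law.clone _ _ *:%R _)
                       (GRing.Scale.Law.clone _ _ *:%R _) f.
  by split=> [w|v] a u1 u2; [exact: fl|exact: fr].
pose fM := bilinear_isBilinear.Build K V W U _ _ f bl.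
pose f' : {bilinear V -> W -> U} := HB.pack f fM.
by have [g [[glin gE] _]] := tP _ f'; exists g; split.
Qed.

End TensorSpan.

Section CountableDimension.
Context {K : fieldType} {U : lmodType K}.

Lemma infinite_dim_kernel (n : nat) (f : 'I_n -> U -> K) :
  countably_infinite_dim U ->
  (forall i a u v, f i (a *: u + v) = a * f i u + f i v) ->
  exists2 u, u != 0 & forall i, f i u = 0.
Proof.
move=> [e [_ free]] flin.
have f0 i : f i 0 = 0 by have := flin i (- 1) 0 0; rewrite scaler0 addr0 mulN1r addNr.
pose A := \matrix_(k < n.+1, i < n) f i (e k).
have rkA : (\rank (kermx A) > 0)%N.
  by rewrite mxrank_ker subn_gt0 ltnS rank_leq_col.
have [i hi] : exists i, row i (kermx A) != 0.
  apply/existsP; rewrite -negb_forall; apply: contraTN rkA => /forallP h.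
  rewrite lt0n mxrank_eq0 negbK; apply/eqP/row_matrixP => i.
  by rewrite row0; apply/eqP.
set c := row i _ in hi; have cA : c *m A = 0.
  by apply/sub_kermxP; exact: row_sub.
exists (\sum_(k < n.+1) c 0 k *: e k).
  apply: contraNneq hi => /free h; apply/eqP/rowP => k.
  by rewrite h mxE.
move=> j; have /rowP/(_ j) := cA; rewrite !mxE => <-.
rewrite (big_morph (f j) (id1 := 0) (op1 := +%R)) //; last first.
  by move=> u v; have := flin j 1 u v; rewrite scale1r mul1r.
apply: eq_bigr => k _; by rewrite !mxE -[_ *: _]addr0 flin f0 addr0.
Qed.

End CountableDimension.

Local Notation "x ** y" := (tmul _ x y) (at level 40, left associativity).

Section TensorAlgebra.
Context {R : realType} {V W : lmodType R[i]} (T : tensor_algebra V W).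
Local Notation K := R[i].
Implicit Types (x y z : T) (u v : V) (w : W) (a b c : K).

Local Notation tens := (tens T).
Local Notation pair := (pairing T).

Lemma pairPl w a u v : pair (a *: u + v) w = a * pair u w + pair v w.
Proof. by rewrite linearPl. Qed.
Lemma pairPr u a w w' : pair u (a *: w + w') = a * pair u w + pair u w'.
Proof. by rewrite linearPr. Qed.
Lemma pairZl w a u : pair (a *: u) w = a * pair u w.
Proof. by rewrite linearZl_LR. Qed.
Lemma pairZr u a w : pair u (a *: w) = a * pair u w.
Proof. by rewrite linearZr_LR. Qed.

Lemma tmulPl y a x z : (a *: x + z) ** y = a *: (x ** y) + z ** y.
Proof. by rewrite linearPl. Qed.
Lemma tmulPr y a x z : y ** (a *: x + z) = a *: (y ** x) + y ** z.
Proof. by rewrite linearPr. Qed.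
Lemma tmulZl a x y : (a *: x) ** y = a *: (x ** y).
Proof. by rewrite linearZl_LR. Qed.
Lemma tmulZr a x y : x ** (a *: y) = a *: (x ** y).
Proof. by rewrite linearZr_LR. Qed.
Lemma tmulDl x y z : (x + y) ** z = x ** z + y ** z.
Proof. by rewrite linearDl. Qed.
Lemma tmulDr x y z : x ** (y + z) = x ** y + x ** z.
Proof. by rewrite linearDr. Qed.
Lemma tmulBl x y z : (x - y) ** z = x ** z - y ** z.
Proof. by rewrite linearBl. Qed.
Lemma tmulBr x y z : x ** (y - z) = x ** y - x ** z.
Proof. by rewrite linearBr. Qed.
Lemma tmulNl x y : (- x) ** y = - (x ** y).
Proof. by rewrite linearNl. Qed.
Lemma tmulNr x y : x ** (- y) = - (x ** y).
Proof. by rewrite linearNr. Qed.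
Lemma tmul0l x : 0 ** x = 0.
Proof. by rewrite linear0l. Qed.
Lemma tmul0r x : x ** 0 = 0.
Proof. by rewrite linear0r. Qed.

Lemma tens_ind (P : set T) : subspace P -> (forall v w, P (tens v w)) -> forall x, P x.
Proof.
move=> hP ht x; apply: (lin_span_sub hP _ (tensor_spanP (@tensP _ _ _ T) x)).
by move=> _ [v [w ->]].
Qed.

Lemma act_existsP u : exists g : T -> V,
  (forall a x y, g (a *: x + y) = a *: g x + g y) /\
  forall v w, g (tens v w) = pair u w *: v.
Proof.
apply: (tensor_lift (@tensP _ _ _ T)) => [w a v v'|v a w w'].
  by rewrite scalerDr !scalerA mulrC.
by rewrite pairPr scalerDl scalerA.
Qed.

(** The operator represented by x. By [act_inj] the action is faithful, so identities in [T],
    associativity among them, are checked on vectors. *)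
Definition act x u : V := sval (cid (act_existsP u)) x.

Lemma act_tens v w u : act (tens v w) u = pair u w *: v.
Proof. by rewrite /act; case: cid => g [_ /= ->]. Qed.

Lemma actPl u a x y : act (a *: x + y) u = a *: act x u + act y u.
Proof. by rewrite /act; case: cid => g [/= -> _]. Qed.

Lemma act0l u : act 0 u = 0.
Proof. exact: (lin_op0 (actPl u)). Qed.
Lemma actDl u x y : act (x + y) u = act x u + act y u.
Proof. exact: (lin_opD (actPl u)). Qed.
Lemma actNl u x : act (- x) u = - act x u.
Proof. exact: (lin_opN (actPl u)). Qed.
Lemma actBl u x y : act (x - y) u = act x u - act y u.
Proof. exact: (lin_opB (actPl u)). Qed.
Lemma actZl u a x : act (a *: x) u = a *: act x u.
Proof. exact: (lin_opZ (actPl u)). Qed.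
Lemma actPr x a u v : act x (a *: u + v) = a *: act x u + act x v.
Proof.
move: x; apply: tens_ind.
  split=> [|b x y /= hx hy].
    by rewrite !act0l scaler0 addr0.
  by rewrite !actPl hx hy !scalerDr !scalerA mulrC addrACA.
move=> v' w; rewrite /= !act_tens pairPl scalerDl scalerA //.
Qed.

Lemma act_suml I (r : seq I) (f : I -> T) u :
  act (\sum_(i <- r) f i) u = \sum_(i <- r) act (f i) u.
Proof. exact: (lin_op_sum (actPl u)). Qed.
Lemma act0r x : act x 0 = 0.
Proof. exact: (lin_op0 (actPr x)). Qed.
Lemma actBr x u v : act x (u - v) = act x u - act x v.
Proof. exact: (lin_opB (actPr x)). Qed.
Lemma actZr x a u : act x (a *: u) = a *: act x u.
Proof. exact: (lin_opZ (actPr x)). Qed.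

Lemma actM x y u : act (x ** y) u = act x (act y u).
Proof.
move: x; apply: tens_ind.
  split=> [|b x x' /= hx hy]; first by rewrite /= tmul0l !act0l.
  by rewrite tmulPl !actPl hx hy.
move=> v w /=; move: y; apply: tens_ind.
  split=> [|b x x' /= hx hy]; first by rewrite /= tmul0r !act0l act0r.
  by rewrite tmulPr !actPl actPr hx hy.
by move=> v' w' /=; rewrite tmulE actZl !act_tens pairZl !scalerA mulrC.
Qed.

(** Stated for every N from n on, so that two expansions can be added over a common range. *)
Lemma tens_basis (e : nat -> V) : lin_span (range e) = setT -> forall x,
  exists n (w : nat -> W), forall N, (n <= N)%N -> x = \sum_(k < N) tens (e k) (w k).
Proof.
move=> espan; pose Q x := exists n (w : nat -> W), forall N, (n <= N)%N ->
  x = \sum_(k < N) tens (e k) (w k).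
have hQ : subspace Q.
  split; first by exists 0%N, (fun=> 0) => N _; rewrite big1 // => k _; rewrite linear0r.
  move=> a x y [n [w hx]] [n' [w' hy]].
  exists (maxn n n'), (fun k => a *: w k + w' k) => N; rewrite geq_max => /andP[h h'].
  rewrite {1}(hx N h) {1}(hy N h') scaler_sumr -big_split; apply: eq_bigr => k _ /=.
  by rewrite linearPr.
apply: tens_ind => // v w.
have : lin_span (range e) v by rewrite espan.
apply: (@lin_span_sub _ _ _ [set v | Q (tens v w)]).
  split; first by rewrite /= linear0l; case: hQ.
  by move=> a u u' /= hu hu'; rewrite linearPl; case: hQ => _; apply.
move=> _ [k _ <-] /=; exists k.+1, (fun j => if j == k then w else 0) => N hN.
rewrite (bigD1 (Ordinal hN)) //= eqxx big1 ?addr0 // => j; rewrite -val_eqE /= => /negbTE ->.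
by rewrite linear0r.
Qed.

Lemma act_inj x y : (forall u, act x u = act y u) -> x = y.
Proof.
move=> h; apply/eqP; rewrite -subr_eq0; apply/eqP; move: (x - y) (fun u => actBl u x y) => z hz.
have {}hz u : act z u = 0 by rewrite hz h subrr.
have [e [espan efree]] := dim_left T.
have [n [w /(_ n (leqnn n)) ez]] := tens_basis espan z.
rewrite ez big1 // => k _; suff -> : w k = 0 by rewrite linear0r.
have [_] := pairing_nondeg T; apply=> u.
have : \sum_(j < n) pair u (w j) *: e j = 0.
  rewrite -[RHS](hz u) ez.
  rewrite act_suml; apply: eq_bigr => j _.
  by rewrite act_tens.
by move=> /(efree n (fun j => pair u (w j))).
Qed.

Lemma tmulA x y z : x ** (y ** z) = x ** y ** z.
Proof. by apply: act_inj => u; rewrite !actM. Qed.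

Lemma tens_sum x : exists n (v : 'I_n.+1 -> V) (w : 'I_n.+1 -> W),
  x = \sum_(k < n.+1) tens (v k) (w k).
Proof.
have [e [espan _]] := dim_left T.
have [n [w h]] := tens_basis espan x.
by exists n, (fun k => e k), (fun k => w k); apply: h.
Qed.

Lemma tensl0 w : tens 0 w = 0. Proof. by rewrite linear0l. Qed.
Lemma tensZl a v w : tens (a *: v) w = a *: tens v w. Proof. by rewrite linearZl_LR. Qed.
Lemma tensZr a v w : tens v (a *: w) = a *: tens v w. Proof. by rewrite linearZr_LR. Qed.

Lemma tmul_tens x v w : x ** tens v w = tens (act x v) w.
Proof. by apply: act_inj => u; rewrite actM !act_tens actZr. Qed.

(** w' is the transpose of x applied to w, described only by its pairings. *)
Lemma tens_tmul v w x : exists2 w', tens v w ** x = tens v w' &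
  forall u, pair u w' = pair (act x u) w.
Proof.
suff [w' hw'] : exists w', forall u, pair u w' = pair (act x u) w.
  by exists w' => //; apply: act_inj => u; rewrite actM !act_tens hw'.
move: x; apply: tens_ind.
  split; first by exists 0 => u; rewrite linear0r act0l linear0l.
  move=> a x y [w1 h1] [w2 h2]; exists (a *: w1 + w2) => u.
  by rewrite pairPr actPl pairPl h1 h2.
by move=> v' w'; exists (pair v' w *: w') => u; rewrite act_tens pairZr pairZl mulrC.
Qed.

Lemma trace_exists : exists g : T -> K,
  (forall a x y, g (a *: x + y) = a * g x + g y) /\
  forall v w, g (tens v w) = pair v w.
Proof.
have [g hg] := tensor_lift (@tensP _ _ _ T) (U := K^o) pairPl (fun v a w w' => pairPr v a w w').
by exists g.
Qed.

Definition trace : T -> K := sval (cid trace_exists).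

Lemma trace_tens v w : trace (tens v w) = pair v w.
Proof. by rewrite /trace; case: cid => g []. Qed.
Lemma traceP a x y : trace (a *: x + y) = a * trace x + trace y.
Proof. by rewrite /trace; case: cid => g []. Qed.
Lemma traceD x y : trace (x + y) = trace x + trace y.
Proof. by rewrite -[x]scale1r traceP mul1r scale1r. Qed.
Lemma trace0 : trace 0 = 0.
Proof. by have /eqP := traceD 0 0; rewrite addr0 -subr_eq0 opprD addNKr oppr_eq0 => /eqP. Qed.
Lemma traceZ a x : trace (a *: x) = a * trace x.
Proof. by rewrite -[a *: x]addr0 traceP trace0 addr0. Qed.
Lemma traceN x : trace (- x) = - trace x.
Proof. by rewrite -scaleN1r traceZ mulN1r. Qed.
Lemma traceB x y : trace (x - y) = trace x - trace y.
Proof. by rewrite traceD traceN. Qed.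

Lemma traceC x y : trace (x ** y) = trace (y ** x).
Proof.
move: x; apply: tens_ind.
  split=> [|b x x' /= hx hy]; first by rewrite /= tmul0l tmul0r.
  by rewrite tmulPl tmulPr !traceP hx hy.
move=> v w /=; rewrite tmul_tens.
by have [w' -> hw'] := tens_tmul v w y; rewrite !trace_tens hw'.
Qed.

Lemma kernel_left (n : nat) (w : 'I_n -> W) :
  exists2 u, u != 0 & forall i, pair u (w i) = 0.
Proof.
apply: (infinite_dim_kernel (f := fun i u => pair u (w i)) (dim_left T)) => *.
exact: pairPl.
Qed.

Lemma kernel_right (n : nat) (v : 'I_n -> V) :
  exists2 w, w != 0 & forall i, pair (v i) w = 0.
Proof.
apply: (infinite_dim_kernel (f := fun i w => pair (v i) w) (dim_right T)) => *.
exact: pairPr.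
Qed.

Lemma act_kernel x : exists2 u, u != 0 & act x u = 0.
Proof.
have [n [v [w ->]]] := tens_sum x; have [u u0 hu] := kernel_left w.
exists u => //; rewrite act_suml big1 // => k _.
by rewrite act_tens hu scale0r.
Qed.

Lemma dual_left u : u != 0 -> exists w, pair u w = 1.
Proof.
move=> u0; have [w hw] : exists w, pair u w != 0.
  apply: contrapT => h; move/eqP: u0; apply; case: (pairing_nondeg T) => + _; apply=> w.
  by apply/eqP; apply: contrapT => /negP h'; apply: h; exists w.
by exists ((pair u w)^-1 *: w); rewrite pairZr mulVf.
Qed.

Lemma dual_right w : w != 0 -> exists u, pair u w = 1.
Proof.
move=> w0; have [u hu] : exists u, pair u w != 0.
  apply: contrapT => h; move/eqP: w0; apply; case: (pairing_nondeg T) => _; apply=> u.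
  by apply/eqP; apply: contrapT => /negP h'; apply: h; exists u.
by exists ((pair u w)^-1 *: u); rewrite pairZl mulVf.
Qed.

End TensorAlgebra.

(** * Equations, traces and Jordan decompositions of finite-rank operators *)

Section Jordan.
Context {R : realType} {V W : lmodType R[i]} (T : tensor_algebra V W).
Local Notation K := R[i].
Implicit Types (x y s n : T) (u v : V) (w : W) (a b : K).
Local Notation tens := (tens T).
Local Notation pair := (pairing T).

Section FiniteRank.
Variables (n : nat) (v : 'I_n.+1 -> V) (w : 'I_n.+1 -> W).
(** [comb] intertwines right multiplication by the matrix [A] on rows with [act x]. Spectral
    questions on x thus become questions on [A], even if the vectors [v k] are dependent. *)
Let x := \sum_(k < n.+1) tens (v k) (w k).
Let A : 'M[K]_n.+1 := \matrix_(i, j) pair (v i) (w j).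
Let comb (c : 'rV[K]_n.+1) := \sum_k c 0 k *: v k.

Let combP a c d : comb (a *: c + d) = a *: comb c + comb d.
Proof.
rewrite /comb scaler_sumr -big_split; apply: eq_bigr => k _ /=.
by rewrite !mxE scalerDl scalerA.
Qed.

Let act_sum u : act x u = \sum_k pair u (w k) *: v k.
Proof.
by rewrite act_suml; apply: eq_bigr => k _; rewrite act_tens.
Qed.

Let pair_comb c j : pair (comb c) (w j) = (c *m A) 0 j.
Proof.
rewrite /comb linear_sumlz /= mxE; apply: eq_bigr => k _.
by rewrite pairZl mxE.
Qed.

Let act_comb c : act x (comb c) = comb (c *m A).
Proof. by rewrite act_sum; apply: eq_bigr => k _; rewrite pair_comb. Qed.

Let act_range u : exists c, act x u = comb c.
Proof.
exists (\row_k pair u (w k)); rewrite act_sum; apply: eq_bigr => k _.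
by rewrite mxE.
Qed.

Let poly_act_comb p c : poly_act (act x) p (comb c) = comb (c *m horner_mx A p).
Proof.
elim/poly_ind: p c => [|p d IH] c.
  by rewrite poly_act0 rmorph0 mulmx0 /comb big1 // => k _; rewrite mxE scale0r.
rewrite poly_actD poly_actMX poly_actC act_comb IH mulrC rmorphD rmorphM /= horner_mx_X horner_mx_C.
by rewrite mulmxDr mulmxA mul_mx_scalar [_ + d *: c]addrC combP addrC.
Qed.

Lemma finite_rank_algebraic : exists2 p, p != 0 & forall u, poly_act (act x) p u = 0.
Proof.
(* The factor 'X moves u into the range of x, where Cayley-Hamilton applies. *)
exists (char_poly A * 'X).
  by rewrite mulf_neq0 ?polyX_eq0 // monic_neq0 // char_poly_monic.
move=> u; rewrite poly_actMX; have [c ->] := act_range u.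
rewrite poly_act_comb Cayley_Hamilton mulmx0 /comb big1 // => k _.
by rewrite mxE scale0r.
Qed.

(** The trace of x is the sum of the roots of [char_poly A]. A nonzero root z, with row eigenvector
    c, is an eigenvalue of x: pairing [comb c] with [w j] gives z times the j-th entry of c, so
    [comb c] is not zero. In characteristic 0 a vanishing trace leaves only the root 0. *)
Lemma finite_rank_trace l :
  (forall m u, u != 0 -> act x u = m *: u -> m = 0 \/ m = l) ->
  exists m, trace x = l *+ m /\ (trace x = 0 -> exists k, forall u, iter k (act x) u = 0).
Proof.
move=> hl; have [r er] := closed_field_poly_normal (char_poly A).
have {}er : char_poly A = \prod_(z <- r) ('X - z%:P).
  by rewrite {1}er (monicP (char_poly_monic A)) scale1r.
have hr z : z \in r -> z = 0 \/ z = l.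
  move=> zr; have : root (char_poly A) z by rewrite er root_prod_XsubC.
  rewrite -eigenvalue_root_char => /eigenvalueP[c cA c0].
  have [->|z0] := eqVneq z 0; first by left.
  apply: (hl z (comb c)); last by rewrite act_comb cA -[_ *: _]addr0 combP;
     rewrite [comb 0]big1 ?addr0 // => k _; rewrite mxE scale0r.
  apply: contraNneq c0 => h; apply/eqP/rowP => j.
  have := pair_comb c j; rewrite h linear0l cA !mxE => /esym/eqP.
  by rewrite mulf_eq0 (negbTE z0) => /eqP.
have size_r : size r = n.+1.
  by have := size_char_poly A; rewrite er size_prod_XsubC => -[].
have trE : trace x = l *+ count (fun z => z != 0) r.
  have -> : trace x = \tr A.
    rewrite (big_morph (trace (T:=T)) (fun y z => traceD y z) (trace0 T)).
    by apply: eq_bigr => k _; rewrite trace_tens mxE.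
  have := coefPn_prod_XsubC (ps := r); rewrite -er size_r char_poly_trace // => /(_ isT) /oppr_inj ->.
  elim: (r) hr => [|z t IH] hr; first by rewrite big_nil.
  rewrite big_cons IH /=; last by move=> y hy; apply: hr; rewrite inE hy orbT.
  have [->|->] := hr z (mem_head _ _); first by rewrite eqxx add0r add0n.
  by have [->|_] := eqVneq l 0; rewrite ?mul0rn ?addr0 // mulrS.
exists (count (fun z => z != 0) r); split=> // tr0.
have {}hr z : z \in r -> z = 0.
  move=> zr; have [//|zl] := hr z zr; apply/eqP; apply: contraT => z0.
  move: tr0; rewrite trE => /eqP; rewrite mulrn_eq0 -zl (negbTE z0) orbF.
  by rewrite eqn0Ngt -has_count; case/hasP; exists z.
have {}er : char_poly A = 'X ^+ n.+1.
  rewrite er -size_r; elim: (r) hr => [|z t IH] hr; first by rewrite big_nil.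
  rewrite big_cons IH /=; last by move=> y hy; apply: hr; rewrite inE hy orbT.
  by rewrite (hr z (mem_head _ _)) polyC0 subr0 exprS.
(* [n.+1] steps for the power of [A], and one to enter the range. *)
exists n.+2 => u; rewrite iterSr -poly_act_Xn.
have [c ->] := act_range u.
rewrite poly_act_comb -er Cayley_Hamilton mulmx0 /comb big1 // => k _.
by rewrite mxE scale0r.
Qed.

End FiniteRank.

Lemma act_algebraic x : exists2 p, p != 0 & forall u, poly_act (act x) p u = 0.
Proof. by have [n [v [w ->]]] := tens_sum x; exact: finite_rank_algebraic. Qed.

Definition semisimple x := diagonal_op (act x).

Definition nilpotent x := forall u, exists k, iter k (act x) u = 0.

Lemma trace_eigenvalues x l :
  (forall m u, u != 0 -> act x u = m *: u -> m = 0 \/ m = l) ->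
  exists m, trace x = l *+ m /\ (trace x = 0 -> exists k, forall u, iter k (act x) u = 0).
Proof. by have [n [v [w ->]]] := tens_sum x; exact: finite_rank_trace. Qed.

Lemma iter_eigen x a u k : act x u = a *: u -> iter k (act x) u = a ^+ k *: u.
Proof.
move=> h; elim: k => [|k /= ->]; first by rewrite expr0 scale1r.
by rewrite actZr h scalerA exprSr.
Qed.

Lemma nilpotent_eigen x a u : nilpotent x -> u != 0 -> act x u = a *: u -> a = 0.
Proof.
move=> nx u0 h; have [k] := nx u; rewrite (iter_eigen k h) => /eqP.
by rewrite scaler_eq0 (negbTE u0) orbF expf_eq0 => /andP[_ /eqP].
Qed.

Lemma trace_nilpotent x : nilpotent x -> trace x = 0.
Proof.
move=> nx; have [|m [-> _]] := @trace_eigenvalues x 0; last by rewrite mul0rn.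
by move=> a u u0 h; left; exact: nilpotent_eigen nx u0 h.
Qed.

Lemma nilpotent_uniform x : nilpotent x -> exists k, forall u, iter k (act x) u = 0.
Proof.
move=> nx; have [|m [_ h]] := @trace_eigenvalues x 0; last exact/h/trace_nilpotent.
by move=> a u u0 e; left; exact: nilpotent_eigen nx u0 e.
Qed.

Lemma primary_span_act x u :
  lin_span [set z | exists a m, poly_act (act x) (('X - a%:P) ^+ m) z = 0] u.
Proof. by have [p p0 hp] := act_algebraic x; exact: (primary_span (actPr x) p0 (hp u)). Qed.

Lemma act_calculus x (c : K -> K) : c 0 = 0 ->
  exists z, (forall a m u, poly_act (act x) (('X - a%:P) ^+ m) u = 0 -> act z u = c a *: u) /\
    (forall y, x ** y = y ** x -> z ** y = y ** z).
Proof.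
move=> c0; have [p p0 hp] := act_algebraic x.
have [Q hQ] := functional_calculus (actPr x) p0 hp c0.
(* [Q] of left multiplication by x, applied to x: the value of [Q * 'X] at x without a unit. *)
exists (poly_act (tmul T x) Q x); split.
  move=> a m u hu; rewrite -(hQ a m u hu) poly_actMX.
  rewrite (poly_act_morph (phi' := act x) (psi := fun y => act y u)) //.
    by move=> *; rewrite actPl.
  by move=> y; rewrite actM.
move=> y xy.
rewrite (poly_act_morph (phi' := tmul T x) (psi := fun t => t ** y)); last first.
- by move=> t; rewrite tmulA.
- by move=> *; rewrite tmulPl.
rewrite xy -(poly_act_morph (phi := tmul T x) (psi := fun t => y ** t)) //.
- by move=> *; rewrite tmulPr.
- by move=> t; rewrite !tmulA xy.
Qed.

(** The last clause puts s in the bicommutant of x, so that centralizer conditions pass from x to s;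
    by [ss_part_unique], commuting with x already singles s out. *)
Definition ss_part x s :=
  [/\ semisimple s, nilpotent (x - s) & forall y, x ** y = y ** x -> s ** y = y ** s].

Lemma ss_part_exists x : exists s, ss_part x s.
Proof.
have [s [sE sc]] := @act_calculus x id erefl.
exists s; split=> // u.
- move: (@primary_span_act x u); apply: lin_spanS => z [a [m hz]].
  by exists a; rewrite (sE a m).
have it0 k : iter k (act (x - s)) 0 = 0 by elim: k => //= k ->; rewrite act0r.
have hS : subspace [set u | exists k, iter k (act (x - s)) u = 0].
  split; first by exists 0%N.
  move=> a y z [k hk] [l hl]; exists (k + l)%N.
  rewrite iter_lin; last exact: actPr.
  by rewrite addnC iterD hk it0 scaler0 add0r addnC iterD hl it0.
apply: (lin_span_sub hS _ (@primary_span_act x u)).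
move=> z [a [m hz]]; exists m; rewrite -hz.
have hk k : poly_act (act x) (('X - a%:P) ^+ m) (poly_act (act x) (('X - a%:P) ^+ k) z) = 0.
  by rewrite poly_act_comm ?hz ?(lin_op0 (poly_actP (actPr x) _)) //; exact: actPr.
move: {1 2}m => k; elim: k => [|k IH]; first by rewrite expr0 poly_act1.
rewrite iterS IH exprS poly_actM; last exact: actPr.
rewrite poly_act_XsubC ?actBl ?(sE _ _ _ (hk k)) //.
Qed.

Lemma ss_part_comm x s : ss_part x s -> s ** x = x ** s.
Proof. by case=> _ _; apply. Qed.

Lemma ss_part_eigen x s a m u : ss_part x s ->
  poly_act (act x) (('X - a%:P) ^+ m) u = 0 -> act s u = a *: u.
Proof.
move=> h; have [ss nn _] := h.
apply: (generalized_eigen (nu := act (x - s)) (actPr s) (actPr _)) => // v.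
  by rewrite -actDl addrC subrK.
by rewrite -!actM tmulBl tmulBr (ss_part_comm h).
Qed.

Lemma ss_part_unique x s s' : ss_part x s -> semisimple s' -> nilpotent (x - s') ->
  s' ** x = x ** s' -> s = s'.
Proof.
move=> h ss' ns' hc; apply: act_inj => u.
have hS : subspace [set u | act s u = act s' u].
  split=> [|a y z /= hy hz]; first by rewrite /= !act0r.
  by rewrite !actPr hy hz.
apply: (lin_span_sub hS _ (ss' u)) => y [a ya] /=.
have [||k hk] := @eigen_generalized _ _ (act x) (act s') (act (x - s')) (actPr _) (actPr _) _ _ ns' a y ya.
- by move=> v; rewrite -actDl addrC subrK.
- by move=> v; rewrite -!actM tmulBl tmulBr hc.
by rewrite (ss_part_eigen h hk) ya.
Qed.

Lemma ss_part_semisimple s : semisimple s -> ss_part s s.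
Proof. by move=> hs; split=> //; rewrite subrr => u; exists 1%N; rewrite /= act0l. Qed.

Lemma semisimple0 : semisimple 0.
Proof. by move=> u; apply: sub_lin_span; exists 0; rewrite act0l scale0r. Qed.

Lemma semisimpleD x y : semisimple x -> semisimple y -> x ** y = y ** x -> semisimple (x + y).
Proof.
move=> hx hy hc u.
have hc' v : act x (act y v) = act y (act x v) by rewrite -!actM hc.
move: (diagonalD (actPr x) (actPr y) hc' hx hy u); apply: lin_spanS.
by move=> z [a ha]; exists a; rewrite actDl.
Qed.

Lemma semisimpleZ a x : semisimple x -> semisimple (a *: x).
Proof.
move=> hx u; move: (hx u); apply: lin_spanS => z [b hb].
by exists (a * b); rewrite actZl hb scalerA.
Qed.

Lemma semisimple_nilpotent x : semisimple x -> nilpotent x -> x = 0.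
Proof.
move=> hs hn; apply: (@ss_part_unique x x 0); first exact: ss_part_semisimple.
- exact: semisimple0.
- by rewrite subr0.
- by rewrite tmul0l tmul0r.
Qed.

End Jordan.

(** * Jordan decompositions *)

Section Adjoint.
Context {R : realType} {V W : lmodType R[i]} (T : tensor_algebra V W).
Local Notation K := R[i].
Implicit Types (x y s n : T) (u v : V) (w : W) (a b : K) (g h k N : set T).
Local Notation tens := (tens T).
Local Notation pair := (pairing T).

Lemma bracketPl y a x x' : bracket (a *: x + x') y = a *: bracket x y + bracket x' y.
Proof. by rewrite /bracket tmulPl tmulPr scalerBr opprD addrACA. Qed.

Lemma bracketPr y a x x' : bracket y (a *: x + x') = a *: bracket y x + bracket y x'.
Proof. by rewrite /bracket tmulPl tmulPr scalerBr opprD addrACA. Qed.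

Lemma bracketN x y : bracket y x = - bracket x y.
Proof. by rewrite /bracket opprB. Qed.

Lemma bracket_eq0 x y : bracket x y = 0 <-> x ** y = y ** x.
Proof.
by rewrite /bracket; split=> [/eqP|->]; [rewrite subr_eq0 => /eqP|exact: subrr].
Qed.

Lemma bracketDl x x' y : bracket (x + x') y = bracket x y + bracket x' y.
Proof. exact: (lin_opD (bracketPl y)). Qed.

Lemma bracketBl x x' y : bracket (x - x') y = bracket x y - bracket x' y.
Proof. exact: (lin_opB (bracketPl y)). Qed.

Lemma bracket0l y : bracket (0 : T) y = 0.
Proof. exact: (lin_op0 (bracketPl y)). Qed.

Lemma bracket0r y : bracket y (0 : T) = 0.
Proof. exact: (lin_op0 (bracketPr y)). Qed.

Lemma bracket_comm x y z : x ** y = y ** x -> bracket x (bracket y z) = bracket y (bracket x z).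
Proof.
move=> hc; rewrite /bracket !tmulBr !tmulBl !tmulA hc.
rewrite -[z ** x ** y]tmulA hc tmulA.
by rewrite !opprB !addrA [LHS]addrAC [RHS]addrAC; congr (_ + _); rewrite addrAC.
Qed.

Lemma iter_tmulr j x y :
  iter j (fun z => z ** x) (y ** x) = y ** iter j (tmul T x) x.
Proof.
elim: j y => // j IH y; rewrite iterSr IH -tmulA; congr (_ ** _).
Qed.

Lemma tmulr_lin x a y z : (a *: y + z) ** x = a *: (y ** x) + z ** x.
Proof. exact: tmulPl. Qed.

Lemma semisimple_mull s : semisimple s -> diagonal_op (tmul T s).
Proof.
move=> hs; apply: tens_ind; first exact: subspace_lin_span.
move=> v w; pose P := lin_span [set y : T | exists a, s ** y = a *: y].
have hP : subspace [set v | P (tens v w)].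
  have [P0 hP] := subspace_lin_span [set y : T | exists a, s ** y = a *: y].
  split; first by rewrite /= tensl0.
  by move=> a x y hx hy; rewrite /= linearPl; exact: hP.
apply: (lin_span_sub hP _ (hs v)) => y [a ya] /=.
by apply: sub_lin_span; exists a; rewrite tmul_tens ya tensZl.
Qed.

(** Since [T] acts on V only, the property is transported by an equation. A product q of distinct
    linear factors kills s on V; as 0 was put among the roots, q = q' 'X, and q'(s) s = 0 holds in
    [T]. Multiplying by y on the left, q kills right multiplication by s. *)
Lemma semisimple_mulr s : semisimple s -> diagonal_op (fun y => y ** s).
Proof.
move=> hs; have [p p0 hp] := act_algebraic s.
have [r [m [ur r0 hr]]] := dvdp_primary [:: 0] p0.
pose q := \prod_(a <- r) ('X - a%:P).
have qs u : poly_act (act s) q u = 0.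
  apply: (lin_span_sub (subspace_pev (actPr s) q) _ (hs u)) => y [a ya] /=.
  rewrite (poly_act_eigen (actPr s) _ ya).
  have [ar|ar] := boolP (a \in r).
    have /eqP-> : root q a by rewrite root_prod_XsubC.
    by rewrite scale0r.
  suff -> : y = 0 by rewrite scaler0.
  have := poly_act_dvd (actPr s) hr (hp y); rewrite (poly_act_eigen (actPr s) _ ya) => /eqP.
  rewrite scaler_eq0 => /orP[|/eqP//].
  by rewrite horner_exp expf_eq0 /= -[_ == 0]rootE root_prod_XsubC (negbTE ar).
have /dvdpP[q' eq'] : 'X %| q.
  by rewrite -['X]subr0 -polyC0 dvdp_XsubCl root_prod_XsubC r0 ?mem_head.
have q's : poly_act (tmul T s) q' s = 0.
  apply: act_inj => u; rewrite act0l -(qs u) eq' poly_actMX.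
  rewrite (poly_act_morph (phi' := act s) (psi := fun y => act y u)) //.
    by move=> *; rewrite actPl.
  by move=> y; rewrite actM.
move=> y; have h : poly_act (fun z => z ** s) (q ^+ 1) y = 0.
  rewrite expr1 eq' poly_actMX -[RHS](tmul0r y) -q's /poly_act.
  rewrite (big_morph (tmul T y) (tmulDr y) (tmul0r y)); apply: eq_bigr => i _.
  by rewrite iter_tmulr tmulZr.
move: (primary_decomposition (tmulr_lin s) (@subspaceT _ T) (fun _ _ => I) ur I h).
apply: lin_spanS => z [_ [a _]]; rewrite expr1 poly_act_XsubC // => /eqP.
by rewrite subr_eq0 => /eqP za; exists a.
Qed.

Lemma opp_tmulr_lin x a y z : - ((a *: y + z) ** x) = a *: (- (y ** x)) + - (z ** x).
Proof. by rewrite tmulPl opprD scalerN. Qed.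

Lemma ad_semisimple s : semisimple s -> diagonal_op (bracket s).
Proof.
move=> hs; rewrite /bracket.
apply: (diagonalD (tmulPr s) (opp_tmulr_lin s)) => [y||y].
- by rewrite tmulNr tmulA.
- exact: semisimple_mull.
- move: (semisimple_mulr hs y); apply: lin_spanS => z [a za].
  by exists (- a); rewrite za scaleNr.
Qed.

Lemma ad_nilpotent n : nilpotent n -> exists m, forall y, iter m (bracket n) y = 0.
Proof.
move=> /nilpotent_uniform[k hk].
have hl (y : T) : iter k (tmul T n) y = 0.
  apply: act_inj => u; rewrite act0l -(hk (act y u)).
  by elim: k {hk} => //= k IH; rewrite actM IH.
(* Left multiplication by n dies after k steps; right multiplication takes one more, its powers
   being reached as [y ** iter k (tmul T n) n]. *)
exists (k + k.+1)%N => y; rewrite /bracket.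
apply: (iter_addn_eq0 (tmulPr n) (opp_tmulr_lin n)) => //.
  by move=> z; rewrite tmulNr tmulA.
have itN j z : iter j (fun z => - (z ** n)) z = (-1) ^+ j *: iter j (fun z => z ** n) z.
  elim: j => [|j /= ->]; first by rewrite expr0 scale1r.
  by rewrite tmulZl exprS mulN1r scaleNr.
by rewrite itN iterSr iter_tmulr hl tmul0r scaler0.
Qed.

Section SemisimplePart.
Variables x s : T.
Hypothesis xs : ss_part x s.

Let bracketE y : bracket x y = bracket s y + bracket (x - s) y.
Proof. by rewrite -bracketDl addrC subrK. Qed.

Let bracketC y : bracket s (bracket (x - s) y) = bracket (x - s) (bracket s y).
Proof. by apply: bracket_comm; rewrite tmulBl tmulBr (ss_part_comm xs). Qed.

Let nil y : exists m, iter m (bracket (x - s)) y = 0.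
Proof. by have [_ /ad_nilpotent[m hm] _] := xs; exists m. Qed.

Let ss : diagonal_op (bracket s).
Proof. by have [hs _ _] := xs; exact: ad_semisimple. Qed.

(** [bracket s] is diagonal, [bracket (x - s)] is locally nilpotent and they commute, so they are
    the Jordan parts of [bracket x]. *)
Lemma ad_ss_part_stable N y : subspace N -> (forall z, N z -> N (bracket x z)) ->
  N y -> N (bracket s y).
Proof.
move=> hN sN Ny.
exact: (jordan_stable (bracketPr s) (bracketPr (x - s)) bracketE bracketC ss nil hN sN Ny).
Qed.

Lemma ad_ss_part_eigen a m y : poly_act (bracket x) (('X - a%:P) ^+ m) y = 0 ->
  bracket s y = a *: y.
Proof.
exact: (generalized_eigen (bracketPr s) (bracketPr (x - s)) bracketE bracketC ss nil).
Qed.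

(** This turns nilpotence of [bracket x] on y into commutation of s with y. *)
Lemma ad_ss_part_ker m y : iter m (bracket x) y = 0 -> bracket s y = 0.
Proof.
move=> h; rewrite -[RHS](scale0r y); apply: (@ad_ss_part_eigen _ m).
by rewrite polyC0 subr0 poly_act_Xn.
Qed.

End SemisimplePart.

(** Functional calculus for the indicator function of a. The eigenvalue 0 is excluded because the
    projection onto the kernel has infinite rank. *)
Lemma spectral_projection s a : semisimple s -> a != 0 ->
  exists q, [/\ q ** q = q, s ** q = a *: q,
    forall b u, act s u = b *: u -> act q u = (b == a)%:R *: u &
    forall y, s ** y = y ** s -> q ** y = y ** q].
Proof.
move=> ss a0; have c0 : (0 == a)%:R = 0 :> K by rewrite eq_sym (negbTE a0).
have [p [pE pc]] := act_calculus s (c := fun b => (b == a)%:R) c0.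
have pE1 b v : act s v = b *: v -> act p v = (b == a)%:R *: v.
  by move=> hv; apply: (pE b 1%N); rewrite expr1 poly_act_XsubC hv subrr.
exists p; split=> //; apply: act_inj => v.
- have hS : subspace [set v | act (p ** p) v = act p v].
    split=> [|b v1 v2 /= h1 h2]; first by rewrite /= !act0r.
    by rewrite !actPr h1 h2.
  apply: (lin_span_sub hS _ (ss v)) => z [b zb] /=.
  by rewrite actM (pE1 b z zb) actZr (pE1 b z zb) scalerA; case: eqP; rewrite ?mulr0 ?mulr1.
- have hS : subspace [set v | act (s ** p) v = act (a *: p) v].
    split=> [|b v1 v2 /= h1 h2]; first by rewrite /= !act0r.
    by rewrite !actPr h1 h2.
  apply: (lin_span_sub hS _ (ss v)) => z [b zb] /=.
  rewrite actM actZl (pE1 b z zb) actZr zb.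
  by case: eqP => [->|]; rewrite ?scale1r ?scale0r ?scaler0.
Qed.

(* The semisimple part [s] of [n] centralizes [k], hence so does its spectral
   projection [p] for an eigenvalue [a != 0]; then [trace (p ** n)] vanishes as
   [n] is a sum of brackets, but it is a multiple of [a]. *)
Lemma nilpotent_elt_nilpotent k n : lie_subalgebra k -> nilpotent_elt k n -> nilpotent n.
Proof.
move=> [hk lk] [dn [m hm]].
have [s hs] := ss_part_exists n; have [ss nn sc] := hs.
have kn : k n.
  by apply: (lin_span_sub hk _ dn) => _ [x [y [kx ky ->]]]; exact: lk.
have sk y : k y -> s ** y = y ** s.
  by move=> ky; apply/bracket_eq0; apply: (ad_ss_part_ker hs (hm y ky)).
suff s0 : s = 0 by move: nn; rewrite s0 subr0.
apply: act_inj => u; rewrite act0l.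
apply: (lin_span_sub (subspace_ker (actPr s)) _ (ss u)) => y [a ya] /=.
have [a0|a0] := eqVneq a 0; first by rewrite ya a0 scale0r.
have [p [pp sp pE1 pc]] := spectral_projection ss a0.
have ps v : act p v = v -> act s v = a *: v.
  by move=> <-; rewrite -!actM -actZl sp.
have pk z : k z -> p ** z = z ** p by move=> kz; apply: pc; exact: sk.
have [|j [_ hnil]] := @trace_eigenvalues _ _ _ T (p ** n) a.
  move=> b v v0 hb; have [->|b0] := eqVneq b 0; [by left|right].
  have pv : act p v = v.
    apply: (scalerI b0); rewrite -[in RHS]hb -[in LHS]actZr -hb -!actM.
    by rewrite [p ** (p ** n)]tmulA pp.
  have nv : act n v = b *: v by rewrite -hb actM -{1}pv -!actM (pk _ kn).
  have sv : act s v = b *: v.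
    by apply: (ss_part_eigen (m := 1) hs); rewrite expr1 poly_act_XsubC nv subrr.
  have := ps v pv; rewrite sv => /eqP; rewrite -subr_eq0 -scalerBl scaler_eq0 (negbTE v0) orbF.
  by rewrite subr_eq0 => /eqP.
have [i hi] : exists i, forall v, iter i (act (p ** n)) v = 0.
  apply: hnil; pose Q := [set z : T | trace (p ** z) = 0].
  have hQ : subspace Q.
    split; first by rewrite /Q /= tmul0r trace0.
    by move=> b z1 z2 h1 h2; rewrite /Q /= tmulPr traceP h1 h2 mulr0 addr0.
  apply: (lin_span_sub hQ _ dn) => _ [x1 [x2 [k1 k2 ->]]].
  rewrite /Q /= /bracket tmulBr traceB [p ** (x2 ** x1)]tmulA (pk _ k2) -tmulA.
  by rewrite [trace (x2 ** _)]traceC -tmulA subrr.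
have py : act p y = y by rewrite (pE1 a) // eqxx scale1r.
(* p fixes y and commutes with n, so [p ** n] and n have the same iterates on y. Hence y is in the
   generalized 0-eigenspace of n, where s vanishes. *)
have itn l : iter l (act (p ** n)) y = iter l (act n) y /\ act p (iter l (act n) y) = iter l (act n) y.
  elim: l => [|l] /=; [by split|case=> -> IH; split].
    by rewrite (pk _ kn) actM IH.
  by rewrite -actM (pk _ kn) actM IH.
have /(ss_part_eigen hs) : poly_act (act n) (('X - 0%:P) ^+ i) y = 0.
  by rewrite polyC0 subr0 poly_act_Xn -(itn i).1 hi.
by rewrite scale0r.
Qed.

End Adjoint.

(** * Jordan decompositions inside the exhausting subalgebras *)

Section Exhaustion.
Context {R : realType} {V W : lmodType R[i]} (T : tensor_algebra V W).
Local Notation K := R[i].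
Implicit Types (x y s n : T) (u v : V) (w : W) (a b : K) (g h k N : set T).

Definition ss_closed g := forall x s, g x -> ss_part x s -> g s.

Definition centerless g := forall x, (forall y, g y -> x ** y = y ** x) -> x = 0.

Definition ss_set h := [set s | exists2 x, h x & ss_part x s].

Variables (g : set T) (F : nat -> set T).
Hypotheses (gss : ss_closed g) (gc : centerless g) (gF : reductive_exhaustion g F).

Let Flie i : lie_subalgebra (F i).
Proof. by have [h _ _] := gF; have [] := h i. Qed.

Let Fmono i j : (i <= j)%N -> F i `<=` F j.
Proof.
have [_ h _] := gF; move=> /subnK <-; elim: (j - i)%N => [|k IH] x Fx; first by rewrite add0n.
by apply: (h _).1; exact: IH.
Qed.

(* The nilpotent part [n] of [s] acts on [F (i + j).+1] as an endomorphism of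
   [F (i + j)]-modules that preserves submodules; its kernel has a stable
   complement, on which the nilpotent [bracket n] is injective.  So [n] commutes
   with all of [g]. *)
Lemma semisimple_elt_semisimple i s : semisimple_elt (F i) s -> semisimple s.
Proof.
move=> [Fs ds]; have [s0 hs] := ss_part_exists s; have [ss0 nn _] := hs.
suff n0 : s - s0 = 0 by move/eqP: n0; rewrite subr_eq0 => /eqP ->.
suff H j y : F (i + j)%N y -> bracket (s - s0) y = 0.
  apply: gc => y; have [_ _ ->] := gF; move=> [j _ Fy]; apply/bracket_eq0.
  by apply: (H j); apply: Fmono Fy; exact: leq_addl.
elim: j y => [|j IH] y; rewrite ?addn0 ?addnS => Fy.
  (* On [F i] itself [bracket s] is diagonal, hence equal to [bracket s0] on its eigenvectors. *)
  apply: (lin_span_sub (subspace_ker (bracketPr (s - s0))) _ (ds y Fy)) => z [Fz [a za]] /=.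
  rewrite bracketBl za (@ad_ss_part_eigen _ _ _ T s s0 hs a 1) ?subrr //.
  by rewrite expr1 poly_act_XsubC za subrr.
have [_ /(_ (i + j)%N) [Fincl red] _] := gF.
pose M := F (i + j).+1 `&` [set z | bracket (s - s0) z = 0].
have hM : submodule (F (i + j)%N) (F (i + j).+1) M.
  split; first by apply: subspaceI; [exact: (Flie _).1|exact: subspace_ker (bracketPr _)].
    by move=> z [].
  move=> x z Fx [Fz] /= hz; split; first by apply: (Flie _).2 => //; exact: Fincl.
  rewrite /= bracket_comm ?hz ?bracket0r //; apply/bracket_eq0; exact: IH.
have [M' [[M'sub M'F M'mod] MM' FE]] := red M hM.
have Fs' : F (i + j)%N s by apply: Fmono Fs; exact: leq_addr.
have stM z : M' z -> M' (bracket (s - s0) z).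
  move=> Mz; rewrite bracketBl; apply: subspaceB => //; first exact: M'mod.
  by apply: (ad_ss_part_stable hs M'sub _ Mz) => t; exact: M'mod.
have M'0 z : M' z -> z = 0.
  move=> Mz; have [m hm] := ad_nilpotent nn.
  have {hm}hm := hm z; elim: m z Mz hm => [|m IHm] z Mz; first by [].
  rewrite iterSr => h; have h0 := IHm _ (stM _ Mz) h.
  have : (M `&` M') z by split => //; split => //; exact: M'F.
  by rewrite MM'.
move: Fy; rewrite FE => -[y1 [y2 [[_ My1] /M'0 -> ->]]].
by rewrite addr0.
Qed.

Lemma jordan_in_ss_part i x s n : jordan_in (F i) x s n -> ss_part x s.
Proof.
move=> [/semisimple_elt_semisimple hs /(nilpotent_elt_nilpotent (Flie i)) hn sn ->].
have [s' hs'] := ss_part_exists (s + n).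
have e : s' = s.
  apply: (ss_part_unique hs') => //; first by rewrite addrC addKr.
  by rewrite tmulDl tmulDr ((bracket_eq0 _ _).1 sn).
by move: hs'; rewrite e.
Qed.

(** A k-stable complement of [k, k] is central: its brackets with k lie in it and in [k, k]. *)
Lemma reductive_derived_center k x : lie_subalgebra k -> reductive_in k k -> k x ->
  exists z y, [/\ k z, forall t, k t -> z ** t = t ** z, derived k y & x = z + y].
Proof.
move=> [hk lk] red kx.
have dk : derived k `<=` k.
  by apply: lin_span_sub => // _ [y [z [ky kz ->]]]; exact: lk.
have der y z : k y -> k z -> derived k (bracket y z).
  by move=> ky kz; apply: sub_lin_span; exists y, z.
have [|M' [[M'sub M'k M'mod] dM' kE]] := red (derived k).
  by split; [exact: subspace_lin_span|exact: dk|move=> y z ky /dk kz; exact: der].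
move: (kx); rewrite {1}kE => -[y [z [dy Mz ->]]]; exists z, y; split=> //.
- exact: M'k.
- move=> t kt; apply/esym/bracket_eq0.
  have : (derived k `&` M') (bracket t z).
    by split; [apply: der => //; exact: M'k|exact: M'mod].
  by rewrite dM'.
- exact: addrC.
Qed.

(** The point is that x - s lies in the derived algebra. Its central component z is semisimple, its
    derived component nilpotent, and they commute; by uniqueness z is the semisimple part of the
    nilpotent x - s, namely 0. *)
Lemma ss_part_jordan_in x s : g x -> ss_part x s -> exists i, jordan_in (F i) x s (x - s).
Proof.
move=> gx hs; have gs := gss gx hs; have [ss nn _] := hs.
have [Fred _ gE] := gF.
move: (gx) (gs); rewrite gE => -[i _ Fx] [j _ Fs]; exists (maxn i j).
have {}Fx := Fmono (leq_maxl i j) Fx; have {}Fs := Fmono (leq_maxr i j) Fs.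
move: (maxn i j) Fx Fs => {i j}i Fx Fs.
have [hF lF] := Flie i.
have hc := ss_part_comm hs.
split.
- split=> // y Fy.
  apply: (diagonal_sub (bracketPr s) hF _ (ad_semisimple ss) Fy) => z; exact: lF.
- have Fn : F i (x - s) by exact: subspaceB.
  have [_ _ redF] := Fred i.
  have [z [y [Fz zc dy e]]] := reductive_derived_center (Flie i) redF Fn.
  have [m hm] := ad_nilpotent nn.
  split; last by exists m.
  have sz : semisimple z.
    apply: (@semisimple_elt_semisimple i); split=> // t Ft; apply: sub_lin_span.
    by split=> //; exists 0; rewrite scale0r; apply/bracket_eq0; exact: zc.
  have Fy : F i y by rewrite -[y](addKr z) -e addrC; exact: subspaceB.
  have ny : nilpotent y.
    apply: (@nilpotent_elt_nilpotent _ _ _ _ (F i)); first exact: Flie.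
    split=> //; exists m => t Ft.
    suff [-> _] : iter m (bracket y) t = iter m (bracket (x - s)) t /\ F i (iter m (bracket (x - s)) t) by exact: hm.
    elim: (m) => //= l [-> IH]; split; last exact: lF.
    move: IH; move: (iter l _ t) => t' Ft'.
    by rewrite e bracketDl (_ : bracket z _ = 0) ?add0r //; apply/bracket_eq0; exact: zc.
  suff -> : x - s = y by [].
  suff z0 : z = 0 by rewrite e z0 add0r.
  have [s' hs'] := ss_part_exists (x - s).
  have e1 : s' = 0.
    apply: (ss_part_unique hs'); [exact: semisimple0|by rewrite subr0|by rewrite tmul0l tmul0r].
  rewrite -e1; apply/esym; apply: (ss_part_unique hs') => //.
    by rewrite e addrC addKr.
  by apply: zc.
- by apply/bracket_eq0; rewrite tmulBl tmulBr hc.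
- by rewrite addrC subrK.
Qed.

(** Here the exhaustion drops out: from now on only operators matter. *)
Lemma ss_partsE h : h `<=` g -> ss_parts F h = ss_set h.
Proof.
move=> hg; apply/seteqP; split=> [s [x hx [i [n]]]|s [x hx xs]].
  by move=> /jordan_in_ss_part xs; exists x.
exists x => //; have [i hi] := ss_part_jordan_in (hg _ hx) xs.
by exists i, (x - s).
Qed.

Lemma cartan_ss_set h : cartan_subalgebra g F h <->
  [/\ lie_subalgebra h, h `<=` g, locally_nilpotent h & h = centralizer g (ss_set h)].
Proof.
by split=> -[h1 h2 h3 h4]; split=> //; [rewrite -ss_partsE|rewrite ss_partsE].
Qed.

End Exhaustion.

(** * Orthogonal rank-one idempotents *)

Section RankOne.
Context {R : realType} {V W : lmodType R[i]} (T : tensor_algebra V W).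
Local Notation K := R[i].
Implicit Types (x y s e f p : T) (u v : V) (w : W) (a b : K) (g h N E : set T).
Local Notation tens := (tens T).
Local Notation pair := (pairing T).

Definition rank_one e := exists v w, e = tens v w /\ pair v w = 1.

Definition orth_idempotents E := (forall e, E e -> rank_one e) /\
  forall e f, E e -> E f -> e <> f -> e ** f = 0.

Definition annihilated E y := forall e, E e -> e ** y = 0 /\ y ** e = 0.

Definition torus g E := g `&` lin_span E.

Lemma tens_neq0 v w : v != 0 -> w != 0 -> tens v w != 0.
Proof.
move=> v0 w0; have [u hu] := dual_right T w0.
apply: contraNneq v0 => h; have := act_tens T v w u.
by rewrite h act0l hu scale1r => <-.
Qed.

Lemma pair1_neq0 v w : pair v w = 1 -> v != 0 /\ w != 0.
Proof.
by move=> h; split; apply/eqP => e; move/eqP: h; rewrite e ?linear0l ?linear0r eq_sym oner_eq0.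
Qed.

Lemma rank_one_idem e : rank_one e -> e ** e = e.
Proof. by move=> [v [w [-> h]]]; rewrite tmulE h scale1r. Qed.

Lemma rank_one_trace e : rank_one e -> trace e = 1.
Proof. by move=> [v [w [-> h]]]; rewrite trace_tens. Qed.

Lemma rank_one_neq0 e : rank_one e -> e != 0.
Proof. by move/rank_one_trace => h; apply/eqP => e0; move/eqP: h; rewrite e0 trace0 eq_sym oner_eq0. Qed.

Lemma rank_one_sandwich e x : rank_one e -> e ** x ** e = trace (x ** e) *: e.
Proof.
by move=> [v [w [-> h]]]; rewrite -tmulA tmul_tens tmulE trace_tens.
Qed.

Lemma tmul_tens_eq0 v w v' w' : v != 0 -> w' != 0 ->
  tens v w ** tens v' w' = 0 -> pair v' w = 0.
Proof.
move=> v0 w0 /eqP; rewrite tmulE scaler_eq0 => /orP[/eqP//|].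
by rewrite (negbTE (tens_neq0 v0 w0)).
Qed.

(** [e ** f] is the same nonzero multiple, by [trace (f ** e)], of e and of f. *)
Lemma rank_one_comm_eq e f : rank_one e -> rank_one f -> e ** f = f ** e ->
  e ** f != 0 -> e = f.
Proof.
move=> re rf hc h0; have ee := rank_one_idem re; have ff := rank_one_idem rf.
have h1 : e ** f = trace (f ** e) *: e.
  by rewrite -rank_one_sandwich // -tmulA -hc tmulA ee.
have h2 : e ** f = trace (f ** e) *: f.
  rewrite traceC -rank_one_sandwich // -hc -tmulA ff.
  by [].
apply: (scalerI (a := trace (f ** e))); last by rewrite -h1 -h2.
by apply: contraNneq h0 => t0; rewrite h1 t0 scale0r.
Qed.

Lemma infinite_set_seq (U : choiceType) (A : set U) n : infinite_set A ->
  exists r : seq U, [/\ uniq r, (n <= size r)%N & forall t, t \in r -> A t].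
Proof.
move=> /(infinite_set_fset n)[B BA szB]; exists (finmap.enum_fset B).
by split=> // t tB; exact: BA.
Qed.

(** Among [n.+1] of them the range vectors are linearly dependent; pairing the relation with the
    l-th dual vector isolates its l-th coefficient, so it is trivial. Serves both the finiteness of
    supports and the countability of [E]. *)
Lemma finite_orth_idempotents E n (v : 'I_n -> V) : orth_idempotents E ->
  finite_set [set e | E e /\ exists (c : 'I_n -> K) w, e = tens (\sum_k c k *: v k) w].
Proof.
move=> [E1 EO]; apply: contrapT => /(infinite_set_seq n.+1)[r [ur szr rA]].
pose f (j : 'I_n.+1) := nth 0 r j.
have fE (j : 'I_n.+1) : E (f j) /\ exists (c : 'I_n -> K) w, f j = tens (\sum_k c k *: v k) w
  := rA (f j) (mem_nth 0 (leq_trans (ltn_ord j) szr)).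
have finj i j : f i = f j -> i = j.
  move/eqP; rewrite nth_uniq ?(leq_trans (ltn_ord _) szr) // => /eqP.
  exact: val_inj.
have [c hc] := choice (fun j => (fE j).2).
have [w hw] := choice hc.
pose A : 'M[K]_(n.+1, n) := \matrix_(j, k) c j k.
have [i hi] : exists i, row i (kermx A) != 0.
  apply/existsP; rewrite -negb_forall.
  have : (\rank (kermx A) > 0)%N by rewrite mxrank_ker subn_gt0 ltnS rank_leq_col.
  apply: contraTN => /forallP h.
  rewrite lt0n mxrank_eq0 negbK; apply/eqP/row_matrixP => i.
  by rewrite row0; apply/eqP.
set d := row i _ in hi; have dA : d *m A = 0 by apply/sub_kermxP; exact: row_sub.
pose vv j := \sum_k c j k *: v k.
have pvw j : pair (vv j) (w j) = 1.
  by have := rank_one_trace (E1 _ (fE j).1); rewrite hw trace_tens.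
have pvw0 j l : j != l -> pair (vv j) (w l) = 0.
  move=> jl; apply: (@tmul_tens_eq0 (vv l) _ _ (w j)).
  - exact: (pair1_neq0 (pvw l)).1.
  - exact: (pair1_neq0 (pvw j)).2.
  - rewrite -!hw; apply: EO; [exact: (fE l).1|exact: (fE j).1|].
    by move/finj => e; rewrite e eqxx in jl.
have s0 : \sum_(j < n.+1) d 0 j *: vv j = 0.
  transitivity (\sum_k (d *m A) 0 k *: v k); last first.
    by rewrite dA big1 // => k _; rewrite mxE scale0r.
  under eq_bigr => j _ do rewrite scaler_sumr.
  rewrite exchange_big; apply: eq_bigr => k _ /=.
  by rewrite mxE scaler_suml; apply: eq_bigr => j _; rewrite scalerA !mxE.
move/eqP: hi; apply; apply/rowP => l; rewrite [RHS]mxE.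
have : pair (\sum_(j < n.+1) d 0 j *: vv j) (w l) = 0 by rewrite s0 linear0l.
rewrite linear_sumlz (bigD1 l) //= big1 ?addr0 => [|j jl].
  by rewrite pairZl pvw mulr1.
by rewrite pairZl pvw0 ?mulr0.
Qed.

Section Span.
Variable E : set T.
Hypothesis EO : orth_idempotents E.

Lemma orth_comm e f : E e -> E f -> e ** f = f ** e.
Proof. by move=> He Hf; have [->//|/eqP ef] := eqVneq e f; rewrite !EO.2 // => /esym. Qed.

Lemma subspace_comm y : subspace [set x : T | x ** y = y ** x].
Proof.
split; first by rewrite /= tmul0l tmul0r.
by move=> a x z /= hx hz; rewrite tmulPl tmulPr hx hz.
Qed.

Lemma span_comm x y : (forall e, E e -> y ** e = e ** y) -> lin_span E x -> x ** y = y ** x.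
Proof.
by move=> h Ex; apply: (lin_span_sub (subspace_comm y) _ Ex) => e Ee /=; rewrite h.
Qed.

Lemma span_commE x e : lin_span E x -> E e -> x ** e = e ** x.
Proof. by move=> Ex Ee; apply: span_comm Ex => f Ef; exact: orth_comm. Qed.

Lemma span_comm2 x y : lin_span E x -> lin_span E y -> x ** y = y ** x.
Proof. by move=> Ex Ey; apply: span_comm Ex => e Ee; exact: span_commE. Qed.

Lemma rank_one_semisimple e : rank_one e -> semisimple e.
Proof.
move=> re u; have ee := rank_one_idem re.
rewrite -(subrK (act e u) u); apply: (subspaceD (subspace_lin_span _)); apply: sub_lin_span.
  by exists 0; rewrite actBr -actM ee subrr scale0r.
by exists 1; rewrite -actM ee scale1r.
Qed.

Lemma span_semisimple x : lin_span E x -> semisimple x.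
Proof.
(* Semisimplicity alone is not additive; the second clause makes the two summands commute. *)
move=> Ex; pose P := [set x : T | semisimple x /\
  forall y, (forall e, E e -> y ** e = e ** y) -> x ** y = y ** x].
have hP : subspace P.
  split; first by split=> [|y _]; [exact: semisimple0|rewrite tmul0l tmul0r].
  move=> a y z [sy cy] [sz cz]; split=> [|t ht]; last by rewrite tmulPl tmulPr cy ?cz.
  have cyz : y ** z = z ** y.
    apply: cy => e Ee; apply: cz => f Ef; exact: orth_comm.
  apply: semisimpleD => //; first exact: semisimpleZ.
  by rewrite tmulZl tmulZr cyz.
have [] : P x; last by [].
apply: (lin_span_sub hP _ Ex) => e Ee; split; last by move=> y h; rewrite h.
by apply: rank_one_semisimple; exact: EO.1.
Qed.

Lemma span_annihilated x y : annihilated E y -> lin_span E x -> x ** y = 0 /\ y ** x = 0.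
Proof.
move=> hy Ex; pose P := [set x : T | x ** y = 0 /\ y ** x = 0].
suff : P x by [].
have hP : subspace P.
  split; first by rewrite /P /= tmul0l tmul0r.
  move=> a z t [h1 h2] [h3 h4].
  by rewrite /P /= tmulPl tmulPr h1 h2 h3 h4 scaler0 addr0.
by apply: (lin_span_sub hP _ Ex) => e Ee; exact: hy.
Qed.

Lemma span_annihilated0 x : annihilated E x -> lin_span E x -> x = 0.
Proof.
move=> hx Ex; apply: semisimple_nilpotent (span_semisimple Ex) _.
by move=> u; exists 2%N; rewrite /= -actM (span_annihilated hx Ex).1 act0l.
Qed.

(** Commuting with e in [E] gives [x ** e = trace (x ** e) *: e]. If this is not zero, the range of
    e lies in that of x, which happens for finitely many e only; s is the sum of these multiples. *)
Lemma orth_decomposition x : (forall e, E e -> x ** e = e ** x) ->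
  exists s y, [/\ lin_span E s, annihilated E y & x = s + y].
Proof.
move=> xE; have [n [v [w ex]]] := tens_sum x.
have xe e : E e -> x ** e = trace (x ** e) *: e.
  move=> Ee; rewrite -rank_one_sandwich; last exact: EO.1.
  by rewrite -xE // -tmulA rank_one_idem //; exact: EO.1.
have fin : finite_set [set e | E e /\ x ** e != 0].
  apply: sub_finite_set (finite_orth_idempotents v EO) => e [Ee xe0]; split=> //.
  have [v' [w' [ee pe]]] := EO.1 _ Ee.
  exists (fun k => (trace (x ** e))^-1 * pair v' (w k)), w'.
  have t0 : trace (x ** e) != 0 by apply: contraNneq xe0 => h; rewrite xe // h scale0r.
  rewrite -[LHS](scalerK t0) -xe // {2}ee tmul_tens -tensZl; congr (tens _ _).
  have -> : act x v' = \sum_k pair v' (w k) *: v k.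
    by rewrite ex act_suml; apply: eq_bigr => k _; rewrite act_tens.
  by rewrite scaler_sumr; apply: eq_bigr => k _; rewrite scalerA.
have [r0 er0] := (finite_seqP _).1 fin.
pose r := undup r0; have ur : uniq r := undup_uniq r0.
have rP e : e \in r <-> E e /\ x ** e != 0.
  by have := congr1 (fun A => A e) er0; rewrite mem_undup /= => ->.
pose s := \sum_(e <- r) trace (x ** e) *: e.
have sE : lin_span E s.
  apply: (subspace_sum (subspace_lin_span E)) => e /rP[Ee _].
  by apply: (subspaceZ _ (subspace_lin_span E)); exact: sub_lin_span.
exists s, (x - s); split=> //; last by rewrite addrC subrK.
move=> e Ee; have h : s ** e = x ** e.
  have sum : s ** e = \sum_(f <- r) trace (x ** f) *: (f ** e).
    rewrite /s (big_morph (fun z : T => z ** e) (fun y z => tmulDl y z e) (tmul0l e)).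
    by apply: eq_bigr => f _; rewrite tmulZl.
  have [er|/negP er] := boolP (e \in r).
    rewrite sum (bigD1_seq e) //= rank_one_idem; last exact: EO.1.
    rewrite -xe // big_seq_cond big1 ?addr0 // => f /andP[/rP[Ef _] /eqP fe].
    by rewrite (EO.2 _ _ Ef Ee fe) scaler0.
  have xe0 : x ** e = 0.
    by apply/eqP; apply: contrapT => /negP h; apply: er; apply/rP.
  rewrite sum xe0 big_seq big1 // => f fr.
  have [Ef _] := (rP f).1 fr; have fe : f <> e by move=> fe; apply: er; rewrite -fe.
  by rewrite (EO.2 _ _ Ef Ee fe) scaler0.
by rewrite tmulBl tmulBr h subrr -(span_commE sE Ee) h xE // subrr.
Qed.

End Span.

Lemma centralizer_lie g (A : set T) : lie_subalgebra g -> lie_subalgebra (centralizer g A).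
Proof.
move=> [hg lg]; split.
  split; first by split=> [|a _]; [case: hg|rewrite bracket0l].
  move=> a x y [gx hx] [gy hy]; split=> [|z Az]; first by case: hg => _; apply.
  by rewrite bracketPl hx // hy // scaler0 addr0.
move=> x y [gx hx] [gy hy]; split=> [|z Az]; first exact: lg.
rewrite bracketN bracket_comm ?[bracket z y]bracketN ?hy // ?oppr0 ?bracket0r ?oppr0 //.
by apply/bracket_eq0; rewrite bracketN hx // oppr0.
Qed.

(** * From a system of idempotents to a Cartan subalgebra *)

Section Forward.
Variables (g E : set T).
Hypothesis gl : lie_subalgebra g.
Hypothesis EO : orth_idempotents E.
(** The features shared by the four algebras. e itself may lie outside [g], but the difference e - f
    is inside; [Eproj] keeps both parts of the decomposition s + y in [g], and [Enil] makes the
    y-part nilpotent. *)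
Hypothesis Esep : forall e, E e -> exists f, [/\ torus g E (e - f), f ** f = f, e ** f = 0 & f ** e = 0].
Hypothesis Eproj : forall s y, lin_span E s -> annihilated E y -> g (s + y) -> g y.
Hypothesis Enil : forall x y z, g x -> g y -> g z -> annihilated E x -> annihilated E y ->
  annihilated E z -> x ** y ** z = 0.

Local Notation h := (centralizer g (torus g E)).

(* [(e - f) ** (e - f) = e + f] *)
Lemma torus_separates x : (forall t, torus g E t -> x ** t = t ** x) ->
  forall e, E e -> x ** e = e ** x.
Proof.
move=> hx e Ee; have [f [tf ff ef fe]] := Esep Ee.
have ee := rank_one_idem (EO.1 _ Ee).
have h1 := hx _ tf.
have h2 : x ** (e + f) = (e + f) ** x.
  have -> : e + f = (e - f) ** (e - f).
    by rewrite tmulBl !tmulBr ee ff ef fe subr0 sub0r opprK.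
  by rewrite tmulA h1 -tmulA h1 tmulA.
have : x ** (e *+ 2) = (e *+ 2) ** x.
  have -> : e *+ 2 = (e - f) + (e + f) by rewrite addrACA addNr addr0 mulr2n.
  by rewrite tmulDr tmulDl h1 h2.
rewrite -scaler_nat tmulZl tmulZr; apply: scalerI.
by rewrite pnatr_eq0.
Qed.

Lemma centralizer_torusP x : h x <-> g x /\ forall e, E e -> x ** e = e ** x.
Proof.
split=> [[gx hx]|[gx hx]]; split=> //.
  by apply: torus_separates => t /hx /bracket_eq0.
by move=> t [_ Et]; apply/bracket_eq0/esym; apply: span_comm Et.
Qed.

Lemma centralizer_torus_decomposition x : h x ->
  exists s y, [/\ torus g E s, annihilated E y, g y & x = s + y] /\ ss_part x s.
Proof.
move=> /centralizer_torusP[gx xE].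
have [s [y [Es yE xsy]]] := orth_decomposition EO xE.
have gy : g y by apply: (Eproj Es yE); rewrite -xsy.
have gs : g s.
  have -> : s = x - y by rewrite xsy addrK.
  by apply: subspaceB => //; case: gl.
exists s, y; split; first by split.
have [s' hs'] := ss_part_exists x.
suff <- : s' = s by [].
apply: (ss_part_unique hs').
- exact: span_semisimple Es.
(* x - s is y, whose cube vanishes by [Enil]. *)
- by move=> u; exists 3%N; rewrite xsy addrC addKr /= -!actM ?tmulA Enil // act0l.
- by apply/esym; apply/esym; apply: span_comm Es.
Qed.

Lemma torus_sub_ss_set : torus g E `<=` ss_set h.
Proof.
move=> t [gt Et]; exists t.
  by apply/centralizer_torusP; split=> // e; exact: span_commE.
by apply: ss_part_semisimple; exact: span_semisimple Et.
Qed.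

Lemma ss_set_centralizer_torus : ss_set h = torus g E.
Proof.
apply/seteqP; split; last exact: torus_sub_ss_set.
move=> t [x hx xt]; have [s [y [[ts _ _ _] xs]]] := centralizer_torus_decomposition hx.
have [ss1 ss2 _] := xs.
by rewrite (ss_part_unique xt ss1 ss2 (ss_part_comm xs)).
Qed.

Lemma centralizer_torus_cartan :
  [/\ lie_subalgebra h, h `<=` g, locally_nilpotent h & h = centralizer g (ss_set h)].
Proof.
split; [exact: centralizer_lie|by move=> x []| |by rewrite ss_set_centralizer_torus].
move=> A _ Ah; exists h; split=> //; first exact: centralizer_lie.
(* The whole centralizer is nilpotent: the span of [E] is commutative and annihilates the y-parts,
   so a double bracket is a sum of triple products of y-parts. *)
exists 2%N; rewrite /lower_central /=.
have step x x' x'' : h x -> h x' -> h x'' -> bracket x (bracket x' x'') = 0.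
  move=> /centralizer_torus_decomposition[s [y [[[_ ts] yE gy ->] _]]].
  move=> /centralizer_torus_decomposition[s' [y' [[[_ ts'] yE' gy' ->] _]]].
  move=> /centralizer_torus_decomposition[s'' [y'' [[[_ ts''] yE'' gy'' ->] _]]].
  have [a1 a2] := span_annihilated yE' ts; have [a3 a4] := span_annihilated yE'' ts.
  have [b1 b2] := span_annihilated yE'' ts'; have [b3 b4] := span_annihilated yE' ts''.
  have -> : bracket (s' + y') (s'' + y'') = bracket y' y''.
    rewrite /bracket !tmulDl !tmulDr (span_comm2 EO ts' ts'') b1 b2 b3 b4 !addr0 !add0r.
    by rewrite opprD addrACA subrr add0r.
  rewrite /bracket !(tmulDl, tmulDr, tmulNl, tmulNr) !tmulA a1 a3 !tmul0l.
  rewrite -[y' ** y'' ** s]tmulA -[y'' ** y' ** s]tmulA a2 a4 !tmul0r !Enil //.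
  by rewrite !(oppr0, addr0).
apply/seteqP; split; last by move=> x ->; case: (subspace_lin_span [set z | exists x y : T,
  [/\ h x, bracket_span h h y & z = bracket x y]]).
apply: lin_span_sub; first by split=> // a x y /= -> ->; rewrite scaler0 addr0.
move=> _ [x [y [hx hy ->]]] /=.
apply: (lin_span_sub (subspace_ker (bracketPr x)) _ hy) => _ [x' [x'' [h' h'' ->]]] /=.
exact: step.
Qed.

(** This gives injectivity, as the right-hand side depends on [E] only through the centralizer. *)
Lemma recover_idempotents : E = [set e | [/\ rank_one e, forall x, h x -> x ** e = e ** x &
  exists2 x, h x & e ** x = e]].
Proof.
apply/seteqP; split=> [e Ee|e [re eh [x hx ex]]].
  split; [exact: EO.1|by move=> x /centralizer_torusP[_ xE]; exact: xE|].
  have [f [tf ff ef fe]] := Esep Ee; exists (e - f).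
    by have [_ Et] := tf; apply/centralizer_torusP; split=> [|e']; [exact: tf.1|exact: span_commE].
  by rewrite tmulBr ef subr0 (rank_one_idem (EO.1 _ Ee)).
have eE f : E f -> e ** f = f ** e.
  apply: torus_separates => t [gt Et]; apply/esym; apply: eh.
  by apply/centralizer_torusP; split=> // f'; exact: span_commE.
have [s [y [[[gs Es] yE gy xsy] _]]] := centralizer_torus_decomposition hx.
(* [e ** x = e] and [s ** y = 0] give e y = e y y; iterating produces the factor y y y. *)
have ey : e ** y = 0.
  have h1 : e ** y = e ** y ** y.
    by rewrite -{1}ex xsy tmulDr tmulDl -[e ** s ** y]tmulA (span_annihilated yE Es).1 tmul0r add0r.
  by rewrite h1 h1 -!tmulA [y ** (y ** y)]tmulA Enil // tmul0r.
have es : e ** s = e by rewrite -[RHS]ex xsy tmulDr ey addr0.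
have [f [Ef ef]] : exists f, E f /\ e ** f != 0.
  apply: contrapT => H; move: (rank_one_neq0 re); rewrite -es => /eqP; apply.
  apply: (lin_span_sub (subspace_ker (tmulPr e)) _ Es) => f Ef /=.
  by apply/eqP; apply: contrapT => /negP h0; apply: H; exists f.
by rewrite (rank_one_comm_eq re (EO.1 _ Ef) (eE _ Ef) ef).
Qed.

End Forward.

End RankOne.

Section Idempotents.
Context {R : realType} {V W : lmodType R[i]} (T : tensor_algebra V W).
Local Notation K := R[i].
Implicit Types (x y s e f p q : T) (u v : V) (w : W) (a b : K) (g h N E : set T).
Local Notation tens := (tens T).
Local Notation pair := (pairing T).

(* The trace of an idempotent is its rank. *)
Lemma trace_idempotent p : p ** p = p ->
  exists m : nat, trace p = m%:R /\ (m = 0%N -> p = 0).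
Proof.
move=> pp; have [|m [tr hm]] := @trace_eigenvalues _ _ _ T p 1.
  move=> a u u0 h; have : (a * a - a) *: u = 0.
    by rewrite scalerBl -scalerA -h -actZr -h -actM pp subrr.
  have -> : a * a - a = a * (a - 1) by rewrite mulrBr mulr1.
  move/eqP; rewrite scaler_eq0 (negbTE u0) orbF mulf_eq0 subr_eq0.
  by case/orP => /eqP; [left|right].
exists m; split=> // m0; have [|k hk] := hm; first by rewrite tr m0 mulr0n.
apply: act_inj => u; rewrite act0l -(hk (act p u)).
by elim: k {hk} => //= k <-; rewrite -actM pp.
Qed.

(** Take a nonzero vector p u and a functional that is 1 on it; precomposing the functional with p
    makes the tensor absorb p on both sides. *)
Lemma sub_rank_one p : p ** p = p -> p != 0 ->
  exists e, [/\ rank_one e, p ** e = e & e ** p = e].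
Proof.
move=> pp p0; have [u hu] : exists u, act p u != 0.
  apply: contrapT => h; move/eqP: p0; apply; apply: act_inj => u; rewrite act0l.
  by apply/eqP; apply: contrapT => /negP h'; apply: h; exists u.
have [w0 hw0] := dual_left T hu.
have [w ew pw] := tens_tmul (act p u) w0 p.
exists (tens (act p u) w); split.
- by exists (act p u), w; rewrite pw -actM pp.
- by rewrite tmul_tens -actM pp.
- by rewrite -ew -tmulA pp.
Qed.

(* A corner [p ** T ** p] that is not one-dimensional contains the Borel
   subalgebra of an sl_2. *)
Lemma rank_one_or_borel p : p ** p = p -> p != 0 ->
  rank_one p \/ exists x y, [/\ p ** x = x /\ x ** p = x, p ** y = y /\ y ** p = y,
    trace x = 0 /\ trace y = 0, bracket x y = 2 *: y & y != 0].
Proof.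
move=> pp p0; have [e [re pe ep]] := sub_rank_one pp p0.
have [->|ne] := eqVneq p e; [by left|right].
have ee := rank_one_idem re.
have qq : (p - e) ** (p - e) = p - e.
  by rewrite tmulBl !tmulBr pp ep pe ee subrr subr0.
have [|f [rf qf fq]] := sub_rank_one qq; first by rewrite subr_eq0.
have ef : e ** f = 0 by rewrite -qf tmulA tmulBr ep ee subrr tmul0l.
have fe : f ** e = 0 by rewrite -fq -tmulA tmulBl pe ee subrr tmul0r.
have pf : p ** f = f by rewrite -[RHS]qf tmulBl ef subr0.
have fp : f ** p = f by rewrite -[RHS]fq tmulBr fe subr0.
have [v [w [e_ vw]]] := re; have [v' [w' [f_ vw']]] := rf.
have [v0 w0] := pair1_neq0 vw; have [v'0 w'0] := pair1_neq0 vw'.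
have pv'w : pair v' w = 0 by apply: (tmul_tens_eq0 v0 w'0); rewrite -e_ -f_.
have pvw' : pair v w' = 0 by apply: (tmul_tens_eq0 v'0 w0); rewrite -e_ -f_.
have ey : e ** tens v w' = tens v w' by rewrite e_ tmulE vw scale1r.
have yf : tens v w' ** f = tens v w' by rewrite f_ tmulE vw' scale1r.
have fy : f ** tens v w' = 0 by rewrite f_ tmulE pvw' scale0r.
have ye : tens v w' ** e = 0 by rewrite e_ tmulE pvw' scale0r.
(* On the plane of v and v' these are diag(1, -1) and the elementary matrix sending v' to v, whence
   the constant 2. *)
exists (e - f), (tens v w'); split.
- by rewrite tmulBl tmulBr pe pf ep fp.
- by split; [rewrite -[in LHS]ey tmulA pe ey|rewrite -[in LHS]yf -tmulA fp yf].
- by rewrite traceB trace_tens !rank_one_trace // subrr.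
- by rewrite /bracket tmulBl tmulBr ey fy ye yf subr0 sub0r opprK scaler_nat mulr2n.
- exact: tens_neq0.
Qed.

Lemma exists_orth_rank_one e : rank_one e ->
  exists f, [/\ rank_one f, e ** f = 0 & f ** e = 0].
Proof.
move=> [v [w [-> vw]]].
have [v' v'0 hv'] := kernel_left T (fun _ : 'I_1 => w).
have [w0 hw0] := dual_left T v'0.
exists (tens v' (w0 - pair v w0 *: w)); split.
- exists v', (w0 - pair v w0 *: w); split=> //.
  by rewrite linearBr /= pairZr (hv' ord0) mulr0 subr0.
- by rewrite tmulE (hv' ord0) scale0r.
- by rewrite tmulE linearBr /= pairZr vw mulr1 subrr scale0r.
Qed.

End Idempotents.

(** * From a Cartan subalgebra to its idempotents *)

Section Backward.
Context {R : realType} {V W : lmodType R[i]} (T : tensor_algebra V W).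
Local Notation K := R[i].
Implicit Types (x y s e f p q : T) (u v : V) (w : W) (a b : K).

Variables (g h : set T).
Hypothesis gss : ss_closed g.
Hypothesis hg : h `<=` g.
Hypothesis hn : locally_nilpotent h.
Local Notation S := (ss_set h).
Hypothesis hE : h = centralizer g S.

Lemma cartan_memP x : h x <-> g x /\ forall s, S s -> x ** s = s ** x.
Proof.
rewrite {1}hE; split=> -[gx hx]; split=> // s Ss; apply/bracket_eq0; exact: hx.
Qed.

Lemma cartan_ad_nilpotent x y : h x -> h y -> exists m, iter m (bracket x) y = 0.
Proof.
move=> hx hy; have fin : finite_set [set x; y] by [].
have [|k [kl kh kxy [m hm]]] := hn fin; first by move=> z [->|->].
exists m; have kx : k x by apply: kxy; left.
have ky : k y by apply: kxy; right.
suff : lower_central k m (iter m (bracket x) y) by rewrite hm.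
elim: (m) => //= l IH; apply: sub_lin_span; by exists x, (iter l (bracket x) y).
Qed.

(** The form in which local nilpotence is used against a Borel relation [x, y] = 2y. *)
Lemma cartan_no_eigen x y a : h x -> h y -> a != 0 -> bracket x y = a *: y -> y = 0.
Proof.
move=> hx hy a0 e; have [m] := cartan_ad_nilpotent hx hy.
have -> : iter m (bracket x) y = a ^+ m *: y.
  elim: m => [|m /= ->]; first by rewrite expr0 scale1r.
  by rewrite (lin_opZ (bracketPr x)) e scalerA exprSr.
by move/eqP; rewrite scaler_eq0 expf_eq0 (negbTE a0) andbF => /eqP.
Qed.

Lemma cartan_ss_comm s y : S s -> h y -> s ** y = y ** s.
Proof.
move=> [x hx xs] hy; have [m hm] := cartan_ad_nilpotent hx hy.
by apply/bracket_eq0; exact: (ad_ss_part_ker xs hm).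
Qed.

(** s commutes with all of [h], in particular with the x' whose part is s'; as s' is in the
    bicommutant of x', it commutes with s. *)
Lemma cartan_ss_sub : S `<=` h.
Proof.
move=> s Ss; have [x hx xs] := Ss; apply/cartan_memP; split; first exact: (gss (hg hx) xs).
move=> s' [x' hx' [_ _ cs']]; apply/esym; apply: cs'; apply/esym; exact: cartan_ss_comm.
Qed.

Lemma cartan_ss_mem x : g x -> semisimple x -> (forall s, S s -> x ** s = s ** x) -> S x.
Proof.
by move=> gx sx cx; exists x; [apply/cartan_memP|exact: ss_part_semisimple].
Qed.

(** A commutative algebra containing the spectral projections of the elements of [S]; it is formed
    in [T] since [g] may contain no idempotent but 0. *)
Let Pc := [set p : T | forall y, (forall s, S s -> s ** y = y ** s) -> p ** y = y ** p].

Let Pc_S p s : Pc p -> S s -> p ** s = s ** p.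
Proof. by move=> Pp Ss; apply: Pp => s' Ss'; apply: cartan_ss_comm => //; exact: cartan_ss_sub. Qed.

Let Pc_comm p q : Pc p -> Pc q -> p ** q = q ** p.
Proof. by move=> Pp Pq; apply: Pp => s Ss; apply/esym; exact: Pc_S. Qed.

Let Pc_mul p q : Pc p -> Pc q -> Pc (p ** q).
Proof. by move=> Pp Pq y hy; rewrite -tmulA (Pq y hy) tmulA (Pp y hy) tmulA. Qed.

Let Pc_subspace : subspace Pc.
Proof.
split=> [y _|a x y Px Py z hz]; first by rewrite tmul0l tmul0r.
by rewrite tmulPl tmulPr Px // Py.
Qed.

(* The minimal idempotents of the double centralizer of [S] that are not killed
   by [S]; for so there can be one more minimal idempotent, [u (x) u] with [u]
   spanning the orthogonal complement of the system. *)
Definition cartan_idempotents : set T := [set p | [/\ Pc p, p ** p = p, p != 0,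
  exists2 s, S s & p ** s != 0 &
  forall q, Pc q -> q ** q = q -> p ** q = q -> q = 0 \/ q = p]].

Local Notation E := cartan_idempotents.

Let S_semisimple s : S s -> semisimple s.
Proof. by move=> [x _ []]. Qed.

(** By minimality p q is 0 or p for each spectral projection q of s. If it is p, then s is the
    eigenvalue of q on p; if it is always 0, then s p = 0. *)
Lemma cartan_idempotents_scalar p s : E p -> S s -> exists a, s ** p = a *: p.
Proof.
move=> [Pp pp p0 _ pmin] Ss; have ss := S_semisimple Ss.
have [[a [a0 [q [[qq sq _ qc] pq]]]]|H] := pselect (exists a, a != 0 /\ exists q,
    [/\ q ** q = q, s ** q = a *: q,
    forall b u, act s u = b *: u -> act q u = (b == a)%:R *: u &
    forall y, s ** y = y ** s -> q ** y = y ** q] /\ p ** q != 0).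
  have Pq : Pc q by move=> y hy; apply: qc; exact: hy.
  have [|||/eqP|pqp] := pmin (p ** q); first exact: Pc_mul.
  - by rewrite tmulA -[p ** q ** p]tmulA -(Pc_comm Pp Pq) tmulA pp -tmulA qq.
  - by rewrite tmulA pp.
  - by rewrite (negbTE pq).
  by exists a; rewrite -pqp (Pc_comm Pp Pq) tmulA sq tmulZl.
exists 0; rewrite scale0r -(Pc_S Pp Ss); apply: act_inj => u; rewrite act0l.
apply: (lin_span_sub (subspace_ker (actPr (p ** s))) _ (ss u)) => z [a za] /=.
rewrite actM za actZr; have [->|a0] := eqVneq a 0; first by rewrite scale0r.
have [q hq] := spectral_projection ss a0; have [_ _ qE _] := hq.
have pq : p ** q = 0.
  by apply/eqP; apply: contrapT => /negP h'; apply: H; exists a; split=> //; exists q.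
have -> : z = act q z by rewrite (qE a z za) eqxx scale1r.
by rewrite -actM pq act0l scaler0.
Qed.

Lemma cartan_corner_comm p x s : E p -> p ** x = x -> x ** p = x -> S s -> x ** s = s ** x.
Proof.
move=> Ep px xp Ss; have [a ha] := cartan_idempotents_scalar Ep Ss.
have ps : p ** s = s ** p by apply: Pc_S => //; case: Ep.
by rewrite -{1}xp -tmulA ps ha tmulZr xp -{2}px tmulA ha tmulZl px.
Qed.

(** Induction on the rank, read off the trace: a non-minimal q splits as q' + (q - q'). Both pieces
    inherit the eigenvalue condition, which keeps the minimal ones from being killed by [S]. *)
Let span_E_idem m q : Pc q -> q ** q = q -> trace q = m%:R ->
  (exists a, a != 0 /\ exists2 s, S s & s ** q = a *: q) -> lin_span E q.
Proof.
elim/ltn_ind: m q => m IH q Pq qq tq [a [a0 [s Ss sq]]].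
have [->|q0] := eqVneq q 0; first by case: (subspace_lin_span E).
have [[q' [Pq' qq' q'1 q'0 q'q]]|H] := pselect (exists q', [/\ Pc q', q' ** q' = q',
    q ** q' = q', q' != 0 & q' != q]); last first.
  apply: sub_lin_span; split=> //.
    by exists s => //; rewrite (Pc_S Pq Ss) sq scaler_eq0 (negbTE a0).
  move=> q' Pq' qq' q'1; have [->|q'0] := eqVneq q' 0; first by left.
  have [->|q'q] := eqVneq q' q; first by right.
  by case: H; exists q'.
have q'2 : q' ** q = q' by rewrite -(Pc_comm Pq Pq').
have Pq'' : Pc (q - q') by exact: (subspaceB Pc_subspace Pq Pq').
have qq'' : (q - q') ** (q - q') = q - q'.
  by rewrite tmulBl !tmulBr qq q'1 q'2 qq' subrr subr0.
have [m1 [t1 z1]] := trace_idempotent qq'; have [m2 [t2 z2]] := trace_idempotent qq''.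
have em : m = (m1 + m2)%N.
  apply: (mulrIn (R := K) (x := 1)); first exact: oner_neq0.
  by rewrite mulrnDr -t1 -t2 -tq -traceD addrC subrK.
have m1_gt0 : (0 < m1)%N by rewrite lt0n; apply: contraNneq q'0 => /z1 ->.
have m2_gt0 : (0 < m2)%N.
  by rewrite lt0n; apply: contraNneq q'q => /z2/eqP; rewrite subr_eq0 eq_sym.
rewrite -(subrK q' q); apply: (subspaceD (subspace_lin_span _)).
- apply: (IH m2) => //; first by rewrite em -addn1 addnC leq_add2r.
  exists a; split=> //; exists s => //.
  by rewrite tmulBr sq -q'1 tmulA sq tmulZl scalerBr.
- apply: (IH m1) => //; first by rewrite em -addn1 leq_add2l.
  exists a; split=> //; exists s => //.
  by rewrite -{1}q'1 tmulA sq tmulZl q'1.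
Qed.

Lemma cartan_ss_span : S `<=` lin_span E.
Proof.
move=> s Ss; have ss := S_semisimple Ss.
have [p p0 hp] := act_algebraic s.
have [r [m [ur _ hr]]] := dvdp_primary [::] p0.
(* Made total in a for [choice]; at a = 0 the dummy value gets weight 0 in the sum. *)
have hq a : exists q, a != 0 -> [/\ q ** q = q, s ** q = a *: q,
    forall b u, act s u = b *: u -> act q u = (b == a)%:R *: u &
    forall y, s ** y = y ** s -> q ** y = y ** q].
  have [->|a0] := eqVneq a 0; first by exists 0.
  by have [q] := spectral_projection ss a0; exists q.
have [q qP] := choice hq.
have -> : s = \sum_(a <- r) a *: q a.
  apply: act_inj => u; pose P := [set u | act s u = act (\sum_(a <- r) a *: q a) u].
  have hP : subspace P.
    split; first by rewrite /P /= !act0r.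
    by move=> a y z /= h1 h2; rewrite /P /= !actPr h1 h2.
  apply: (lin_span_sub hP _ (ss u)) => z [b zb]; rewrite /P /= act_suml zb.
  have [->|z0] := eqVneq z 0; first by rewrite scaler0 big1 // => a _; rewrite act0r.
  have br : b \in r.
    apply: contraNT z0 => br; have := poly_act_dvd (actPr s) hr (hp z).
    rewrite (poly_act_eigen (actPr s) _ zb) => /eqP; rewrite scaler_eq0 => /orP[|//].
    by rewrite horner_exp expf_eq0 /= -[_ == 0]rootE root_prod_XsubC (negbTE br).
  rewrite (bigD1_seq b) //= big1 ?addr0 => [|a ab].
    have [->|b0] := eqVneq b 0; first by rewrite !scale0r act0l.
    by have [_ _ qE _] := qP b b0; rewrite actZl (qE b z zb) eqxx scale1r.
  have [->|a0] := eqVneq a 0; first by rewrite scale0r act0l.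
  by have [_ _ qE _] := qP a a0; rewrite actZl (qE b z zb) eq_sym (negbTE ab) scale0r scaler0.
apply: (subspace_sum (subspace_lin_span E)) => a _.
have [->|a0] := eqVneq a 0; first by rewrite scale0r; case: (subspace_lin_span E).
apply: (subspaceZ _ (subspace_lin_span E)).
have [qq sq _ qc] := qP a a0; have [k [tk _]] := trace_idempotent qq.
apply: (span_E_idem _ qq tk); last by exists a; split=> //; exists s.
by move=> y hy; apply: qc; exact: hy.
Qed.

Lemma cartan_idempotents_orth p q : E p -> E q -> p <> q -> p ** q = 0.
Proof.
move=> [Pp pp p0 _ pmin] [Pq qq q0 _ qmin] npq; have pqc := Pc_comm Pp Pq.
have pqpq : (p ** q) ** (p ** q) = p ** q.
  by rewrite tmulA -[p ** q ** p]tmulA -pqc tmulA pp -tmulA qq.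
have [|||//|e1] := pmin (p ** q) => //; [exact: Pc_mul|by rewrite tmulA pp|].
have [|||//|e2] := qmin (p ** q) => //; first exact: Pc_mul.
  by rewrite pqc tmulA qq.
by case: npq; rewrite -e1 -{2}e2.
Qed.

(** The step that depends on the algebra: corner elements commute with [S], but the way to bring
    them into [g] varies. *)
Hypothesis corner : forall p x y, E p -> p ** x = x /\ x ** p = x -> p ** y = y /\ y ** p = y ->
  trace x = 0 -> trace y = 0 -> bracket x y = 2 *: y -> y = 0.

Lemma cartan_orth_idempotents : orth_idempotents E.
Proof.
split=> [p Ep|p q]; last exact: cartan_idempotents_orth.
have [_ pp p0 _ _] := Ep.
have [//|[x [y [px py [tx ty] xy y0]]]] := rank_one_or_borel pp p0.
by move/eqP: y0; case; exact: (corner Ep px py tx ty xy).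
Qed.

Lemma span_cartan_idempotents_comm x s : lin_span E x -> S s -> x ** s = s ** x.
Proof.
by move=> Ex Ss; apply: span_comm Ex => e [Pe _ _ _ _]; apply/esym; exact: Pc_S.
Qed.

Lemma cartan_ss_torus : S = torus g E.
Proof.
apply/seteqP; split=> [s Ss|t [gt Et]].
  by split; [exact/hg/cartan_ss_sub|exact: cartan_ss_span].
apply: cartan_ss_mem => // [|s Ss]; first exact: (span_semisimple cartan_orth_idempotents Et).
exact: span_cartan_idempotents_comm.
Qed.

Lemma cartan_centralizer_torus : h = centralizer g (torus g E).
Proof. by rewrite -cartan_ss_torus. Qed.

(** Such an x commutes with [S], so it belongs to [S] and to the span of [E]. This yields maximality
    for so and sp. *)
Lemma cartan_annihilated x : g x -> semisimple x -> annihilated E x -> x = 0.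
Proof.
move=> gx sx xE; apply: (span_annihilated0 cartan_orth_idempotents xE).
apply: cartan_ss_span; apply: cartan_ss_mem => // s /cartan_ss_span Es.
by have [-> ->] := span_annihilated xE Es.
Qed.

End Backward.

(** * Systems of lines *)

Section Lines.
Context {K : fieldType} {U : lmodType K}.
Implicit Types (u v : U) (L : set U).

Definition line_of v : set U := [set a *: v | a in [set: K]].

Lemma line_of_mem v : line_of v v.
Proof. by exists 1; rewrite ?scale1r. Qed.

Lemma line_ofZ a v : a != 0 -> line_of (a *: v) = line_of v.
Proof.
move=> a0; apply/seteqP; split=> _ [b _ <-]; first by exists (b * a); rewrite ?scalerA.
by exists (b / a) => //; rewrite scalerA divfK.
Qed.

Lemma line_line_of v : v != 0 -> line (line_of v).
Proof. by move=> v0; exists v. Qed.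

Lemma lineE L v : line L -> L v -> v != 0 -> L = line_of v.
Proof.
move=> [u u0 ->] [a _ <-]; rewrite scaler_eq0 negb_or => /andP[a0 _].
exact: (esym (line_ofZ u a0)).
Qed.

Lemma line_subspace L : line L -> subspace L.
Proof.
move=> [v _ ->]; split; first by exists 0; rewrite ?scale0r.
by move=> a _ _ [b _ <-] [c _ <-]; exists (a * b + c) => //; rewrite scalerDl scalerA.
Qed.

End Lines.

Section Enumeration.
Context {U : choiceType}.

Lemma countable_enumeration (u0 : U) (E : set U) : countable E ->
  exists (I : set nat) (f : nat -> U),
    [/\ finite_set I \/ I = [set i | (0 < i)%N], I `<=` [set i | (0 < i)%N],
        forall i j, I i -> I j -> f i = f j -> i = j & f @` I = E].
Proof.
move=> cE; have [f [finj fE]] : exists f : U -> nat, {in E &, injective f} /\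
    (finite_set (f @` E) \/ f @` E = setT).
  have [fin|inf] := pselect (finite_set E).
    have /pcard_injP[f finj] := cE; exists f; split=> //; left; exact: finite_image.
  have /card_set_bijP[f [_ finj fsurj]] := eq_card_nat cE inf.
  by exists f; split=> //; right; apply/seteqP; split.
(* f counts from 0 and the indices from 1, hence [i.-1]; [u0] is the value outside the index set. *)
pose g i := xget u0 [set e | E e /\ f e = i.-1].
pose I := S @` (f @` E).
have gE e : E e -> g (f e).+1 = e.
  move=> Ee; rewrite /g; case: xgetP => [e' _ [Ee' /= h]|/(_ e)]; last by case.
  by apply: finj => //; rewrite inE.
exists I, g; split.
- rewrite /I; case: fE => [fin|->]; [left; exact: finite_image|right].
  by apply/seteqP; split=> [_ [i _ <-]|[//|i] _] //=; exists i.
- by move=> _ [i _ <-].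
- by move=> _ _ [_ [e Ee <-] <-] [_ [e' Ee' <-] <-]; rewrite !gE // => ->.
- apply/seteqP; split=> [_ [_ [_ [e Ee <-] <-] <-]|e Ee]; first by rewrite gE.
  by exists (f e).+1; [exists (f e) => //; exists e|exact: gE].
Qed.

End Enumeration.

(** * Dictionary between systems of lines and orthogonal idempotents *)

Section Systems.
Context {R : realType} {V W : lmodType R[i]} (T : tensor_algebra V W).
Local Notation K := R[i].
Implicit Types (x y s e f p q : T) (u v : V) (w : W) (a b : K) (g h E : set T).
Implicit Types (D : set (set V) * set (set W)) (L : set V) (M : set W).
Local Notation tens := (tens T).
Local Notation pair := (pairing T).

(** With pairing normalized to 1 the tensor depends only on the two lines. *)
Definition idem_of D : set T := [set e | exists v w,
  [/\ exists2 L, D.1 L & L v, exists2 M, D.2 M & M w, pair v w = 1 & e = tens v w]].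

Definition lines_of E : set (set V) * set (set W) :=
  ([set L | exists v w, [/\ E (tens v w), pair v w = 1 & L = line_of v]],
   [set M | exists v w, [/\ E (tens v w), pair v w = 1 & M = line_of w]]).

(** Dual systems freed from their indices; a self-dual system D fits as (D, D), so both kinds share
    the dictionary. *)
Definition pairing_system D :=
  [/\ forall L, D.1 L -> line L, forall M, D.2 M -> line M,
      forall L, D.1 L -> exists M v w, [/\ D.2 M, L v, M w & pair v w = 1],
      forall M, D.2 M -> exists L v w, [/\ D.1 L, L v, M w & pair v w = 1] &
      forall L M L' M' v w v' w', D.1 L -> D.2 M -> D.1 L' -> D.2 M' ->
        L v -> M w -> L' v' -> M' w' -> pair v w = 1 -> pair v' w' = 1 ->
        pair v w' != 0 -> L = L' /\ M = M'].

Lemma tens_lines_eq v w v' w' : tens v w = tens v' w' -> pair v w = 1 -> pair v' w' = 1 ->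
  line_of v = line_of v' /\ line_of w = line_of w'.
Proof.
move=> e p1 p2; have h u : pair u w *: v = pair u w' *: v' by rewrite -!act_tens e.
have c0 : pair v' w != 0.
  apply/eqP => c0; have := h v'; rewrite c0 p2 scale0r scale1r => v'0.
  by move/eqP: p2; rewrite -v'0 linear0l eq_sym oner_eq0.
have ev : v' = pair v' w *: v by rewrite h p2 scale1r.
have ew : w = pair v' w *: w'.
  apply/eqP; rewrite -subr_eq0; apply/eqP; case: (pairing_nondeg T) => _; apply=> u.
  have hu := h u; rewrite [in RHS]ev scalerA in hu.
  move/eqP: hu; rewrite -subr_eq0 -scalerBl scaler_eq0.
  rewrite (negbTE (pair1_neq0 p1).1) orbF => /eqP e'.
  by rewrite linearBr /= pairZr mulrC.
by split; [rewrite ev line_ofZ|rewrite ew line_ofZ].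
Qed.

Section Idempotents.
Variable E : set T.
Hypothesis EO : orth_idempotents E.

Lemma orth_pair0 v w v' w' : E (tens v w) -> E (tens v' w') -> pair v w = 1 -> pair v' w' = 1 ->
  tens v w <> tens v' w' -> pair v w' = 0.
Proof.
move=> e1 e2 p1 p2 ne; have := EO.2 _ _ e2 e1 (nesym ne).
by apply: tmul_tens_eq0; [exact: (pair1_neq0 p2).1|exact: (pair1_neq0 p1).2].
Qed.

Lemma idem_of_lines_of : idem_of (lines_of E) = E.
Proof.
apply/seteqP; split=> [_ [v [w [[_ [v1 [w1 [E1 p1 ->]]] [a _ <-]] [_ [v2 [w2 [E2 p2 ->]]] [b _ <-]] p ->]]]|e Ee].
  have [eq12|ne12] := pselect (tens v1 w1 = tens v2 w2); last first.
    by move/eqP: p; rewrite pairZl pairZr (orth_pair0 E1 E2) // !mulr0 eq_sym oner_eq0.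
  have e : tens v1 w1 = pair v2 w1 *: tens v1 w2.
    by rewrite -tmulE -eq12 tmulE p1 scale1r.
  have c1 : pair v2 w1 * pair v1 w2 = 1.
    by have := congr1 (@trace _ _ _ T) e; rewrite traceZ !trace_tens p1.
  suff -> : tens (a *: v1) (b *: w2) = tens v1 w1 by [].
  rewrite tensZl tensZr scalerA e; congr (_ *: _).
  move: p; rewrite pairZl pairZr mulrA => p.
  apply: (mulIf (x := pair v1 w2)); last by rewrite p c1.
  by apply/eqP => h; move/eqP: c1; rewrite h mulr0 eq_sym oner_eq0.
have [v [w [ee p]]] := EO.1 _ Ee; exists v, w; split=> //.
- by exists (line_of v); [exists v, w; rewrite -ee|exact: line_of_mem].
- by exists (line_of w); [exists v, w; rewrite -ee|exact: line_of_mem].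
Qed.

(** Every range vector lies in the span of an initial piece of a basis, and each such span contains
    the range vectors of finitely many idempotents. *)
Lemma countable_orth_idempotents : countable E.
Proof.
have [b [bspan _]] := dim_left T.
have -> : E = \bigcup_n [set e | E e /\ exists (c : 'I_n -> K) w, e = tens (\sum_k c k *: b k) w].
  apply/seteqP; split=> [e Ee|e [n _ []//]].
  have [v [w [ee _]]] := EO.1 _ Ee.
  suff [n [c hc]] : exists n (c : nat -> K), forall N, (n <= N)%N -> v = \sum_(k < N) c k *: b k.
    by exists n => //; split=> //; exists (fun k => c k), w; rewrite -hc.
  pose Q := [set v | exists n (c : nat -> K), forall N, (n <= N)%N -> v = \sum_(k < N) c k *: b k].
  have hQ : subspace Q.
    split; first by exists 0%N, (fun=> 0) => N _; rewrite big1 // => k _; rewrite scale0r.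
    move=> a x y [n [c hx]] [n' [c' hy]].
    exists (maxn n n'), (fun k => a * c k + c' k) => N; rewrite geq_max => /andP[h h'].
    rewrite {1}(hx N h) {1}(hy N h') scaler_sumr -big_split; apply: eq_bigr => k _ /=.
    by rewrite scalerDl scalerA.
  have : lin_span (range b) v by rewrite bspan.
  apply: (lin_span_sub hQ) => _ [k _ <-].
  exists k.+1, (fun j => (j == k)%:R) => N hN.
  rewrite (bigD1 (Ordinal hN)) //= eqxx scale1r big1 ?addr0 // => j.
  by rewrite -val_eqE /= => /negbTE ->; rewrite scale0r.
apply: bigcup_countable => // n _; apply: finite_set_countable.
exact: (finite_orth_idempotents (fun k : 'I_n => b k) EO).
Qed.

Lemma orth_tens_choice : exists (vv : T -> V) (ww : T -> W),
  forall e, E e -> e = tens (vv e) (ww e) /\ pair (vv e) (ww e) = 1.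
Proof.
have h e : exists vw : V * W, E e -> e = tens vw.1 vw.2 /\ pair vw.1 vw.2 = 1.
  have [Ee|nE] := pselect (E e); last by exists (0, 0).
  by have [v [w h]] := EO.1 _ Ee; exists (v, w).
have [f fP] := choice h; by exists (fst \o f), (snd \o f).
Qed.

Lemma pair_sets_lines v w v' w' : E (tens v w) -> pair v w = 1 ->
  E (tens v' w') -> pair v' w' = 1 ->
  pair_sets T (line_of v) (line_of w') = if tens v w == tens v' w' then setT else [set 0].
Proof.
move=> Ee p Ef p'; case: eqP => [e|ne].
  have [_ <-] := tens_lines_eq e p p'.
  apply/seteqP; split=> // c _; exists (c *: v), w; split.
  - by exists c.
  - exact: line_of_mem.
  - by rewrite pairZl p mulr1.
have p0 : pair v w' = 0 := orth_pair0 Ee Ef p p' ne.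
apply/seteqP; split=> [_ [_ [_ [[a _ <-] [b _ <-] ->]]]|_ ->].
  by rewrite pairZl pairZr p0 !mulr0.
by exists v, w'; split=> //; exact: line_of_mem.
Qed.

Lemma lines_of_dual_system : dual_system T (lines_of E).
Proof.
have [I [f [hI _ finj fI]]] := countable_enumeration (0 : T) countable_orth_idempotents.
have [vv [ww hvw]] := orth_tens_choice.
have fE i : I i -> E (f i) by move=> Ii; rewrite -fI; exists i.
exists I, (fun i => line_of (vv (f i))), (fun i => line_of (ww (f i))); split=> //.
- move=> i /fE /hvw[_ p]; have [v0 w0] := pair1_neq0 p.
  by split; exact: line_line_of.
- move=> i j Ii Ij; have [ei pi] := hvw _ (fE _ Ii); have [ej pj] := hvw _ (fE _ Ij).
  rewrite (pair_sets_lines (w := ww (f i)) (v' := vv (f j))) -?ei -?ej //; try exact: fE.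
  have [->|nij] := eqVneq i j; first by rewrite eqxx.
  by case: eqP => // /(finj _ _ Ii Ij) e; rewrite e eqxx in nij.
- apply/seteqP; split=> [_ [v [w [Evw p ->]]]|_ [i Ii <-]].
    have [i Ii fi] : (f @` I) (tens v w) by rewrite fI.
    exists i => //; have [e p'] := hvw _ Evw.
    by have [-> _] := tens_lines_eq e p p'; rewrite fi.
  by have [e p] := hvw _ (fE _ Ii); exists (vv (f i)), (ww (f i)); rewrite -e; split=> //; exact: fE.
- apply/seteqP; split=> [_ [v [w [Evw p ->]]]|_ [i Ii <-]].
    have [i Ii fi] : (f @` I) (tens v w) by rewrite fI.
    exists i => //; have [e p'] := hvw _ Evw.
    by have [_ ->] := tens_lines_eq e p p'; rewrite fi.
  by have [e p] := hvw _ (fE _ Ii); exists (vv (f i)), (ww (f i)); rewrite -e; split=> //; exact: fE.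
Qed.

End Idempotents.

Section PairingSystem.
Variable D : set (set V) * set (set W).
Hypothesis DP : pairing_system D.

Lemma idem_of_orth : orth_idempotents (idem_of D).
Proof.
have [D1 D2 _ _ Dsep] := DP; split=> [_ [v [w [_ _ p ->]]]|]; first by exists v, w.
move=> _ _ [v [w [[L DL Lv] [M DM Mw] p ->]]] [v' [w' [[L' DL' Lv'] [M' DM' Mw'] p' ->]]] ne.
rewrite tmulE; have [->|h0] := eqVneq (pair v' w) 0; first by rewrite scale0r.
have [eL eM] := Dsep _ _ _ _ _ _ _ _ DL' DM' DL DM Lv' Mw' Lv Mw p' p h0.
case: ne; move: Lv' Mw'; rewrite eL eM.
rewrite (lineE (D1 _ DL) Lv (pair1_neq0 p).1) (lineE (D2 _ DM) Mw (pair1_neq0 p).2).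
move=> [a _ ea] [b _ eb]; rewrite -ea -eb tensZl tensZr scalerA.
by move: p'; rewrite -ea -eb pairZl pairZr p mulr1 => ->; rewrite scale1r.
Qed.

Lemma lines_of_idem_of : lines_of (idem_of D) = D.
Proof.
have [D1 D2 De1 De2 Dsep] := DP; rewrite [RHS]surjective_pairing; congr (_, _);
  apply/seteqP; split.
- move=> _ [v [w [[v' [w' [[L DL Lv] _ p e]]] p' ->]]].
  have [-> _] := tens_lines_eq e p' p.
  by rewrite -(lineE (D1 _ DL) Lv (pair1_neq0 p).1).
- move=> L DL; have [M [v [w [DM Lv Mw p]]]] := De1 _ DL; exists v, w; split=> //.
    by exists v, w; split=> //; [exists L|exists M].
  exact: (lineE (D1 _ DL) Lv (pair1_neq0 p).1).
- move=> _ [v [w [[v' [w' [_ [M DM Mw] p e]]] p' ->]]].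
  have [_ ->] := tens_lines_eq e p' p.
  by rewrite -(lineE (D2 _ DM) Mw (pair1_neq0 p).2).
- move=> M DM; have [L [v [w [DL Lv Mw p]]]] := De2 _ DM; exists v, w; split=> //.
    by exists v, w; split=> //; [exists L|exists M].
  exact: (lineE (D2 _ DM) Mw (pair1_neq0 p).2).
Qed.

Lemma system_torusE g : system_torus g D = torus g (idem_of D).
Proof.
have [D1 D2 _ _ _] := DP; congr (_ `&` _); apply/seteqP; split.
  apply: lin_span_sub; first exact: subspace_lin_span.
  move=> _ [v [w [[L DL Lv] [M DM Mw] p0 ->]]].
  have -> : tens v w = pair v w *: tens ((pair v w)^-1 *: v) w.
    by rewrite tensZl scalerA mulfV // scale1r.
  apply: (subspaceZ _ (subspace_lin_span _)); apply: sub_lin_span.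
  exists ((pair v w)^-1 *: v), w; split=> //; last by rewrite pairZl mulVf.
    by exists L => //; apply: (subspaceZ _ (line_subspace (D1 _ DL))).
  by exists M.
apply: lin_spanS => _ [v [w [hL hM p ->]]]; exists v, w; split=> //.
by rewrite p oner_neq0.
Qed.

End PairingSystem.

Lemma dual_system_pairing D : dual_system T D -> pairing_system D.
Proof.
move=> [I [L [M [_ Ll LM D1 D2]]]].
have cpl i : I i -> exists v w, [/\ L i v, M i w & pair v w = 1].
  move=> Ii; have := LM i i Ii Ii; rewrite eqxx => h.
  have [v [w [Lv Mw e]]] : pair_sets T (L i) (M i) 1 by rewrite h.
  by exists v, w.
split; rewrite ?D1 ?D2.
- by move=> _ [i /Ll[h _] <-].
- by move=> _ [i /Ll[_ h] <-].
- move=> _ [i Ii <-]; have [v [w [Lv Mw p]]] := cpl i Ii.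
  by exists (M i), v, w; split=> //; exists i.
- move=> _ [i Ii <-]; have [v [w [Lv Mw p]]] := cpl i Ii.
  by exists (L i), v, w; split=> //; exists i.
move=> _ _ _ _ v w v' w' [i Ii <-] [j Ij <-] [i' Ii' <-] [j' Ij' <-] Lv Mw Lv' Mw' p p' p0.
have sep k l vv ww : I k -> I l -> L k vv -> M l ww -> pair vv ww != 0 -> k = l.
  move=> Ik Il Lvv Mww h0; apply/eqP; apply: contraTT h0 => /negbTE kl.
  have : pair_sets T (L k) (M l) (pair vv ww) by exists vv, ww.
  by rewrite LM // kl => ->; rewrite eqxx.
have e1 : i = j by apply: (sep _ _ v w) => //; rewrite p oner_neq0.
have e2 : i' = j' by apply: (sep _ _ v' w') => //; rewrite p' oner_neq0.
have e3 : i = j' by apply: (sep _ _ v w').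
by rewrite -e1 e2 -e3.
Qed.

Lemma idem_ofS D D' : D.1 `<=` D'.1 -> D.2 `<=` D'.2 -> idem_of D `<=` idem_of D'.
Proof.
move=> h1 h2 _ [v [w [[L DL Lv] [M DM Mw] p ->]]]; exists v, w; split=> //.
  by exists L => //; exact: h1.
by exists M => //; exact: h2.
Qed.

Lemma lines_ofS E E' : E `<=` E' ->
  (lines_of E).1 `<=` (lines_of E').1 /\ (lines_of E).2 `<=` (lines_of E').2.
Proof. by move=> h; split=> _ [v [w [Evw p ->]]]; exists v, w; split=> //; exact: h. Qed.

Definition maximal_orth E := forall e, rank_one e -> ~ annihilated E e.

Lemma orth_idempotents1 E e : orth_idempotents E -> rank_one e -> annihilated E e ->
  orth_idempotents (E `|` [set e]).
Proof.
move=> [E1 EO] re hE; split=> [f [/E1//|->//]|x y [Ex|->] [Ey|->] ne] //.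
- exact: EO.
- by have [] := hE _ Ex.
- by have [] := hE _ Ey.
Qed.

(** An idempotent annihilated by those of D could be adjoined; conversely, idempotents of a larger
    system that are not from D are annihilated by those of D. *)
Lemma maximal_dual_systemP D : maximal_dual_system T D <->
  [/\ orth_idempotents (idem_of D), maximal_orth (idem_of D) & D = lines_of (idem_of D)].
Proof.
split=> [[dD Dmax]|[EO Emax DE]].
  have DP := dual_system_pairing dD; have EO := idem_of_orth DP.
  split=> //; last by rewrite lines_of_idem_of.
  move=> e re hE; have EO' := orth_idempotents1 EO re hE.
  have [s1 s2] := lines_ofS (@subsetUl _ (idem_of D) [set e]).
  have := Dmax _ (lines_of_dual_system EO'); rewrite lines_of_idem_of // in s1 s2 *.
  move=> /(_ s1 s2) eD; have Ee : idem_of D e.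
    by rewrite -eD idem_of_lines_of //; right.
  have [h _] := hE _ Ee; move/eqP: (rank_one_neq0 re); apply.
  by rewrite -h rank_one_idem.
have dD : dual_system T D by rewrite DE; exact: lines_of_dual_system.
split=> // D' dD' s1 s2; have DP' := dual_system_pairing dD'.
have EO' := idem_of_orth DP'; have sE := idem_ofS s1 s2.
rewrite DE -(lines_of_idem_of DP'); congr lines_of; apply/seteqP; split=> // e Ee.
apply: contrapT => nE; apply: (Emax e) => [|f Ef]; first exact: EO'.1.
have fe : f <> e by move=> fe; apply: nE; rewrite -fe.
by have Ef' := sE _ Ef; split; [exact: (EO'.2 _ _ Ef' Ee fe)|exact: (EO'.2 _ _ Ee Ef' (nesym fe))].
Qed.

End Systems.

(** * gl and sl *)

Section Linear.
Context {R : realType} {V W : lmodType R[i]} (T : tensor_algebra V W).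
Local Notation K := R[i].
Implicit Types (x y s e f p q : T) (u v : V) (w : W) (a b : K) (g h E : set T).
Local Notation tens := (tens T).
Local Notation pair := (pairing T).

Lemma sl_algP x : sl_alg T x <-> trace x = 0.
Proof.
have hT : subspace [set x : T | trace x = 0].
  by split=> [|a y z /= hy hz]; rewrite /= ?trace0 // traceP hy hz mulr0 addr0.
split.
  apply: (lin_span_sub hT) => _ [y [z [_ _ ->]]] /=.
  by rewrite /bracket traceB traceC subrr.
(* A reference tensor of trace 1: subtracting [trace x] times it leaves a sum of brackets, a single
   one for pure tensors. *)
move=> tx; have [v' v'0 _] := act_kernel (0 : T); have [w' p'] := dual_left T v'0.
suff : sl_alg T (x - trace x *: tens v' w') by rewrite tx scale0r subr0.
move: x {tx}; apply: tens_ind => [|v w].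
  split; first by rewrite /= trace0 scale0r subr0; case: (subspace_lin_span
    [set z | exists x y : T, [/\ gl_alg T x, gl_alg T y & z = bracket x y]]).
  move=> a x y /= hx hy; rewrite traceP scalerDl -scalerA opprD addrACA -scalerBr.
  by case: (subspace_lin_span
    [set z | exists x y : T, [/\ gl_alg T x, gl_alg T y & z = bracket x y]]) => _; apply.
apply: sub_lin_span; exists (tens v w'), (tens v' w); split=> //.
by rewrite /bracket !tmulE p' scale1r trace_tens.
Qed.

Lemma gl_lie : lie_subalgebra (gl_alg T).
Proof. by []. Qed.

Lemma sl_lie : lie_subalgebra (sl_alg T).
Proof.
split; first exact: subspace_lin_span.
by move=> x y _ _; apply/sl_algP; rewrite /bracket traceB traceC subrr.
Qed.

Lemma sl_ss_closed : ss_closed (sl_alg T).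
Proof.
move=> x s /sl_algP tx [_ /trace_nilpotent tn _]; apply/sl_algP.
by move: tn; rewrite traceB tx sub0r => /eqP; rewrite oppr_eq0 => /eqP.
Qed.

Section Bijection.
Variables (g : set T) (F : nat -> set T).
Hypothesis gl : lie_subalgebra g.
Hypothesis gss : ss_closed g.
Hypothesis gsl : forall x, trace x = 0 -> g x.
Hypothesis gF : reductive_exhaustion g F.

(** z kills some u0, and a traceless x with x u0 = v gives z v = x z u0 = 0. The term in [tens a b]
    cancels the trace and vanishes on u0. *)
Lemma trace0_centerless : centerless g.
Proof.
move=> z zc; have [u0 u00 zu0] := act_kernel z.
have [w pw] := dual_left T u00.
have [b b0 hb] := kernel_right T (fun _ : 'I_1 => u0).
have [a pab] := dual_right T b0.
apply: act_inj => v; rewrite act0l.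
have gx : g (tens v w - pair v w *: tens a b).
  by apply: gsl; rewrite traceB traceZ !trace_tens pab mulr1 subrr.
have xv : act (tens v w - pair v w *: tens a b) u0 = v.
  by rewrite actBl actZl !act_tens pw (hb ord0) scale0r scaler0 subr0 scale1r.
by rewrite -[in LHS]xv -actM zc // actM zu0 act0r.
Qed.

Section MaximalSystem.
Variable E : set T.
Hypothesis EO : orth_idempotents E.
Hypothesis Emax : maximal_orth E.

Lemma maximal_orth_other e : E e -> exists2 f, E f & f <> e.
Proof.
move=> Ee; apply: contrapT => H.
have [f [rf ef fe]] := exists_orth_rank_one (EO.1 _ Ee).
apply: (Emax rf) => e' Ee'; suff -> : e' = e by [].
by apply: contrapT => ne; apply: H; exists e'.
Qed.

Lemma maximal_orth_separated e : E e ->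
  exists f, [/\ torus g E (e - f), f ** f = f, e ** f = 0 & f ** e = 0].
Proof.
move=> Ee; have [f Ef fe] := maximal_orth_other Ee; exists f; split.
- split; first by apply: gsl; rewrite traceB !rank_one_trace ?subrr //; exact: EO.1.
  by apply: (subspaceB (subspace_lin_span _)); exact: sub_lin_span.
- by apply: rank_one_idem; exact: EO.1.
- exact: (EO.2 _ _ Ee Ef (nesym fe)).
- exact: (EO.2 _ _ Ef Ee fe).
Qed.

(** If y y' u were not zero, y' u and a functional factoring through y would form a rank-one
    idempotent annihilated by [E]. *)
Lemma maximal_orth_mul0 y y' : annihilated E y -> annihilated E y' -> y ** y' = 0.
Proof.
move=> hy hy'; apply: act_inj => u; rewrite act0l actM.
apply/eqP; apply: contrapT => /negP yv0; set v := act y' u in yv0.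
have [w0 p0] := dual_left T yv0; have [w ew pw] := tens_tmul v w0 y.
apply: (@Emax (tens v w)); first by exists v, w; rewrite pw.
move=> e Ee; have [ey ye] := hy _ Ee; have [ey' y'e] := hy' _ Ee.
by rewrite tmul_tens /v -actM ey' act0l tensl0 -ew -tmulA ye tmul0r.
Qed.

Lemma maximal_orth_proj s y : lin_span E s -> annihilated E y -> g (s + y) -> g y.
Proof.
move=> _ hy _; apply: gsl; apply: trace_nilpotent => u; exists 2%N.
by rewrite /= -actM maximal_orth_mul0 // act0l.
Qed.

Lemma maximal_orth_nil x y z : g x -> g y -> g z -> annihilated E x -> annihilated E y ->
  annihilated E z -> x ** y ** z = 0.
Proof. by move=> _ _ _ hx hy _; rewrite (maximal_orth_mul0 hx hy) tmul0l. Qed.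

End MaximalSystem.

Lemma cartan_maximal_orth h : cartan_subalgebra g F h ->
  exists E, [/\ orth_idempotents E, maximal_orth E & h = centralizer g (torus g E)].
Proof.
move=> /(cartan_ss_set gss trace0_centerless gF) [hl hg hn hE].
pose E := cartan_idempotents h.
have sub_h x : g x -> (forall s, ss_set h s -> x ** s = s ** x) -> h x.
  by move=> gx cx; apply/(cartan_memP hE).
have corner p x y : E p -> p ** x = x /\ x ** p = x -> p ** y = y /\ y ** p = y ->
    trace x = 0 -> trace y = 0 -> bracket x y = 2 *: y -> y = 0.
  move=> Ep [px xp] [py yp] tx ty; apply: (cartan_no_eigen hn).
  - by apply: sub_h => [|s Ss]; [exact: gsl|exact: (cartan_corner_comm gss hg hn hE Ep px xp Ss)].
  - by apply: sub_h => [|s Ss]; [exact: gsl|exact: (cartan_corner_comm gss hg hn hE Ep py yp Ss)].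
  - by rewrite pnatr_eq0.
have EO : orth_idempotents E := cartan_orth_idempotents gss hg hn hE corner.
have Sspan := cartan_ss_span gss hg hn hE.
exists E; split=> //; last exact: (cartan_centralizer_torus gss hg hn hE corner).
move=> e re hEe; have e0 := rank_one_neq0 re; have ee := rank_one_idem re.
(* If f is in [E], the traceless semisimple e - f commutes with [S], so it lies in the span of [E],
   which e annihilates; but e (e - f) = e. *)
have [[f Ef]|noE] := pselect (exists f, E f).
  have [fe ef] := hEe _ Ef; have rf := EO.1 _ Ef.
  have Sx : ss_set h (e - f).
    apply: (cartan_ss_mem hE).
    - by apply: gsl; rewrite traceB !rank_one_trace // subrr.
    - apply: semisimpleD; first exact: rank_one_semisimple.
        by rewrite -scaleN1r; apply: semisimpleZ; exact: rank_one_semisimple.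
      by rewrite tmulNr tmulNl ef fe.
    - move=> s /Sspan Es; rewrite tmulBl tmulBr.
      have [h1 h2] := span_annihilated hEe Es.
      by rewrite h1 h2 (span_commE EO Es Ef).
  have [h1 _] := span_annihilated hEe (Sspan _ Sx).
  by move/eqP: e0; apply; rewrite -h1 tmulBl ee fe subr0.
(* If [E] is empty, [S] is zero and h contains all traceless operators, among them the Borel pair in
   the corner of [e + f], which has rank two. *)
have S0 s : ss_set h s -> s = 0.
  move=> /Sspan Es; apply: (lin_span_sub (S := [set 0]) _ _ Es).
    by split=> // a x y /= -> ->; rewrite scaler0 addr0.
  by move=> f Ef; case: noE; exists f.
have sub_h' x : trace x = 0 -> h x.
  by move=> tx; apply: sub_h => [|s /S0 ->]; [exact: gsl|rewrite tmul0l tmul0r].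
have [f [rf ef fe]] := exists_orth_rank_one re.
have tp : trace (e + f) = 2 by rewrite traceD !rank_one_trace.
have [||rp|[x [y [_ _ [tx ty] xy y0]]]] := @rank_one_or_borel _ _ _ T (e + f).
- by rewrite tmulDl !tmulDr ee ef fe (rank_one_idem rf) addr0 add0r.
- by apply/eqP => p0; move/eqP: tp; rewrite p0 trace0 eq_sym pnatr_eq0.
- by have /eqP := rank_one_trace rp; rewrite tp -subr_eq0 addrK oner_eq0.
- move/eqP: y0; apply; apply: (cartan_no_eigen hn _ _ _ xy); try exact: sub_h'.
  by rewrite pnatr_eq0.
Qed.

Lemma system_cartan_bij :
  set_bij (maximal_dual_system T) (cartan_subalgebra g F) (system_cartan g).
Proof.
have eqC D : maximal_dual_system T D ->
    system_cartan g D = centralizer g (torus g (idem_of (T := T) D)).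
  by move=> [/dual_system_pairing DP _]; rewrite /system_cartan system_torusE.
split.
- move=> D mD; rewrite eqC //; have [EO Emax _] := (maximal_dual_systemP T D).1 mD.
  apply/(cartan_ss_set gss trace0_centerless gF).
  exact: (centralizer_torus_cartan gl EO (maximal_orth_separated EO Emax)
    (@maximal_orth_proj _ Emax) (@maximal_orth_nil _ Emax)).
- move=> D D'; rewrite !inE => mD mD'; rewrite !eqC // => eh.
  have [EO Emax DE] := (maximal_dual_systemP T D).1 mD.
  have [EO' Emax' DE'] := (maximal_dual_systemP T D').1 mD'.
  rewrite DE DE'; congr lines_of.
  rewrite (recover_idempotents gl EO (maximal_orth_separated EO Emax)
    (@maximal_orth_proj _ Emax) (@maximal_orth_nil _ Emax)).
  rewrite [RHS](recover_idempotents gl EO' (maximal_orth_separated EO' Emax')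
    (@maximal_orth_proj _ Emax') (@maximal_orth_nil _ Emax')).
  by rewrite eh.
- move=> h /cartan_maximal_orth[E [EO Emax hE]]; exists (lines_of E).
    by apply/maximal_dual_systemP; rewrite idem_of_lines_of.
  rewrite eqC; last by apply/maximal_dual_systemP; rewrite idem_of_lines_of.
  by rewrite idem_of_lines_of.
Qed.

End Bijection.

End Linear.

(** * so and sp *)

Section Star.
Context {R : realType} {V : lmodType R[i]} (T : tensor_algebra V V).
Local Notation K := R[i].
Implicit Types (x y s e f p q : T) (u v w : V) (a b : K) (g h E : set T).
Local Notation tens := (tens T).
Local Notation pair := (pairing T).

(* [eps = 1] gives so and [eps = -1] gives sp. *)
Variable eps : K.
Hypothesis epsP : eps = 1 \/ eps = -1.
Hypothesis sym : forall u v, pair u v = eps * pair v u.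

Lemma eps2 : eps * eps = 1.
Proof. by case: epsP => ->; rewrite ?mulr1 // mulrNN mulr1. Qed.

Lemma eps_neq0 : eps != 0.
Proof. by case: epsP => ->; rewrite ?oppr_eq0 oner_neq0. Qed.

Lemma pair_self0 v : eps = -1 -> pair v v = 0.
Proof.
move=> e; have := sym v v; rewrite e mulN1r => /eqP.
by rewrite -addr_eq0 -mulr2n mulrn_eq0 => /eqP.
Qed.

Lemma star_exists : exists g : T -> T, (forall a x y, g (a *: x + y) = a *: g x + g y) /\
  forall v w, g (tens v w) = eps *: tens w v.
Proof.
apply: (tensor_lift (@tensP _ _ _ T)) => [w a v v'|v a w w'].
  by rewrite linearPr /= scalerDr !scalerA mulrC.
by rewrite linearPl /= scalerDr !scalerA mulrC.
Qed.

(** The adjoint for the form, see [star_adjoint]. *)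
Definition star : T -> T := sval (cid star_exists).

Lemma star_tens v w : star (tens v w) = eps *: tens w v.
Proof. by rewrite /star; case: cid => g []. Qed.

Lemma starP a x y : star (a *: x + y) = a *: star x + star y.
Proof. by rewrite /star; case: cid => g []. Qed.

Lemma star0 : star 0 = 0. Proof. exact: (lin_op0 starP). Qed.
Lemma starD x y : star (x + y) = star x + star y. Proof. exact: (lin_opD starP). Qed.
Lemma starN x : star (- x) = - star x. Proof. exact: (lin_opN starP). Qed.
Lemma starB x y : star (x - y) = star x - star y. Proof. exact: (lin_opB starP). Qed.
Lemma starZ a x : star (a *: x) = a *: star x. Proof. exact: (lin_opZ starP). Qed.

Lemma starK x : star (star x) = x.
Proof.
move: x; apply: tens_ind; first split; rewrite /= ?star0 //.
  by move=> a x y /= hx hy; rewrite !starP hx hy.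
by move=> v w; rewrite star_tens starZ star_tens scalerA eps2 scale1r.
Qed.

Lemma star_mul x y : star (x ** y) = star y ** star x.
Proof.
move: x; apply: tens_ind.
  split; first by rewrite /= tmul0l star0 tmul0r.
  by move=> a x x' /= hx hx'; rewrite tmulPl !starP hx hx' tmulPr.
move=> v w /=; move: y; apply: tens_ind.
  split; first by rewrite /= tmul0r star0 tmul0l.
  by move=> a x x' /= hx hx'; rewrite tmulPr !starP hx hx' tmulPl.
move=> v' w' /=; rewrite tmulE starZ !star_tens tmulZl tmulZr tmulE !scalerA eps2 mul1r.
by rewrite mulrC -sym.
Qed.

Lemma star_adjoint x u v : pair (act x u) v = pair u (act (star x) v).
Proof.
move: x; apply: tens_ind.
  split; first by rewrite /= star0 !act0l linear0l linear0r.
  by move=> a x y /= hx hy; rewrite starP !actPl pairPl pairPr hx hy.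
by move=> v' w'; rewrite /= star_tens actZl !act_tens !pairZl !pairZr mulrA -sym mulrC.
Qed.

Lemma star_rank_one e : rank_one e -> rank_one (star e).
Proof.
move=> [v [w [-> p]]]; exists (eps *: w), v.
by rewrite star_tens tensZl pairZl -sym.
Qed.

Definition skew : set T := [set x | star x = - x].

Lemma subspace_skew : subspace skew.
Proof.
split; first by rewrite /skew /= star0 oppr0.
by move=> a x y hx hy; rewrite /skew /= starP hx hy scalerN opprD.
Qed.

Lemma skew_star x : skew (x - star x).
Proof. by rewrite /skew /= starB starK opprB. Qed.

Lemma skew_span : lin_span [set z | exists u v, z = tens u v - eps *: tens v u] = skew.
Proof.
apply/seteqP; split.
  apply: lin_span_sub; first exact: subspace_skew.
  by move=> _ [u [v ->]]; rewrite -star_tens; exact: skew_star.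
move=> x hx; pose S := lin_span [set z | exists u v, z = tens u v - eps *: tens v u].
have hS : subspace S := subspace_lin_span _.
have h y : S (y - star y).
  move: y; apply: tens_ind.
    split; first by rewrite /= star0 subr0; case: hS.
    move=> a y z /= hy hz; rewrite starP opprD addrACA -scalerBr.
    by case: hS => _; apply.
  by move=> v w; rewrite /= star_tens; apply: sub_lin_span; exists v, w.
have -> : x = 2^-1 *: (x - star x).
  have -> : x - star x = 2 *: x by rewrite (hx : star x = - x) opprK scaler_nat mulr2n.
  by rewrite scalerA mulVf ?scale1r // pnatr_eq0.
exact: (subspaceZ _ hS).
Qed.

Lemma skew_lie : lie_subalgebra skew.
Proof.
split; first exact: subspace_skew.
move=> x y hx hy; rewrite /skew /= /bracket starB !star_mul hx hy.
by rewrite !tmulNl !tmulNr !opprK opprB.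
Qed.

Lemma skew_adjoint x u v : skew x -> pair (act x u) v = - pair u (act x v).
Proof. by move=> hx; rewrite star_adjoint hx actNl linearNr. Qed.

(** Skewness gives <(x - a)u, v> + <u, (x - b)v> = -(a + b)<u, v>, and the left-hand terms vanish by
    induction on m and k. *)
Lemma skew_generalized_orth x a b m k u v : skew x -> a + b != 0 ->
  poly_act (act x) (('X - a%:P) ^+ m) u = 0 ->
  poly_act (act x) (('X - b%:P) ^+ k) v = 0 -> pair u v = 0.
Proof.
move=> hx ab; elim: m k u v => [|m IHm] k u v.
  by rewrite expr0 poly_act1 => -> _; rewrite linear0l.
elim: k u v => [|k IHk] u v hu; first by rewrite expr0 poly_act1 => ->; rewrite linear0r.
move=> hv.
have h1 : pair (act x u - a *: u) v = 0.
  apply: (IHm k.+1) => //; move: hu; rewrite exprSr poly_actM; last exact: actPr.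
  by rewrite poly_act_XsubC //; exact: actPr.
have h2 : pair u (act x v - b *: v) = 0.
  apply: IHk => //; move: hv; rewrite exprSr poly_actM; last exact: actPr.
  by rewrite poly_act_XsubC //; exact: actPr.
apply: (mulfI ab); rewrite mulr0.
move: h1 h2; rewrite linearBl linearBr /= pairZl pairZr (skew_adjoint _ _ hx).
move=> /eqP; rewrite subr_eq0 => /eqP h1 /eqP; rewrite subr_eq0 => /eqP h2.
by rewrite mulrDl -h1 h2 addNr.
Qed.

(** Checked on generalized eigenvectors for a and b, where s acts by scalars: (a + b)<u', v'>
    vanishes by orthogonality. *)
Lemma skew_ss_closed : ss_closed skew.
Proof.
move=> x s hx xs; apply: act_inj => v; rewrite actNl.
apply/eqP; rewrite -subr_eq0 opprK; apply/eqP.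
case: (pairing_nondeg T) => _; apply=> u; rewrite linearDr /= -star_adjoint.
pose P u := pair (act s u) v + pair u (act s v) = 0.
have hP : subspace P.
  split; first by rewrite /P act0r !linear0l addr0.
  move=> a y z hy hz; rewrite /P actPr !pairPl addrACA -mulrDr hy hz mulr0.
  by rewrite addr0.
apply: (lin_span_sub hP _ (@primary_span_act _ _ _ T x u)) => u' [a [m hu]]; rewrite /P.
pose Q v := pair (act s u') v + pair u' (act s v) = 0.
have hQ : subspace Q.
  split; first by rewrite /Q act0r !linear0r addr0.
  move=> b y z hy hz; rewrite /Q actPr !pairPr addrACA -mulrDr hy hz mulr0.
  by rewrite addr0.
apply: (lin_span_sub hQ _ (@primary_span_act _ _ _ T x v)) => v' [b [k hv]]; rewrite /Q.
rewrite (ss_part_eigen xs hu) (ss_part_eigen xs hv) pairZl pairZr -mulrDl.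
have [->|ab] := eqVneq (a + b) 0; first by rewrite mul0r.
by rewrite (skew_generalized_orth hx ab hu hv) mulr0.
Qed.

Lemma skew_centerless : centerless skew.
Proof.
move=> z zc; apply: act_inj => v; rewrite act0l.
have [n [vz [wz ez]]] := tens_sum z.
(* Besides z u0 = 0, the condition <u0, v> = 0 removes the adjoint term, so that the skew element
   sends u0 to v. *)
have [u0 u00 hu0] := kernel_left T
  (fun i : 'I_n.+2 => if unlift ord0 i is Some k then wz k else v).
have zu0 : act z u0 = 0.
  rewrite ez act_suml big1 // => k _; rewrite act_tens.
  by have := hu0 (lift ord0 k); rewrite liftK => ->; rewrite scale0r.
have pv : pair u0 v = 0 by have := hu0 ord0; rewrite unlift_none.
have [w pw] := dual_left T u00.
have hx := skew_star (tens v w).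
have xu0 : act (tens v w - star (tens v w)) u0 = v.
  by rewrite actBl star_tens actZl !act_tens pw pv scale0r scaler0 subr0 scale1r.
by rewrite -[in LHS]xu0 -actM zc // actM zu0 act0r.
Qed.

(** Taking adjoints exchanges the lines of index i and -i; e <> [star e] reflects i <> -i. *)
Definition star_orth E := [/\ orth_idempotents E, forall e, E e -> E (star e) &
  forall e, E e -> e <> star e].

(** Only idempotents that can be adjoined with their adjoint are excluded: a unit vector of a
    symmetric form gives e = [star e] and may remain. *)
Definition maximal_star_orth E := forall e, rank_one e -> e ** star e = 0 ->
  star e ** e = 0 -> ~ annihilated E e.

Lemma star_orth_mul E e : star_orth E -> E e -> e ** star e = 0 /\ star e ** e = 0.
Proof.
move=> [[_ EO] Es En] Ee; split; apply: EO => //; try exact: Es.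
  exact: En.
exact: (nesym (En _ Ee)).
Qed.

Lemma annihilated_star E y : (forall e, E e -> E (star e)) -> annihilated E y ->
  annihilated E (star y).
Proof.
move=> Es hy e Ee; have [h1 h2] := hy _ (Es _ Ee).
split; rewrite -[e]starK -star_mul ?h1 ?h2 star0 //.
Qed.

Section MaximalSystem.
Variable E : set T.
Hypothesis ES : star_orth E.
Hypothesis Emax : maximal_star_orth E.

Let EO : orth_idempotents E. Proof. by case: ES. Qed.
Let Estar e : E e -> E (star e). Proof. by case: ES => _ + _; apply. Qed.

Lemma star_orth_separated e : E e ->
  exists f, [/\ torus skew E (e - f), f ** f = f, e ** f = 0 & f ** e = 0].
Proof.
move=> Ee; have [h1 h2] := star_orth_mul ES Ee; exists (star e); split=> //.
- split; first exact: skew_star.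
  by apply: (subspaceB (subspace_lin_span _)); apply: sub_lin_span => //; exact: Estar.
- by rewrite -star_mul (rank_one_idem (EO.1 _ Ee)).
Qed.

Lemma span_star x : lin_span E x -> lin_span E (star x).
Proof.
have hS : subspace [set x | lin_span E (star x)].
  have [h0 hS] := subspace_lin_span E.
  by split; rewrite /= ?star0 // => a y z /= hy hz; rewrite starP; exact: hS.
by apply: (lin_span_sub hS) => e Ee; apply: sub_lin_span; exact: Estar.
Qed.

(** [star y + y] is annihilated by [E] and lies in its span, being minus [s + star s]; so it is
    0. *)
Lemma star_orth_proj s y : lin_span E s -> annihilated E y -> skew (s + y) -> skew y.
Proof.
move=> Es hy; rewrite /skew /= starD => e.
have e' : star y + y = - (s + star s).
  apply/eqP; rewrite -subr_eq0 opprK addrC [s + star s]addrC addrACA e.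
  by rewrite addNr.
have : star y + y = 0.
  apply: (span_annihilated0 EO).
    move=> f Ef; have [h1 h2] := hy _ Ef; have [h3 h4] := annihilated_star Estar hy Ef.
    by rewrite tmulDl tmulDr h1 h2 h3 h4 !addr0.
  rewrite e'; apply: (subspaceN (subspace_lin_span _)).
  by apply: (subspaceD (subspace_lin_span _)) => //; exact: span_star.
by move/eqP; rewrite addr_eq0 => /eqP.
Qed.

Let V0 u := forall e, E e -> act e u = 0.

Let subV0 : subspace V0.
Proof.
split=> [e _|a u v hu hv e Ee]; first exact: act0r.
by rewrite actPr hu // hv // scaler0 addr0.
Qed.

Let no_hyperbolic u v : V0 u -> V0 v -> pair u u = 0 -> pair v v = 0 -> pair u v = 0.
Proof.
move=> hu hv uu vv; apply/eqP; apply: contrapT => /negP uv0.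
pose c := (pair u v)^-1.
apply: (@Emax (tens u (c *: v))).
- by exists u, (c *: v); rewrite pairZr mulVf.
- by rewrite star_tens tmulZr tmulE pairZl pairZr vv !mulr0 scale0r scaler0.
- by rewrite star_tens tmulZl tmulE uu scale0r scaler0.
move=> e Ee; split; first by rewrite tmul_tens hu // tensl0.
rewrite -[tens _ _]starK -[e]starK -star_mul star_tens tmulZr tmul_tens actZr.
by rewrite (hv _ (Estar Ee)) scaler0 tensl0 scaler0 star0.
Qed.

Let isotropic_radical u v : V0 u -> V0 v -> pair u u = 0 -> pair u v = 0.
Proof.
move=> hu hv uu; apply/eqP; apply: contrapT => /negP uv0.
(* Makes v - c u isotropic without changing its product with u. *)
pose c := pair v v / (2 * pair u v).
have hw : V0 (v - c *: u) by apply: (subspaceB subV0) => //; exact: (subspaceZ _ subV0).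
have puw : pair u (v - c *: u) = pair u v by rewrite linearBr /= pairZr uu mulr0 subr0.
have pww : pair (v - c *: u) (v - c *: u) = 0.
  rewrite linearBl /= pairZl puw linearBr /= pairZr [pair v u]sym /c.
  have [e|e] := epsP.
    by rewrite e mul1r; field; rewrite uv0.
  by rewrite (pair_self0 v e) !(mul0r, subr0).
by move/eqP: uv0; apply; rewrite -puw; exact: no_hyperbolic.
Qed.

Let annihilated_V0 y u : annihilated E y -> V0 (act y u).
Proof. by move=> hy e Ee; rewrite -actM (hy _ Ee).1 act0l. Qed.

(* If [u] and [c = act y u] were both anisotropic, they would span a hyperbolic
   plane. *)
Let V0_radical y u v : skew y -> annihilated E y -> V0 u -> V0 v -> pair (act y u) v = 0.
Proof.
move=> sy hy hu hv.
have [uu|uu] := eqVneq (pair u u) 0.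
  rewrite skew_adjoint // isotropic_radical ?oppr0 //; exact: annihilated_V0.
have eps1 : eps = 1.
  by case: epsP => // e; move: uu; rewrite (pair_self0 u e) eqxx.
have symm (u1 u2 : V) : pair u1 u2 = pair u2 u1 by rewrite sym eps1 mul1r.
have hc : V0 (act y u) by exact: annihilated_V0.
set c := act y u in hc *.
have cu : pair c u = 0.
  have /eqP : pair c u = - pair u c := skew_adjoint u u sy.
  by rewrite [pair u c]symm -addr_eq0 -mulr2n mulrn_eq0 => /eqP.
have [cc|cc] := eqVneq (pair c c) 0; first exact: isotropic_radical.
(* Makes u + m c isotropic, c being orthogonal to u. It is then orthogonal to u, against <u, u> <>
   0. *)
pose m := sqrtC (- pair u u / pair c c).
have hd : V0 (u + m *: c) by apply: (subspaceD subV0) => //; exact: (subspaceZ _ subV0).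
have dd : pair (u + m *: c) (u + m *: c) = 0.
  rewrite linearDl linearDr /= linearDr /= !pairZl !pairZr [pair u c]symm cu !mulr0 addr0 add0r.
  by rewrite mulrA -expr2 sqrtCK divfK // addrN.
have := isotropic_radical hd hu dd; rewrite linearDl pairZl cu mulr0 addr0 => uu0.
by move: uu; rewrite uu0 eqxx.
Qed.

(** z maps into the common kernel of [E], and y maps that kernel into its radical; moving x across
    the pairing leaves a product of a radical vector with a vector of the kernel. *)
Lemma star_orth_nil x y z : skew x -> skew y -> skew z -> annihilated E x -> annihilated E y ->
  annihilated E z -> x ** y ** z = 0.
Proof.
move=> sx sy _ hx hy hz; apply: act_inj => u; rewrite act0l !actM.
set r := act y _; case: (pairing_nondeg T) => + _; apply=> v.
rewrite skew_adjoint // V0_radical ?oppr0 //; exact: annihilated_V0.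
Qed.

End MaximalSystem.

Local Notation idem D := (idem_of (T := T) (D, D)).

Section LinesOfStar.
Variable E : set T.
Hypothesis ES : star_orth E.

Let EO : orth_idempotents E. Proof. by case: ES. Qed.
Let Estar e : E e -> E (star e). Proof. by case: ES => _ + _; apply. Qed.

Lemma lines_of_star : lines_of E = ((lines_of E).1, (lines_of E).1).
Proof.
rewrite [LHS]surjective_pairing; congr (_, _); apply/seteqP.
split=> _ [v [w [/Estar Evw p ->]]]; rewrite star_tens in Evw.
  exists (eps *: w), v; split; last by rewrite line_ofZ ?eps_neq0.
    by rewrite tensZl.
  by rewrite pairZl -sym.
exists w, (eps *: v); split; last by rewrite line_ofZ ?eps_neq0.
  by rewrite tensZr.
by rewrite pairZr -sym.
Qed.

(** In each pair e, [star e] the member with the smaller code under an injection into nat gets a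
    positive index, its adjoint the opposite one. *)
Lemma lines_of_self_dual_system : self_dual_system T (lines_of E).1.
Proof.
have cE := countable_orth_idempotents EO.
have /pcard_injP[f finj] := cE.
pose E' := [set e | E e /\ (f e < f (star e))%N].
have sE' : E' `<=` E by move=> e [].
have [I [g [hI I0 ginj gI]]] := countable_enumeration (0 : T) (sub_countable (subset_card_le sE') cE).
pose J := [set i : int | i != 0 /\ I `|i|%N].
pose ee (i : int) := if 0 <= i then g `|i|%N else star (g `|i|%N).
have gE i : I i -> E' (g i) by move=> Ii; rewrite -gI; exists i.
have eeE i : J i -> E (ee i).
  by move=> [_ /gE /sE' Eg]; rewrite /ee; case: ifP => // _; exact: Estar.
have eeN i : i != 0 -> ee (- i) = star (ee i).
  move=> i0; rewrite /ee oppr_ge0 abszN; case: ltrgtP i0 => //= _ _.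
  by rewrite starK.
have JN i : J i -> J (- i) by move=> [i0 Ii]; split; rewrite ?oppr_eq0 ?abszN.
have eeinj i j : J i -> J j -> ee i = ee j -> i = j.
  move=> [i0 Ii] [j0 Ij]; have [Egi fi] := gE _ Ii; have [Egj fj] := gE _ Ij.
  rewrite /ee; case: (lerP 0 i) => hi; case: (lerP 0 j) => hj e.
  - by have := ginj _ _ Ii Ij e => /(congr1 Posz); rewrite !gez0_abs.
  - by move: fi fj; rewrite e starK => h1 /(ltn_trans h1); rewrite ltnn.
  - by move: fi fj; rewrite -e starK => h1 h2; have := ltn_trans h1 h2; rewrite ltnn.
  - have /(ginj _ _ Ii Ij)/(congr1 Posz) : g `|i|%N = g `|j|%N by rewrite -[LHS]starK e starK.
    by rewrite !ltz0_abs // => /oppr_inj.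
have eesurj e : E e -> exists2 i, J i & ee i = e.
  move=> Ee; have Es := Estar Ee.
  have [lt|gt|eq] := ltngtP (f e) (f (star e)).
  - have [n In gn] : (g @` I) e by rewrite gI.
    by exists (Posz n) => //; split=> //; have := I0 _ In; rewrite /= lt0n.
  - have [n In gn] : (g @` I) (star e) by rewrite gI; split=> //; rewrite starK.
    have n0 : Posz n != 0 by have := I0 _ In; rewrite /= lt0n.
    exists (- Posz n); first by apply: JN; split.
    by rewrite eeN // /ee /= gn starK.
  - by have [_ _ /(_ _ Ee)] := ES; case; apply: finj => //; rewrite inE.
have [vv [ww hvw]] := orth_tens_choice EO.
have lN i : J i -> line_of (vv (ee (- i))) = line_of (ww (ee i)).
  move=> Ji; have [e p] := hvw _ (eeE _ Ji); have [e' p'] := hvw _ (eeE _ (JN _ Ji)).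
  have e2 : tens (vv (ee (- i))) (ww (ee (- i))) = tens (eps *: ww (ee i)) (vv (ee i)).
    by rewrite -e' eeN ?(proj1 Ji) // {1}e star_tens tensZl.
  have [|-> _] := tens_lines_eq e2 p'; first by rewrite pairZl -sym.
  by rewrite line_ofZ ?eps_neq0.
exists J, (fun i => line_of (vv (ee i))); split.
- case: hI => [fin|hI]; [left|right]; last first.
    by apply/seteqP; split=> [i [//]|i i0]; split=> //; rewrite hI /= absz_gt0.
  split; last by split=> [i []//|i]; split=> /JN; rewrite ?opprK.
  apply: (sub_finite_set (B := [set Posz n | n in I] `|` [set - Posz n | n in I])).
    move=> i [i0 Ii]; case: (lerP 0 i) => hi; [left|right]; exists `|i|%N => //.
      by rewrite gez0_abs.
    by rewrite ltz0_abs // opprK.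
  by rewrite finite_setU; split; exact: finite_image.
- by move=> i Ji; have [_ p] := hvw _ (eeE _ Ji); apply: line_line_of; exact: (pair1_neq0 p).1.
- move=> i j Ji Jj.
  have lj : line_of (vv (ee j)) = line_of (ww (ee (- j))).
    by rewrite -lN ?opprK //; exact: JN.
  rewrite lj.
  have [ei pi] := hvw _ (eeE _ Ji); have [ej pj] := hvw _ (eeE _ (JN _ Jj)).
  have Ei : E (tens (vv (ee i)) (ww (ee i))) by rewrite -ei; exact: eeE.
  have Ej : E (tens (vv (ee (- j))) (ww (ee (- j)))) by rewrite -ej; apply: eeE; exact: JN.
  rewrite (pair_sets_lines EO Ei pi Ej pj) -ei -ej.
  have [->|nij] := eqVneq i (- j); first by rewrite eqxx.
  by case: eqP => // /(eeinj _ _ Ji (JN _ Jj)) e; rewrite e eqxx in nij.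
- apply/seteqP; split=> [_ [v [w [Evw p ->]]]|_ [i Ji <-]].
    have [i Ji ei] := eesurj _ Evw.
    exists i => //; have [e p'] := hvw _ Evw.
    by have [-> _] := tens_lines_eq e p p'; rewrite ei.
  by have [e p] := hvw _ (eeE _ Ji); exists (vv (ee i)), (ww (ee i)); rewrite -e; split=> //; exact: eeE.
Qed.

End LinesOfStar.

Lemma self_dual_system_pairing D : self_dual_system T D ->
  pairing_system T (D, D) /\ star_orth (idem D).
Proof.
move=> [I [L [hI Ll LL ->]]].
have IN i : I i -> I (- i) /\ i != 0.
  case: hI => [[_ [I0 IN]] Ii|-> /= i0]; last by rewrite oppr_eq0.
  by split; [exact: ((IN i).1 Ii)|exact: I0].
have cpl i : I i -> exists v w, [/\ L i v, L (- i) w & pair v w = 1].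
  move=> Ii; have [INi _] := IN _ Ii; have := LL i (- i) Ii INi; rewrite opprK eqxx => h.
  have [v [w [Lv Mw e]]] : pair_sets T (L i) (L (- i)) 1 by rewrite h.
  by exists v, w.
have sep k l u v : I k -> I l -> L k u -> L l v -> pair u v != 0 -> k = - l.
  move=> Ik Il Lu Lv h0; apply/eqP; apply: contraTT h0 => /negbTE kl.
  have : pair_sets T (L k) (L l) (pair u v) by exists u, v.
  by rewrite LL // kl => ->; rewrite eqxx.
have DP : pairing_system T (L @` I, L @` I).
  split=> /=.
  - by move=> _ [i /Ll h <-].
  - by move=> _ [i /Ll h <-].
  - move=> _ [i Ii <-]; have [v [w [Lv Mw p]]] := cpl i Ii.
    by exists (L (- i)), v, w; split=> //; exists (- i) => //; exact: (IN _ Ii).1.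
  - move=> _ [i Ii <-]; have [INi _] := IN _ Ii.
    have [v [w [Lv]]] := cpl _ INi; rewrite opprK => Mw p.
    by exists (L (- i)), v, w; split=> //; exists (- i).
  move=> _ _ _ _ v w v' w' [i Ii <-] [j Ij <-] [i' Ii' <-] [j' Ij' <-] Lv Mw Lv' Mw' p p' p0.
  have e1 : i = - j by apply: (sep _ _ v w) => //; rewrite p oner_neq0.
  have e2 : i' = - j' by apply: (sep _ _ v' w') => //; rewrite p' oner_neq0.
  have e3 : i = - j' by apply: (sep _ _ v w').
  by rewrite e2 -e3; split=> //; congr L; apply: oppr_inj; rewrite -e1.
split=> //; split; first exact: idem_of_orth.
  move=> _ [v [w [hv [M DM Mw] p ->]]]; exists (eps *: w), v; split=> //.
  - exists M => //; have [D1 _ _ _ _] := DP.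
    exact: (subspaceZ _ (line_subspace (D1 _ DM))).
  - by rewrite pairZl -sym.
  - by rewrite star_tens tensZl.
move=> _ [v [w [_ [_ [j Ij <-] Lw] p ->]]] es.
(* j <> -j makes each line isotropic; an e equal to its adjoint would then have square zero. *)
have ww0 : pair w w = 0.
  apply/eqP; apply: contrapT => /negP h0.
  have /eqP := sep _ _ _ _ Ij Ij Lw Lw h0.
  by rewrite -addr_eq0 -mulr2n mulrn_eq0 /=; apply/negP; exact: (IN _ Ij).2.
have : tens v w ** star (tens v w) = 0.
  by rewrite star_tens tmulZr tmulE ww0 scale0r scaler0.
rewrite -es tmulE p scale1r => h; have [v0 w0] := pair1_neq0 p.
by move: (tens_neq0 T v0 w0); rewrite h eqxx.
Qed.

Lemma star_orth1 E e : star_orth E -> rank_one e -> e ** star e = 0 -> star e ** e = 0 ->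
  annihilated E e -> star_orth (E `|` [set e; star e]).
Proof.
move=> [EO Es En] re h1 h2 hE; have hE' := annihilated_star Es hE.
have re' := star_rank_one re.
have nee : e <> star e.
  move=> h; move/eqP: (rank_one_neq0 re); apply.
  by rewrite -(rank_one_idem re) {2}h.
split.
- split=> [f [/EO.1//|[->|->]//]|x y [Ex|[->|->]] [Ey|[->|->]] ne] //.
  + exact: EO.2.
  + by have [] := hE _ Ex.
  + by have [] := hE' _ Ex.
  + by have [] := hE _ Ey.
  + by have [] := hE' _ Ey.
- move=> f [Ef|[->|->]]; [by left; exact: Es|by right; right|by right; left; rewrite starK].
- move=> f [Ef|[->|->]] //; [exact: En|by rewrite starK; exact: nesym].
Qed.

Lemma maximal_self_dual_systemP D : maximal_self_dual_system T D <->
  [/\ star_orth (idem D), maximal_star_orth (idem D) & (D, D) = lines_of (idem D)].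
Proof.
split=> [[dD Dmax]|[ES Emax DE]].
  have [DP ES] := self_dual_system_pairing dD; have [EO _ _] := ES.
  split=> //; last by rewrite lines_of_idem_of.
  move=> e re h1 h2 hE; have ES' := star_orth1 ES re h1 h2 hE; have [EO' _ _] := ES'.
  have [s1 _] := lines_ofS (@subsetUl _ (idem D) [set e; star e]).
  have := Dmax _ (lines_of_self_dual_system ES'); rewrite lines_of_idem_of // in s1 *.
  move=> /(_ s1) eD; have Ee : idem D e.
    by rewrite -eD -(lines_of_star ES') idem_of_lines_of //; right; left.
  have [h _] := hE _ Ee; move/eqP: (rank_one_neq0 re); apply.
  by rewrite -h rank_one_idem.
have [EO _ _] := ES.
have dD : self_dual_system T D.
  have -> : D = (lines_of (idem D)).1 by rewrite -DE.
  exact: lines_of_self_dual_system.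
split=> // D' dD' s1; have [DP' ES'] := self_dual_system_pairing dD'; have [EO' _ _] := ES'.
have sE : idem D `<=` idem D' by exact: idem_ofS.
suff eE : idem D' = idem D.
  by have /(congr1 fst) := lines_of_idem_of DP'; rewrite eE -DE.
apply/seteqP; split=> // e Ee; apply: contrapT => nE.
have [h1 h2] := star_orth_mul ES' Ee.
apply: (Emax e) => // [|f Ef]; first exact: EO'.1.
have fe : f <> e by move=> fe; apply: nE; rewrite -fe.
by have Ef' := sE _ Ef; split; [exact: (EO'.2 _ _ Ef' Ee fe)|exact: (EO'.2 _ _ Ee Ef' (nesym fe))].
Qed.

Section Bijection.
Variables (g : set T) (F : nat -> set T).
Hypothesis gE : g = skew.
Hypothesis gF : reductive_exhaustion g F.

Let gF' : reductive_exhaustion skew F. Proof. by rewrite -gE. Qed.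

Lemma skew_cartan_star_orth h : cartan_subalgebra skew F h ->
  exists E, [/\ star_orth E, maximal_star_orth E & h = centralizer skew (torus skew E)].
Proof.
move=> /(cartan_ss_set skew_ss_closed skew_centerless gF') [hl hg hn hE].
pose S := ss_set h; pose E := cartan_idempotents h.
have Sh : S `<=` h := cartan_ss_sub skew_ss_closed hg hn hE.
have Sstar s : S s -> star s = - s by move=> /Sh /hg.
(* [star] reverses products and negates [S], so it preserves the commutant of [S]. *)
have star_comm y : (forall s, S s -> s ** y = y ** s) -> forall s, S s -> s ** star y = star y ** s.
  move=> hy s Ss; rewrite -[s]starK (Sstar _ Ss) starN tmulNl tmulNr; congr (- _).
  by rewrite -!star_mul -hy.
have Ecomm p s : E p -> S s -> p ** s = s ** p.
  move=> Ep Ss; have [_ pp _ _ _] := Ep.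
  exact: (cartan_corner_comm skew_ss_closed hg hn hE Ep pp pp Ss).
have Estar p : E p -> E (star p).
  move=> Ep; have [Pp pp p0 [s Ss ps0] pmin] := Ep; split.
  - move=> y hy; rewrite -[y]starK -!star_mul; congr star; apply/esym; apply: Pp.
    exact: star_comm.
  - by rewrite -star_mul pp.
  - by apply: contraNneq p0 => h0; rewrite -[p]starK h0 star0.
  - exists s => //; apply: contraNneq ps0 => h0.
    by rewrite (Ecomm _ _ Ep Ss) -[_ ** p]starK star_mul (Sstar _ Ss) tmulNr h0 oppr0 star0.
  - move=> q Pq qq pq; have [|||h0|h0] := pmin (star q).
    + move=> y hy; rewrite -[y]starK -!star_mul; congr star; apply/esym; apply: Pq.
      exact: star_comm.
    + by rewrite -star_mul qq.
    + have qs : q ** star p = star p ** q.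
        apply: Pq => s' Ss'; apply: star_comm => // s'' Ss''; apply/esym; exact: Ecomm.
      by rewrite -[p]starK -star_mul qs pq.
    + by left; rewrite -[q]starK h0 star0.
    + by right; rewrite -[q]starK h0.
(* As p is not killed by [S], some s has s p = a p with a <> 0; taking adjoints, p = [star p] would
   give a = -a. *)
have Enstar p : E p -> p <> star p.
  move=> Ep ps; have [_ pp p0 [s Ss ps0] _] := Ep.
  have [a ha] := cartan_idempotents_scalar skew_ss_closed hg hn hE Ep Ss.
  have : a *: p = - (a *: p).
    by rewrite {1}ps -starZ -ha star_mul (Sstar _ Ss) -ps tmulNr (Ecomm _ _ Ep Ss).
  move/eqP; rewrite -addr_eq0 -mulr2n -scaler_nat !scaler_eq0 pnatr_eq0 /= (negbTE p0) orbF.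
  by move=> /eqP a0; move/eqP: ps0; apply; rewrite (Ecomm _ _ Ep Ss) ha a0 scale0r.
have pps p : E p -> p ** star p = 0 /\ star p ** p = 0.
  move=> Ep; have Es := Estar _ Ep; have Orth := cartan_idempotents_orth skew_ss_closed hg hn hE.
  by split; apply: Orth => //; [exact: Enstar|exact: nesym (Enstar _ Ep)].
have sub_h x : skew x -> (forall s, S s -> x ** s = s ** x) -> h x.
  by move=> gx cx; apply/(cartan_memP hE).
have corner p x y : E p -> p ** x = x /\ x ** p = x -> p ** y = y /\ y ** p = y ->
    trace x = 0 -> trace y = 0 -> bracket x y = 2 *: y -> y = 0.
  move=> Ep [px xp] [py yp] _ _ xy; have [pps1 pps2] := pps _ Ep.
  have mem z : p ** z = z -> z ** p = z -> h (z - star z).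
    move=> pz zp; apply: sub_h => [|s Ss]; first exact: skew_star.
    have c := cartan_corner_comm skew_ss_closed hg hn hE Ep pz zp.
    rewrite tmulBl tmulBr (c _ Ss); congr (_ - _).
    by apply/esym; apply: star_comm Ss => s' Ss'; rewrite (c _ Ss').
  have mul0 z t : z ** p = z -> t ** p = t -> z ** star t = 0.
    by move=> zp tp; rewrite -zp -tp star_mul tmulA -[z ** p ** star p]tmulA pps1 tmul0r tmul0l.
  have mul0' z t : p ** z = z -> p ** t = t -> star z ** t = 0.
    by move=> pz pt; rewrite -pz -pt star_mul tmulA -[star z ** star p ** p]tmulA pps2 tmul0r tmul0l.
  (* Orthogonality of p and [star p] removes the mixed products, so z - [star z] respects brackets
     on the corner of p. *)
  have e : bracket (x - star x) (y - star y) = 2 *: (y - star y).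
    rewrite scalerBr -starZ -xy /bracket !tmulBl !tmulBr.
    rewrite !(mul0 _ _ xp yp, mul0 _ _ yp xp, mul0' _ _ px py, mul0' _ _ py px).
    rewrite starB !star_mul !sub0r !subr0 !opprK !opprD.
    by rewrite addrACA opprK [star x ** star y - _]addrC.
  have y0 : y - star y = 0.
    by apply: (cartan_no_eigen hn _ _ _ e); [exact: mem|exact: mem|rewrite pnatr_eq0].
  move/eqP: y0; rewrite subr_eq0 => /eqP ys.
  by rewrite -py ys -yp star_mul tmulA pps1 tmul0l.
have EO : orth_idempotents E := cartan_orth_idempotents skew_ss_closed hg hn hE corner.
exists E; split; [by split| |exact: (cartan_centralizer_torus skew_ss_closed hg hn hE corner)].
move=> e re es se hEe.
(* A semisimple skew element annihilated by [E]; its vanishing contradicts [e ** star e = 0]. *)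
have x0 : e - star e = 0.
  apply: (cartan_annihilated skew_ss_closed hg hn hE corner).
  - exact: skew_star.
  - apply: semisimpleD; first exact: rank_one_semisimple.
      by rewrite -scaleN1r; apply: semisimpleZ; apply: rank_one_semisimple; exact: star_rank_one.
    by rewrite tmulNr tmulNl es se.
  - move=> f Ef; have [h1 h2] := hEe _ Ef; have [h3 h4] := annihilated_star Estar hEe Ef.
    by rewrite tmulBl tmulBr h1 h2 h3 h4 subrr.
move/eqP: (rank_one_neq0 re); apply.
by move/eqP: x0; rewrite subr_eq0 => /eqP x0; rewrite -(rank_one_idem re) {2}x0.
Qed.

Lemma self_dual_system_cartan_bij :
  set_bij (maximal_self_dual_system T) (cartan_subalgebra g F)
    (fun D => system_cartan g (D, D)).
Proof.
rewrite gE; have eqC D : maximal_self_dual_system T D ->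
    system_cartan skew (D, D) = centralizer skew (torus skew (idem D)).
  by move=> [/self_dual_system_pairing[DP _] _]; rewrite /system_cartan system_torusE.
split.
- move=> D mD; rewrite eqC //; have [ES Emax _] := (maximal_self_dual_systemP D).1 mD.
  have [EO _ _] := ES.
  apply/(cartan_ss_set skew_ss_closed skew_centerless gF').
  exact: (centralizer_torus_cartan skew_lie EO (@star_orth_separated _ ES)
    (@star_orth_proj _ ES) (@star_orth_nil _ ES Emax)).
- move=> D D'; rewrite !inE => mD mD'; rewrite !eqC // => eh.
  have [ES Emax DE] := (maximal_self_dual_systemP D).1 mD; have [EO _ _] := ES.
  have [ES' Emax' DE'] := (maximal_self_dual_systemP D').1 mD'; have [EO' _ _] := ES'.
  suff : (D, D) = (D', D') by case.
  rewrite DE DE'; congr lines_of.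
  rewrite (recover_idempotents skew_lie EO (@star_orth_separated _ ES)
    (@star_orth_proj _ ES) (@star_orth_nil _ ES Emax)).
  rewrite [RHS](recover_idempotents skew_lie EO' (@star_orth_separated _ ES')
    (@star_orth_proj _ ES') (@star_orth_nil _ ES' Emax')).
  by rewrite eh.
- move=> h /skew_cartan_star_orth[E [ES Emax hE]]; have [EO _ _] := ES.
  have eE : idem (lines_of E).1 = E by rewrite -(lines_of_star ES) idem_of_lines_of.
  have mD : maximal_self_dual_system T (lines_of E).1.
    by apply/maximal_self_dual_systemP; rewrite eE -(lines_of_star ES).
  by exists (lines_of E).1 => //; rewrite eqC // eE.
Qed.

End Bijection.

End Star.

Theorem corollary4p11 (R : realType) :
  [/\ forall (V W : lmodType R[i]) (T : tensor_algebra V W) (F : nat -> set T),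
        reductive_exhaustion (gl_alg T) F ->
        set_bij (maximal_dual_system T) (cartan_subalgebra (gl_alg T) F)
          (system_cartan (gl_alg T)),
      forall (V W : lmodType R[i]) (T : tensor_algebra V W) (F : nat -> set T),
        reductive_exhaustion (sl_alg T) F ->
        set_bij (maximal_dual_system T) (cartan_subalgebra (sl_alg T) F)
          (system_cartan (sl_alg T)),
      forall (V : lmodType R[i]) (T : tensor_algebra V V) (F : nat -> set T),
        symmetric_pairing T ->
        reductive_exhaustion (so_alg T) F ->
        set_bij (maximal_self_dual_system T) (cartan_subalgebra (so_alg T) F)
          (fun D => system_cartan (so_alg T) (D, D)) &
      forall (V : lmodType R[i]) (T : tensor_algebra V V) (F : nat -> set T),
        antisymmetric_pairing T ->
        reductive_exhaustion (sp_alg T) F ->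
        set_bij (maximal_self_dual_system T) (cartan_subalgebra (sp_alg T) F)
          (fun D => system_cartan (sp_alg T) (D, D))].
Proof.
split=> [V W T F hF|V W T F hF|V T F hsym hF|V T F hsym hF].
- exact: (system_cartan_bij (@gl_lie _ _ _ T) (fun _ _ _ _ => I) (fun _ _ => I) hF).
- apply: (system_cartan_bij (@sl_lie _ _ _ T) (@sl_ss_closed _ _ _ T)) => //.
  by move=> x /sl_algP.
- have sym u v : pairing T u v = 1 * pairing T v u by rewrite mul1r.
  apply: (self_dual_system_cartan_bij (or_introl erefl) sym) => //.
  rewrite -(skew_span T (or_introl erefl)); congr lin_span; apply/seteqP.
  by split=> _ [u [v ->]]; exists u, v; rewrite scale1r.
- have sym u v : pairing T u v = -1 * pairing T v u by rewrite mulN1r.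
  apply: (self_dual_system_cartan_bij (or_intror erefl) sym) => //.
  rewrite -(skew_span T (or_intror erefl)); congr lin_span; apply/seteqP.
  by split=> _ [u [v ->]]; exists u, v; rewrite scaleN1r opprK.
Qed.
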